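(* Let $\alpha>0$ and consider on $L^2(\mathbb{R}_x)$ the time-dependent Hamiltonian $$H_s=\tfrac12\bigl(p^2+\omega_s^2x^2\bigr),\qquad \omega_s=\alpha|s|,\qquad p=-\mathrm{i}\tfrac{d}{dx}.$$ For $t>0$ let $\mathcal{U}(t,-t)$ be the unitary propagator from time $-t$ to time $t$ of the Schrödinger equation $\mathrm{i}\,\partial_s\psi(s)=H_s\psi(s)$. Put $\omega=\omega_t=\omega_{-t}=\alpha t$ and $a=(2\omega)^{-1/2}(\omega x+\mathrm{i}p)$. Let $\psi_0$ be the normalized vacuum ($a\psi_0=0$), which is the ground state of $H_{-t}=H_t$, and let $\psi_n=(n!)^{-1/2}(a^* )^n\psi_0$. Then $\psi(t):=\mathcal{U}(t,-t)\psi_0$ is a squeezed state with parameter $r(t)e^{\mathrm{i}\theta(t)}$, and as $t\to\infty$ $$e^{\mathrm{i}\theta(t)}=e^{-\mathrm{i}(\alpha t^2+\pi/2)}+o(1),\qquad \tanh r(t)=\frac{1}{\sqrt2}+o(1).$$ Consequently the probabilities $p_n(t)=|\langle\psi_n,\psi(t)\rangle|^2$ satisfy, for all $k\ge 0$, $$\lim_{t\to\infty}p_{2k}(t)=\frac{1}{2^k\sqrt2}\cdot\frac{(2k-1)!!}{(2k)!!},\qquad p_{2k+1}(t)=0 .$$ In particular the limiting fidelity is $p_0(+\infty)=1/\sqrt2$, and none of these limits depends on $\alpha$.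
   Context: Squeezed states: fix $\omega>0$ and set $a=(2\omega)^{-1/2}(\omega x+\mathrm{i}p)$ on $L^2(\mathbb{R})$. For $\lambda,\mu\in\mathbb{C}$ with $|\mu|<|\lambda|$ there is a normalized $\psi$ with $(\lambda a+\mu a^* )\psi=0$, and it is unique up to a phase. It is called the squeezed state with parameter $\tau=re^{\mathrm{i}\theta}$, where $r\ge0$ and $\theta\in[0,2\pi)$ are defined by $\mu/\lambda=e^{\mathrm{i}\theta}\tanh r$. The convention $(2k-1)!!=1$ is used for $k=0$. *)

(* Defs.v *)
From Stdlib Require Import Reals Lra Factorial.
From Coquelicot Require Import Coquelicot.
Open Scope R_scope.

Definition cexp (th : R) : C := (cos th, sin th).

(* double factorial on nat: 0!! = 1!! = 1, (n+2)!! = (n+2) n!!.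
   (2k-1)!! is written dfact (2*k - 1); for k = 0 the truncated
   subtraction gives dfact 0 = 1, matching the convention (-1)!! = 1. *)
Fixpoint dfact (n : nat) : nat :=
  match n with
  | O => 1%nat
  | S O => 1%nat
  | S (S m as p) => (n * dfact m)%nat
  end.

Definition omega_s (alpha s : R) : R := alpha * Rabs s.

Definition Cderiv (f : R -> C) (x : R) : C :=
  (Derive (fun y => fst (f y)) x, Derive (fun y => snd (f y)) x).

Definition Cdiff (f : R -> C) (x : R) : Prop :=
  ex_derive (fun y => fst (f y)) x /\ ex_derive (fun y => snd (f y)) x.

Definition C2fun (f : R -> C) : Prop :=
  (forall x, Cdiff f x) /\ (forall x, Cdiff (Cderiv f) x) /\
  (forall x, continuous (fun y => fst (Cderiv (Cderiv f) y)) x /\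
             continuous (fun y => snd (Cderiv (Cderiv f) y)) x).

Definition Rline_int (g : R -> R) : R :=
  RInt_gen g (Rbar_locally m_infty) (Rbar_locally p_infty).

Definition L2 (f : R -> C) : Prop :=
  ex_RInt_gen (fun x => Cmod (f x) ^ 2) (Rbar_locally m_infty) (Rbar_locally p_infty).

Definition L2norm2 (f : R -> C) : R := Rline_int (fun x => Cmod (f x) ^ 2).

Definition inner (f g : R -> C) : C :=
  (Rline_int (fun x => fst (Cmult (Cconj (f x)) (g x))),
   Rline_int (fun x => snd (Cmult (Cconj (f x)) (g x)))).

(* H_w f = 1/2 (p^2 + w^2 x^2) f = -1/2 f'' + 1/2 w^2 x^2 f *)
Definition Hop (w : R) (f : R -> C) (x : R) : C :=
  Cplus (Cmult (RtoC (- / 2)) (Cderiv (Cderiv f) x))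
        (Cmult (RtoC (/ 2 * w ^ 2 * x ^ 2)) (f x)).

(* a = (2w)^{-1/2} (w x + i p) = (2w)^{-1/2} (w x + d/dx),
   a^dagger = (2w)^{-1/2} (w x - d/dx) *)
Definition aop (w : R) (f : R -> C) (x : R) : C :=
  Cmult (RtoC (/ sqrt (2 * w))) (Cplus (Cmult (RtoC (w * x)) (f x)) (Cderiv f x)).

Definition astar (w : R) (f : R -> C) (x : R) : C :=
  Cmult (RtoC (/ sqrt (2 * w))) (Cminus (Cmult (RtoC (w * x)) (f x)) (Cderiv f x)).

(* normalized vacuum (a psi0 = 0, ||psi0|| = 1), phase fixed to be real positive *)
Definition psi0 (w : R) (x : R) : C :=
  RtoC (Rpower (w / PI) (/ 4) * exp (- (w * x ^ 2) / 2)).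

Definition psi_n (w : R) (n : nat) (x : R) : C :=
  Cmult (RtoC (/ sqrt (INR (fact n)))) (Nat.iter n (astar w) (psi0 w) x).

(* operator domain used for strong solutions: C^2, with f, f'', x^2 f in L^2
   (on this domain every H_w is symmetric) *)
Definition in_dom (f : R -> C) : Prop :=
  C2fun f /\ L2 f /\ L2 (Cderiv (Cderiv f)) /\ L2 (fun x => Cmult (RtoC (x ^ 2)) (f x)).

(* Psi is a strong solution on [-t, t] of  i d/ds Psi(s) = H_{omega_s} Psi(s),
   with Psi(-t) = psi0 (omega = alpha t); derivative taken in L^2 norm
   (one-sided at the endpoints).  Psi(t) = U(t,-t) psi0. *)
Definition solves (alpha t : R) (Psi : R -> R -> C) : Prop :=
  (forall x, Psi (- t) x = psi0 (alpha * t) x) /\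
  (forall s, - t <= s <= t -> in_dom (Psi s)) /\
  (forall s, - t <= s <= t ->
     forall eps, 0 < eps -> exists delta, 0 < delta /\
       forall h, h <> 0 -> Rabs h < delta -> - t <= s + h <= t ->
         L2norm2 (fun x => Cplus (Cmult (RtoC (/ h)) (Cminus (Psi (s + h) x) (Psi s x)))
                                 (Cmult Ci (Hop (omega_s alpha s) (Psi s) x))) < eps).

Definition is_squeezed (w : R) (psi : R -> C) (r th : R) : Prop :=
  L2norm2 psi = 1 /\
  exists lam mu : C,
    Cmod mu < Cmod lam /\
    (forall x, Cplus (Cmult lam (aop w psi x)) (Cmult mu (astar w psi x)) = RtoC 0) /\
    0 <= r /\ 0 <= th < 2 * PI /\
    Cdiv mu lam = Cmult (cexp th) (RtoC (tanh r)).

(* Main.v *)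
Require Import Defs.
From Stdlib Require Import Reals Factorial Lra Lia FunctionalExtensionality.
From Coquelicot Require Import Coquelicot.
From Corelib Require Import ssreflect.
Open Scope R_scope.

(** The classical oscillator [y'' + alpha^2 s^2 y = 0] governs everything. If [y] is its complex solution with
    [y'(-t) = i w y(-t)], [w = alpha t], then [gamma = y'/y] solves [gamma' = - gamma^2 - alpha^2 s^2] with positive
    imaginary part, and the Gaussian [exp (l + i gamma x^2 / 2)] with [l' = - gamma / 2] is a strong solution of the
    Schrodinger equation. It is the only one, because the norm of the difference of two strong solutions is conserved.
    Hence [psi(t)] is squeezed with ratio [mu / lambda = - (w + i gamma) / (w - i gamma)] at time [t], and integrating
    by parts against the Hermite functions gives all its overlaps in terms of that ratio.

    The ratio only depends on the phases of the even and odd real solutions of the oscillator. Both are read off the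
    single solution [f(s) = exp (i alpha s^2 / 2) * int exp (- c s q^2 - q^4 / 2) dq], [c = sqrt alpha (1 - i)]: its
    values at [0] give [Re f + Im f] even and [Im f] odd, while as [s] grows
    [sqrt s * f(s) ~ exp (i alpha s^2 / 2) * J] with [J^2 = pi / c], whose phase is [pi / 4]. *)

(** * Improper integrals over the line *)

(** The domain [in_dom] controls [f], [f''] and [x^2 f] but says nothing about [f']. This is the
    obstacle to conservation of the norm: the boundary terms of the integration by parts cannot be
    bounded directly, and are only shown to be small at suitable endpoints. The solution called
    [weber] is [sqrt PI * D_{-1/2} (c s)], a parabolic cylinder function. The quartic term makes its
    integral converge for both signs of [s], so that one formula links the data at 0 with the
    behaviour at infinity. The limit [1 / sqrt 2] is the cosine of [PI / 4]: the modulus of the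
    ratio is the cosine, up to sign, of the angle between the phase-space points of the even and the
    odd solution, and this angle tends to the one between [1 + i] and [i]. It goes back to the
    direction [-1 + i] of [f'(0)], which [alpha] affects only by a positive factor. Integrals and
    derivatives are total functions in the statement, so each value needs a proof that it exists;
    hence the relational forms [is_lint], [is_Clint] and [is_Cder]. *)

Definition is_lint (g : R -> R) (l : R) : Prop :=
  is_RInt_gen g (Rbar_locally m_infty) (Rbar_locally p_infty) l.

Definition ex_lint (g : R -> R) : Prop :=
  ex_RInt_gen g (Rbar_locally m_infty) (Rbar_locally p_infty).

Definition cont (g : R -> R) : Prop := forall x, continuous g x.

Lemma cont_ex_RInt g a b : cont g -> ex_RInt g a b.
Proof. intros Hg. apply: ex_RInt_continuous => z _. apply Hg. Qed.

(** The two endpoints go to infinity independently, as the product filter of [is_RInt_gen] demands;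
    continuity supplies the integrals over bounded intervals. *)
Lemma is_lintP g l : cont g ->
  (is_lint g l <-> forall eps, 0 < eps -> exists M, forall a b, a < - M -> M < b ->
     Rabs (RInt g a b - l) < eps).
Proof.
intros Hg; split.
- intros H eps He.
  destruct (H (ball l (mkposreal eps He))) as [Q S [M1 HQ] [M2 HS] HQS].
  { exists (mkposreal eps He) => //. }
  exists (Rmax (- M1) M2) => a b Ha Hb.
  assert (Q a). { apply HQ. pose proof (Rmax_l (- M1) M2). lra. }
  assert (S b). { apply HS. pose proof (Rmax_r (- M1) M2). lra. }
  destruct (HQS a b) as [y [Hy1 Hy2]] => //.
  rewrite (is_RInt_unique _ _ _ _ Hy1). exact Hy2.
- intros H P [eps HP].
  destruct (H eps (cond_pos eps)) as [M HM].
  exists (fun a => a < - M) (fun b => M < b).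
  + exists (- M) => //.
  + exists M => //.
  + intros a b Ha Hb. exists (RInt g a b). split.
    * apply: RInt_correct. by apply cont_ex_RInt.
    * apply HP. by apply HM.
Qed.

Lemma is_lint_ext f g l : (forall x, f x = g x) -> is_lint f l -> is_lint g l.
Proof.
intros H. apply (is_RInt_gen_ext (V := R_NormedModule) f g).
exists (fun _ => True) (fun _ => True); try (exists 0 => //). intros; apply H.
Qed.

Lemma is_lint_plus f g a b : is_lint f a -> is_lint g b -> is_lint (fun x => f x + g x) (a + b).
Proof. intros. by apply: is_RInt_gen_plus. Qed.

Lemma is_lint_minus f g a b : is_lint f a -> is_lint g b -> is_lint (fun x => f x - g x) (a - b).
Proof. intros. by apply: is_RInt_gen_minus. Qed.

Lemma is_lint_scal f k a : is_lint f a -> is_lint (fun x => k * f x) (k * a).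
Proof. intros. by apply: is_RInt_gen_scal. Qed.

Lemma is_lint_0 : is_lint (fun _ => 0) 0.
Proof.
apply is_lintP. { intros x; apply continuous_const. }
intros eps He; exists 0; intros a b _ _.
rewrite RInt_const /scal /= /mult /= Rmult_0_r Rminus_0_r Rabs_R0 //.
Qed.

Lemma is_lint_unique f l : is_lint f l -> Rline_int f = l.
Proof. intros H. exact (is_RInt_gen_unique (V := R_CompleteNormedModule) f l H). Qed.

Lemma ex_lint_correct f : ex_lint f -> is_lint f (Rline_int f).
Proof. intros H. exact (RInt_gen_correct (V := R_CompleteNormedModule) f H). Qed.

Lemma is_lint_inj f a b : is_lint f a -> is_lint f b -> a = b.
Proof. intros H1 H2. by rewrite -(is_lint_unique _ _ H1) -(is_lint_unique _ _ H2). Qed.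

Lemma is_lint_abs f g a b : (forall x, Rabs (f x) <= g x) -> is_lint f a -> is_lint g b -> Rabs a <= b.
Proof.
intros H Ha Hb.
apply: (@RInt_gen_norm _ (Rbar_locally m_infty) (Rbar_locally p_infty) _ _ f g) => //.
- exists (fun a => a < 0) (fun b => 0 < b); [by exists 0|by exists 0|]. simpl; intros; lra.
- exists (fun a => True) (fun b => True); [by exists 0|by exists 0|]. intros; apply H.
Qed.

Lemma is_lint_le f g a b : (forall x, f x <= g x) -> is_lint f a -> is_lint g b -> a <= b.
Proof.
intros H Ha Hb.
assert (0 <= b - a); [|lra].
apply Rle_trans with (Rabs 0); [rewrite Rabs_R0; lra|].
apply (is_lint_abs (fun _ => 0) (fun x => g x - f x)).
- intros x. rewrite Rabs_R0. specialize (H x). lra.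
- apply is_lint_0.
- by apply is_lint_minus.
Qed.

Lemma is_lint_ge0 f a : (forall x, 0 <= f x) -> is_lint f a -> 0 <= a.
Proof. intros H Ha. by apply (is_lint_le (fun _ => 0) f); [| apply is_lint_0 |]. Qed.

Lemma RInt_mono_interval f a a0 b0 b : cont f -> (forall x, 0 <= f x) ->
  a <= a0 -> a0 <= b0 -> b0 <= b -> RInt f a0 b0 <= RInt f a b.
Proof.
intros Hf H0 H1 H2 H3.
assert (E := fun x y => cont_ex_RInt f x y Hf).
rewrite -(RInt_Chasles f a a0 b) // -(RInt_Chasles f a0 b0 b) //.
rewrite /plus /=.
assert (0 <= RInt f a a0) by (apply RInt_ge_0 => //).
assert (0 <= RInt f b0 b) by (apply RInt_ge_0 => //).
lra.
Qed.

Lemma RInt_le_lint f a b l : cont f -> (forall x, 0 <= f x) -> a <= b -> is_lint f l -> RInt f a b <= l.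
Proof.
intros Hf H0 Hab Hl. apply Rnot_lt_le => Hlt.
destruct (proj1 (is_lintP f l Hf) Hl (RInt f a b - l)) as [M HM]; [lra|].
set (a' := Rmin a (- M - 1)). set (b' := Rmax b (M + 1)).
assert (a' <= a /\ a' <= - M - 1) as [] by (split; [apply Rmin_l|apply Rmin_r]).
assert (b <= b' /\ M + 1 <= b') as [] by (split; [apply Rmax_l|apply Rmax_r]).
assert (RInt f a b <= RInt f a' b') by (apply RInt_mono_interval => //).
specialize (HM a' b' ltac:(lra) ltac:(lra)).
pose proof (Rle_abs (RInt f a' b' - l)). lra.
Qed.

(** For a nonnegative integrand the integrals grow with the interval, so their supremum is their
    limit. *)
Lemma ex_lint_bounded f M : cont f -> (forall x, 0 <= f x) ->
  (forall a b, a <= b -> RInt f a b <= M) -> ex_lint f.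
Proof.
intros Hf H0 HM.
destruct (completeness (fun y => exists a b, a <= b /\ y = RInt f a b)) as [l [Hl1 Hl2]].
- exists M. intros y [a [b [Hab ->]]]. by apply HM.
- exists (RInt f 0 0), 0, 0. split => //. lra.
- exists l. apply is_lintP => // eps He.
  destruct (Classical_Prop.classic (exists a b, a <= b /\ l - eps < RInt f a b)) as [[a [b [Hab Hlt]]]|Hn].
  + exists (Rmax (Rabs a) (Rabs b)). intros a' b' Ha' Hb'.
    pose proof (Rmax_l (Rabs a) (Rabs b)). pose proof (Rmax_r (Rabs a) (Rabs b)).
    pose proof (Rle_abs (- a)). rewrite Rabs_Ropp in H2. pose proof (Rle_abs b).
    assert (RInt f a b <= RInt f a' b') by (apply RInt_mono_interval => //; lra).
    assert (RInt f a' b' <= l). { apply Hl1. exists a', b'. split => //. lra. }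
    rewrite Rabs_left1; lra.
  + exfalso. assert (l <= l - eps); [|lra].
    apply Hl2. intros y [a [b [Hab ->]]]. apply Rnot_lt_le => Hlt. apply Hn. by exists a, b.
Qed.

(** * Closure of continuity, and tests for convergence over the line *)

Lemma cont_plus f g : cont f -> cont g -> cont (fun x => f x + g x).
Proof. intros Hf Hg x. by apply: continuous_plus. Qed.
Lemma cont_minus f g : cont f -> cont g -> cont (fun x => f x - g x).
Proof. intros Hf Hg x. by apply: continuous_minus. Qed.
Lemma cont_mult f g : cont f -> cont g -> cont (fun x => f x * g x).
Proof. intros Hf Hg x. by apply: continuous_mult. Qed.
Lemma cont_const c : cont (fun _ => c).
Proof. intros x. apply continuous_const. Qed.
Lemma cont_id : cont (fun x => x).
Proof. intros x. apply continuous_id. Qed.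
Lemma cont_opp f : cont f -> cont (fun x => - f x).
Proof. intros Hf x. by apply: continuous_opp. Qed.
Lemma cont_pow f n : cont f -> cont (fun x => f x ^ n).
Proof.
intros Hf. induction n; simpl. apply cont_const. by apply cont_mult. Qed.
Lemma cont_abs f : cont f -> cont (fun x => Rabs (f x)).
Proof. intros Hf x. apply (continuous_comp f Rabs) => //. apply continuous_Rabs. Qed.
Lemma cont_derive f : (forall x, ex_derive f x) -> cont f.
Proof. intros H x. apply: ex_derive_continuous. apply H. Qed.
Lemma cont_comp f g : cont f -> cont g -> cont (fun x => f (g x)).
Proof. intros Hf Hg x. apply (continuous_comp g f) => //. Qed.
Lemma cont_exp : cont exp.
Proof. apply cont_derive => x. auto_derive. easy. Qed.
Lemma cont_cos : cont cos.
Proof. apply cont_derive => x. auto_derive. easy. Qed.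
Lemma cont_sin : cont sin.
Proof. apply cont_derive => x. auto_derive. easy. Qed.
Lemma cont_ext f g : (forall x, f x = g x) -> cont f -> cont g.
Proof. intros H Hf x. apply (continuous_ext f) => //. Qed.

Lemma ex_lint_plus f g : ex_lint f -> ex_lint g -> ex_lint (fun x => f x + g x).
Proof. intros [a Ha] [b Hb]. exists (a + b). by apply is_lint_plus. Qed.
Lemma ex_lint_minus f g : ex_lint f -> ex_lint g -> ex_lint (fun x => f x - g x).
Proof. intros [a Ha] [b Hb]. exists (a - b). by apply is_lint_minus. Qed.
Lemma ex_lint_scal k f : ex_lint f -> ex_lint (fun x => k * f x).
Proof. intros [a Ha]. exists (k * a). by apply is_lint_scal. Qed.
Lemma ex_lint_ext f g : (forall x, f x = g x) -> ex_lint f -> ex_lint g.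
Proof. intros H [a Ha]. exists a. by apply (is_lint_ext f). Qed.

Lemma ex_lint_comparison f g : cont f -> cont g -> (forall x, Rabs (f x) <= g x) ->
  ex_lint g -> ex_lint f.
Proof.
intros Hf Hg H [l Hl].
(* The shift by [g] makes the integrand nonnegative, with [f + g] between 0 and [2 g], so it
   suffices to bound the partial integrals. *)
apply (ex_lint_ext (fun x => (f x + g x) - g x)); [intros; ring|].
apply ex_lint_minus; [|by exists l].
assert (B : forall x, 0 <= f x + g x <= 2 * g x).
{ intros x. specialize (H x). apply Rabs_le_between in H. lra. }
assert (Hc : cont (fun x => 2 * g x)) by (apply cont_mult; [apply cont_const|exact Hg]).
apply (ex_lint_bounded _ (2 * l)).
- by apply cont_plus.
- intros x; apply B.
- intros a b Hab. apply Rle_trans with (RInt (fun x => 2 * g x) a b).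
  + apply RInt_le => //; try (apply cont_ex_RInt => //; by apply cont_plus). intros x _; apply B.
  + apply RInt_le_lint => //. { intros x. specialize (B x). lra. } by apply is_lint_scal.
Qed.

Lemma ex_lint_inv_1px2 : ex_lint (fun x => / (1 + x ^ 2)).
Proof.
assert (H1 : forall x : R, 0 < 1 + x ^ 2) by (intros; nra).
assert (Hc : cont (fun x => / (1 + x ^ 2))).
{ apply cont_derive => x. auto_derive. specialize (H1 x). lra. }
apply (ex_lint_bounded _ PI) => //.
- intros x. left. by apply Rinv_0_lt_compat.
- intros a b Hab.
  rewrite (is_RInt_unique _ a b (atan b - atan a)).
  + pose proof (atan_bound a). pose proof (atan_bound b). lra.
  + apply: is_RInt_derive.
    * intros x _. auto_derive. easy. unfold Rsqr. field. specialize (H1 x). simpl in H1. lra.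
    * intros x _. apply Hc.
Qed.

(** The weight [1 / (1 + x^2)] is the common reference below: its primitive is [atan], and a
    multiple of it dominates any polynomial times a Gaussian. *)
Lemma ex_lint_decay f C : cont f -> (forall x, Rabs (f x) <= C * / (1 + x ^ 2)) -> ex_lint f.
Proof.
intros Hf H. apply (ex_lint_comparison f (fun x => C * / (1 + x ^ 2))) => //.
- apply cont_derive => x. auto_derive. nra.
- apply ex_lint_scal, ex_lint_inv_1px2.
Qed.

Lemma is_lint_derive F f la lb : (forall x, is_derive F x (f x)) -> cont f ->
  is_lim F m_infty (Finite la) -> is_lim F p_infty (Finite lb) -> is_lint f (lb - la).
Proof.
intros HF Hf Ha Hb. apply is_lintP => // eps He.
apply is_lim_spec in Ha. apply is_lim_spec in Hb.
assert (He2 : 0 < eps / 2) by lra.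
destruct (Ha (mkposreal _ He2)) as [M1 H1]. destruct (Hb (mkposreal _ He2)) as [M2 H2].
simpl in H1, H2.
exists (Rmax (- M1) M2). intros a b Hlta Hltb.
pose proof (Rmax_l (- M1) M2). pose proof (Rmax_r (- M1) M2).
rewrite (is_RInt_unique f a b (F b - F a)).
- specialize (H1 a ltac:(lra)). specialize (H2 b ltac:(lra)).
  apply Rabs_def2 in H1. apply Rabs_def2 in H2. apply Rabs_def1; lra.
- apply: is_RInt_derive => x _; [apply HF|apply Hf].
Qed.

Lemma is_lim_decay F C : (forall x, Rabs (F x) <= C * / (1 + x ^ 2)) ->
  is_lim F m_infty 0 /\ is_lim F p_infty 0.
Proof.
intros H.
assert (HC : 0 <= C). { specialize (H 0). pose proof (Rabs_pos (F 0)). replace (/ (1 + 0 ^ 2)) with 1 in H by field. lra. }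
(* As [Rabs x <= 1 + x^2], this threshold already gives [C < eps * (1 + x^2)]. *)
assert (K : forall eps : posreal, forall x, (C + 1) / eps < Rabs x -> Rabs (F x - 0) < eps).
{ intros eps x Hx. rewrite Rminus_0_r. eapply Rle_lt_trans; [apply H|].
  assert (He := cond_pos eps).
  assert (H1 : 0 < 1 + x ^ 2) by nra.
  apply Rmult_lt_reg_r with (1 + x ^ 2) => //.
  rewrite Rmult_assoc Rinv_l; [|lra]. rewrite Rmult_1_r.
  apply Rmult_lt_compat_r with (r := eps) in Hx => //.
  unfold Rdiv in Hx. rewrite Rmult_assoc Rinv_l in Hx; [|lra].
  rewrite -(pow2_abs x). assert (0 <= eps * (1 + Rabs x ^ 2 - Rabs x)); [|lra].
  apply Rmult_le_pos; [lra|]. nra. }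
split; apply is_lim_spec; intros eps.
- exists (- ((C + 1) / eps)). intros x Hx. apply K. rewrite Rabs_left1; [lra|].
  assert (0 <= (C + 1) / eps). { apply Rdiv_le_0_compat; [lra|apply cond_pos]. } lra.
- exists ((C + 1) / eps). intros x Hx. apply K. eapply Rlt_le_trans; [apply Hx|apply Rle_abs].
Qed.

Lemma is_lint_derive_decay F f C : (forall x, is_derive F x (f x)) -> cont f ->
  (forall x, Rabs (F x) <= C * / (1 + x ^ 2)) -> is_lint f 0.
Proof.
intros HF Hf H. replace 0 with (0 - 0) by ring.
destruct (is_lim_decay F C H). by apply (is_lint_derive F).
Qed.

Lemma is_lint_pos_eq0 f : cont f -> (forall x, 0 <= f x) -> is_lint f 0 -> forall x, f x = 0.
Proof.
intros Hf H0 Hl x. apply Rle_antisym; [|apply H0]. apply Rnot_lt_le => Hx.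
assert (H : locally x (fun y => f x / 2 < f y)).
{ apply (Hf x (fun z => f x / 2 < z)). apply (open_gt (f x / 2)). lra. }
destruct H as [d Hd]. assert (Hdp := cond_pos d).
assert (RInt f (x - d / 2) (x + d / 2) <= 0) by (apply RInt_le_lint => //; lra).
assert (RInt (fun _ => f x / 2) (x - d / 2) (x + d / 2) <= RInt f (x - d / 2) (x + d / 2)).
{ apply RInt_le; try (apply cont_ex_RInt => //; apply cont_const); [lra|].
  intros y Hy. left. apply Hd. rewrite /ball /= /AbsRing_ball /abs /minus /plus /opp /=.
  apply Rabs_def1; lra. }
rewrite RInt_const /scal /= /mult /= in H1. nra.
Qed.

Ltac cont_auto := repeat match goal with
  | H : cont ?f |- cont ?f => exact H
  | |- cont (fun _ => ?c) => apply (cont_const c)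
  | |- cont (fun x => x) => apply cont_id
  | |- cont (fun x => @?f x + @?g x) => apply (cont_plus f g)
  | |- cont (fun x => @?f x - @?g x) => apply (cont_minus f g)
  | |- cont (fun x => @?f x * @?g x) => apply (cont_mult f g)
  | |- cont (fun x => - @?f x) => apply (cont_opp f)
  | |- cont (fun x => (@?f x) ^ ?n) => apply (cont_pow f n)
  | |- cont (fun x => Rabs (@?f x)) => apply (cont_abs f)
  | |- cont (fun x => exp (@?f x)) => apply (cont_comp exp f); [apply cont_exp|]
  | |- cont (fun x => cos (@?f x)) => apply (cont_comp cos f); [apply cont_cos|]
  | |- cont (fun x => sin (@?f x)) => apply (cont_comp sin f); [apply cont_sin|]
  end.

(** * Symmetry of the kinetic term *)

Lemma increment_RInt F f a b : a <= b -> (forall x, is_derive F x (f x)) -> cont f ->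
  F b - F a = RInt f a b.
Proof.
intros Hab HF Hf. symmetry. apply is_RInt_unique.
apply: is_RInt_derive => x _; [apply HF|apply Hf].
Qed.

(* If the Wronskian stayed away from 0, then [p1^2 + p2^2] would have a linearly growing integral,
   so [d1^2 + d2^2], whose second derivative is [2 (p1^2 + p2^2)] up to an integrable term,
   would grow and could not be integrable. *)
Lemma wronskian_small_right d1 d2 p1 p2 k1 k2 A B :
  (forall x, is_derive d1 x (p1 x)) -> (forall x, is_derive d2 x (p2 x)) ->
  (forall x, is_derive p1 x (k1 x)) -> (forall x, is_derive p2 x (k2 x)) ->
  cont k1 -> cont k2 ->
  (forall a b, a <= b -> RInt (fun x => d1 x ^ 2 + d2 x ^ 2) a b <= A) ->
  (forall a b, a <= b -> RInt (fun x => k1 x ^ 2 + k2 x ^ 2) a b <= B) ->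
  forall eps M, 0 < eps -> exists x, M < x /\ Rabs (d1 x * p2 x - d2 x * p1 x) < eps.
Proof.
intros D1 D2 P1 P2 K1 K2 HA HB eps M He.
apply Classical_Prop.NNPP => Hn.
assert (Hg : forall x, M < x -> eps <= Rabs (d1 x * p2 x - d2 x * p1 x)).
{ intros x Hx. apply Rnot_lt_le => Hlt. apply Hn. by exists x. }
assert (cd1 : cont d1) by (apply cont_derive => x; eexists; apply D1).
assert (cd2 : cont d2) by (apply cont_derive => x; eexists; apply D2).
assert (cp1 : cont p1) by (apply cont_derive => x; eexists; apply P1).
assert (cp2 : cont p2) by (apply cont_derive => x; eexists; apply P2).
set (G := fun x => 2 * (d1 x * p1 x + d2 x * p2 x)).
set (G' := fun x => 2 * (p1 x ^ 2 + p2 x ^ 2 + d1 x * k1 x + d2 x * k2 x)).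
assert (cG' : cont G').
{ unfold G'. cont_auto. }
assert (DG : forall x, is_derive G x (G' x)).
{ intros x. unfold G, G'. auto_derive.
  - repeat split; eexists; eauto.
  - rewrite (is_derive_unique _ _ _ (D1 x)) (is_derive_unique _ _ _ (D2 x))
      (is_derive_unique _ _ _ (P1 x)) (is_derive_unique _ _ _ (P2 x)). ring. }
assert (cF : cont (fun x => d1 x ^ 2 + d2 x ^ 2)) by cont_auto.
assert (cK : cont (fun x => k1 x ^ 2 + k2 x ^ 2)) by cont_auto.
set (m := M + 1).
(* The Wronskian is at most half of [d1^2 + d2^2 + p1^2 + p2^2], so [2 (p1^2 + p2^2) >= 4 eps - 2
   (d1^2 + d2^2)]. The cross terms [2 (d1 k1 + d2 k2)] cost one more [d1^2 + d2^2] and one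
   [k1^2 + k2^2], whence the coefficients 3 and 1. *)
assert (LG : forall X, m <= X -> 4 * eps * (X - m) - 3 * A - B + G m <= G X).
{ intros X HX.
  assert (E := increment_RInt G G' m X HX DG cG').
  assert (RInt (fun x => 4 * eps - 3 * (d1 x ^ 2 + d2 x ^ 2) - (k1 x ^ 2 + k2 x ^ 2)) m X <= RInt G' m X).
  { apply RInt_le => //; try apply cont_ex_RInt => //.
    - cont_auto.
    - intros x Hx. specialize (Hg x ltac:(unfold m in *; lra)). unfold G'.
      assert (Rabs (d1 x * p2 x - d2 x * p1 x) <= (d1 x ^ 2 + d2 x ^ 2 + p1 x ^ 2 + p2 x ^ 2) / 2).
      { pose proof (pow2_ge_0 (d1 x - p2 x)). pose proof (pow2_ge_0 (d2 x + p1 x)).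
        pose proof (pow2_ge_0 (d1 x + p2 x)). pose proof (pow2_ge_0 (d2 x - p1 x)).
        apply Rabs_le. split; lra. }
      pose proof (pow2_ge_0 (d1 x + k1 x)). pose proof (pow2_ge_0 (d2 x + k2 x)). lra. }
  assert (E2 : RInt (fun x => 4 * eps - 3 * (d1 x ^ 2 + d2 x ^ 2) - (k1 x ^ 2 + k2 x ^ 2)) m X
     = 4 * eps * (X - m) - 3 * RInt (fun x => d1 x ^ 2 + d2 x ^ 2) m X - RInt (fun x => k1 x ^ 2 + k2 x ^ 2) m X).
  { apply is_RInt_unique.
    apply: (is_RInt_minus (fun x => 4 * eps - 3 * (d1 x ^ 2 + d2 x ^ 2))).
    - apply: (is_RInt_minus (fun _ => 4 * eps)).
      + replace (4 * eps * (X - m)) with (scal (X - m) (4 * eps)) by (rewrite /scal /= /mult /=; ring).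
        apply: is_RInt_const.
      + apply: is_RInt_scal. apply: RInt_correct. by apply cont_ex_RInt.
    - apply: RInt_correct. by apply cont_ex_RInt. }
  specialize (HA m X HX). specialize (HB m X HX). lra. }
set (X0 := m + Rabs ((3 * A + B - G m + 1) / (4 * eps))).
assert (LG1 : forall X, X0 <= X -> 1 <= G X).
{ intros X HX.
  assert (H1 : (3 * A + B - G m + 1) / (4 * eps) <= X - m).
  { eapply Rle_trans; [apply Rle_abs|]. unfold X0 in HX. lra. }
  assert (H2 : 0 <= X - m).
  { unfold X0 in HX. pose proof (Rabs_pos ((3 * A + B - G m + 1) / (4 * eps))). lra. }
  apply Rmult_le_compat_l with (r := 4 * eps) in H1; [|lra].
  replace (4 * eps * ((3 * A + B - G m + 1) / (4 * eps))) with (3 * A + B - G m + 1) in H1 by (field; lra).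
  specialize (LG X ltac:(lra)). lra. }
assert (LF : forall X, X0 <= X -> X - X0 <= d1 X ^ 2 + d2 X ^ 2).
{ intros X HX.
  assert (cG : cont G) by (apply cont_derive => x; eexists; apply DG).
  assert (E := increment_RInt (fun x => d1 x ^ 2 + d2 x ^ 2) G X0 X HX).
  rewrite /= in E. rewrite -/(pow _ 2) in E.
  assert (RInt (fun _ => 1) X0 X <= RInt G X0 X).
  { apply RInt_le => //; try apply cont_ex_RInt => //. apply cont_const. intros x Hx. apply LG1. lra. }
  rewrite RInt_const /scal /= /mult /= in H.
  assert (0 <= d1 X0 ^ 2 + d2 X0 ^ 2) by nra.
  rewrite -E in H => //.
  - simpl in *. lra.
  - intros x. unfold G. auto_derive.
    + repeat split; eexists; eauto.
    + rewrite (is_derive_unique _ _ _ (D1 x)) (is_derive_unique _ _ _ (D2 x)). ring. }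
assert (0 <= A). { specialize (HA 0 0 ltac:(lra)). rewrite RInt_point in HA. exact HA. }
(* Beyond [X0 + 1] the integrand is at least 1, so a window of length [A + 1] violates the bound
   [A]. *)
specialize (HA (X0 + 1) (X0 + 1 + (A + 1)) ltac:(lra)).
assert (RInt (fun _ => 1) (X0 + 1) (X0 + 1 + (A + 1)) <= RInt (fun x => d1 x ^ 2 + d2 x ^ 2) (X0 + 1) (X0 + 1 + (A + 1))).
{ apply RInt_le => //; try apply cont_ex_RInt => //; [lra|apply cont_const|].
  intros x Hx. specialize (LF x ltac:(lra)). lra. }
rewrite RInt_const /scal /= /mult /= in H0. simpl in HA. lra.
Qed.

Lemma RInt_reflect f a b : cont f -> RInt (fun x => f (- x)) a b = RInt f (- b) (- a).
Proof.
intros Hf. apply is_RInt_unique.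
assert (H : is_RInt f (- a) (- b) (RInt f (- a) (- b))) by (apply: RInt_correct; by apply cont_ex_RInt).
apply is_RInt_comp_opp in H. apply is_RInt_opp in H.
replace (RInt f (- b) (- a)) with (opp (RInt f (- a) (- b))).
- revert H. apply is_RInt_ext => x _. rewrite /opp /=. ring.
- rewrite -(opp_RInt_swap f (- b) (- a)); [by rewrite opp_opp|by apply cont_ex_RInt].
Qed.

Lemma wronskian_small_left d1 d2 p1 p2 k1 k2 A B :
  (forall x, is_derive d1 x (p1 x)) -> (forall x, is_derive d2 x (p2 x)) ->
  (forall x, is_derive p1 x (k1 x)) -> (forall x, is_derive p2 x (k2 x)) ->
  cont k1 -> cont k2 ->
  (forall a b, a <= b -> RInt (fun x => d1 x ^ 2 + d2 x ^ 2) a b <= A) ->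
  (forall a b, a <= b -> RInt (fun x => k1 x ^ 2 + k2 x ^ 2) a b <= B) ->
  forall eps M, 0 < eps -> exists x, x < - M /\ Rabs (d1 x * p2 x - d2 x * p1 x) < eps.
Proof.
intros D1 D2 P1 P2 K1 K2 HA HB eps M He.
assert (cd1 : cont d1) by (apply cont_derive => x; eexists; apply D1).
assert (cd2 : cont d2) by (apply cont_derive => x; eexists; apply D2).
assert (R1 : forall f f' : R -> R, (forall x, is_derive f x (f' x)) ->
   forall x, is_derive (fun y => f (- y)) x (- f' (- x))).
{ intros f f' H x. auto_derive. eexists; apply H. rewrite (is_derive_unique _ _ _ (H (- x))). ring. }
assert (R2 : forall f f' : R -> R, (forall x, is_derive f x (f' x)) ->
   forall x, is_derive (fun y => - f (- y)) x (f' (- x))).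
{ intros f f' H x. auto_derive. eexists; apply H. rewrite (is_derive_unique _ _ _ (H (- x))). ring. }
assert (cR : forall f, cont f -> cont (fun y => f (- y))).
{ intros f Hf. apply (cont_comp f) => //. apply cont_opp, cont_id. }
destruct (wronskian_small_right (fun x => d1 (- x)) (fun x => d2 (- x)) (fun x => - p1 (- x))
  (fun x => - p2 (- x)) (fun x => k1 (- x)) (fun x => k2 (- x)) A B) with eps M as [x [Hx1 Hx2]]; auto.
- intros a b Hab. rewrite (RInt_reflect (fun x => d1 x ^ 2 + d2 x ^ 2)).
  + apply HA; lra.
  + cont_auto.
- intros a b Hab. rewrite (RInt_reflect (fun x => k1 x ^ 2 + k2 x ^ 2)).
  + apply HB; lra.
  + cont_auto.
- exists (- x). split; [lra|]. rewrite -Rabs_Ropp.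
  replace (- (d1 (- x) * p2 (- x) - d2 (- x) * p1 (- x))) with
   (d1 (- x) * - p2 (- x) - d2 (- x) * - p1 (- x)) by ring. exact Hx2.
Qed.

(** For [d = d1 + i d2] this says [Im <d, d''> = 0], the symmetry of the kinetic energy. The
    integrand is the derivative of the Wronskian [d1 p2 - d2 p1] and is integrable by comparison, so
    its integral may be evaluated with any far endpoints; those where the Wronskian is small
    suffice, and no decay of [p1], [p2] is assumed. *)
Lemma is_lint_wronskian_derivative d1 d2 p1 p2 k1 k2 :
  (forall x, is_derive d1 x (p1 x)) -> (forall x, is_derive d2 x (p2 x)) ->
  (forall x, is_derive p1 x (k1 x)) -> (forall x, is_derive p2 x (k2 x)) ->
  cont k1 -> cont k2 ->
  ex_lint (fun x => d1 x ^ 2 + d2 x ^ 2) -> ex_lint (fun x => k1 x ^ 2 + k2 x ^ 2) ->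
  is_lint (fun x => d1 x * k2 x - d2 x * k1 x) 0.
Proof.
intros D1 D2 P1 P2 K1 K2 HA HB.
assert (cd1 : cont d1) by (apply cont_derive => x; eexists; apply D1).
assert (cd2 : cont d2) by (apply cont_derive => x; eexists; apply D2).
assert (cF : cont (fun x => d1 x ^ 2 + d2 x ^ 2)) by cont_auto.
assert (cK : cont (fun x => k1 x ^ 2 + k2 x ^ 2)) by cont_auto.
assert (cW : cont (fun x => d1 x * k2 x - d2 x * k1 x)) by cont_auto.
assert (HI : ex_lint (fun x => d1 x * k2 x - d2 x * k1 x)).
{ apply (ex_lint_comparison _ (fun x => (d1 x ^ 2 + d2 x ^ 2) + (k1 x ^ 2 + k2 x ^ 2))) => //.
  - cont_auto.
  - intros x. pose proof (pow2_ge_0 (d1 x - k2 x)). pose proof (pow2_ge_0 (d2 x + k1 x)).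
    pose proof (pow2_ge_0 (d1 x + k2 x)). pose proof (pow2_ge_0 (d2 x - k1 x)).
    pose proof (pow2_ge_0 (d1 x)). pose proof (pow2_ge_0 (d2 x)).
    pose proof (pow2_ge_0 (k1 x)). pose proof (pow2_ge_0 (k2 x)). apply Rabs_le; split; lra.
  - by apply ex_lint_plus. }
destruct HA as [A HA]. destruct HB as [B HB]. destruct HI as [I HI].
assert (HA' : forall a b, a <= b -> RInt (fun x => d1 x ^ 2 + d2 x ^ 2) a b <= A).
{ intros a b Hab. apply RInt_le_lint => //. intros; nra. }
assert (HB' : forall a b, a <= b -> RInt (fun x => k1 x ^ 2 + k2 x ^ 2) a b <= B).
{ intros a b Hab. apply RInt_le_lint => //. intros; nra. }
assert (E : I = 0); [|by rewrite -E].
apply Rabs_eq_0. apply Rle_antisym; [|apply Rabs_pos].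
apply Rnot_lt_le => Hlt.
(* The Wronskian at the two endpoints and the truncation contribute one such error each, which
   together stay below [Rabs I]. *)
assert (He : 0 < Rabs I / 4) by lra.
destruct (proj1 (is_lintP _ _ cW) HI _ He) as [M0 HM0].
set (M := Rmax M0 0). assert (HM1 : M0 <= M) by apply Rmax_l. assert (HM2 : 0 <= M) by apply Rmax_r.
assert (HM : forall a b, a < - M -> M < b -> Rabs (RInt (fun x => d1 x * k2 x - d2 x * k1 x) a b - I) < Rabs I / 4).
{ intros a b Ha Hb. apply HM0; lra. }
destruct (wronskian_small_right d1 d2 p1 p2 k1 k2 A B D1 D2 P1 P2 K1 K2 HA' HB' _ M He) as [b [Hb1 Hb2]].
destruct (wronskian_small_left d1 d2 p1 p2 k1 k2 A B D1 D2 P1 P2 K1 K2 HA' HB' _ M He) as [a [Ha1 Ha2]].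
specialize (HM a b Ha1 Hb1).
rewrite -(increment_RInt (fun x => d1 x * p2 x - d2 x * p1 x)) in HM => //.
- apply Rabs_def2 in HM. apply Rabs_def2 in Ha2. apply Rabs_def2 in Hb2.
  destruct (Rcase_abs I) as [HI'|HI']; [rewrite (Rabs_left _ HI') in HM Ha2 Hb2 Hlt | rewrite (Rabs_right _ HI') in HM Ha2 Hb2 Hlt]; lra.
- lra.
- intros x. auto_derive.
  + repeat split; eexists; eauto.
  + rewrite (is_derive_unique _ _ _ (D1 x)) (is_derive_unique _ _ _ (D2 x))
      (is_derive_unique _ _ _ (P1 x)) (is_derive_unique _ _ _ (P2 x)). ring.
Qed.

(** * Uniqueness of strong solutions *)

Lemma Cmod_sqr z : Cmod z ^ 2 = fst z ^ 2 + snd z ^ 2.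
Proof. apply Cmod2_alt. Qed.

Definition Ccont (f : R -> C) : Prop := cont (fun x => fst (f x)) /\ cont (fun x => snd (f x)).

Lemma Ccont_Cmod2 f : Ccont f -> cont (fun x => Cmod (f x) ^ 2).
Proof.
intros [H1 H2]. apply (cont_ext (fun x => fst (f x) ^ 2 + snd (f x) ^ 2)).
- intros x; by rewrite Cmod_sqr.
- cont_auto.
Qed.

Lemma Ccont_plus f g : Ccont f -> Ccont g -> Ccont (fun x => Cplus (f x) (g x)).
Proof. intros [] []. split; simpl; cont_auto. Qed.

Lemma Ccont_minus f g : Ccont f -> Ccont g -> Ccont (fun x => Cminus (f x) (g x)).
Proof.
intros [f1 f2] [g1 g2]. split.
- apply (cont_ext (fun x => fst (f x) - fst (g x))) => //. cont_auto.
- apply (cont_ext (fun x => snd (f x) - snd (g x))) => //. cont_auto.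
Qed.

Lemma Ccont_mult f g : Ccont f -> Ccont g -> Ccont (fun x => Cmult (f x) (g x)).
Proof. intros [] []. split; simpl; cont_auto. Qed.

Lemma Ccont_const c : Ccont (fun _ => c).
Proof. split; cont_auto. Qed.

Lemma Ccont_RtoC f : cont f -> Ccont (fun x => RtoC (f x)).
Proof. intros; split; simpl; cont_auto. Qed.

Lemma Cmod2_plus_le a b : Cmod (Cplus a b) ^ 2 <= 2 * Cmod a ^ 2 + 2 * Cmod b ^ 2.
Proof.
rewrite !Cmod_sqr. destruct a as [a1 a2], b as [b1 b2]. simpl.
pose proof (pow2_ge_0 (a1 - b1)). pose proof (pow2_ge_0 (a2 - b2)). lra.
Qed.

Lemma Cmod2_minus_le a b : Cmod (Cminus a b) ^ 2 <= 2 * Cmod a ^ 2 + 2 * Cmod b ^ 2.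
Proof. unfold Cminus. rewrite -(Cmod_opp b). apply Cmod2_plus_le. Qed.

Lemma L2_is_lint f : L2 f -> is_lint (fun x => Cmod (f x) ^ 2) (L2norm2 f).
Proof. intros H. by apply ex_lint_correct. Qed.

Lemma L2norm2_ge0 f : L2 f -> 0 <= L2norm2 f.
Proof. intros H. apply (is_lint_ge0 (fun x => Cmod (f x) ^ 2)); [intros; apply pow2_ge_0|by apply L2_is_lint]. Qed.

(** Membership and estimate come together because [L2norm2] bounds mean something only for functions
    known to be square integrable. *)
Lemma L2_dominated f g1 g2 : Ccont f -> Ccont g1 -> Ccont g2 -> L2 g1 -> L2 g2 ->
  (forall x, Cmod (f x) ^ 2 <= 2 * Cmod (g1 x) ^ 2 + 2 * Cmod (g2 x) ^ 2) ->
  L2 f /\ L2norm2 f <= 2 * L2norm2 g1 + 2 * L2norm2 g2.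
Proof.
intros cf c1 c2 H1 H2 H.
assert (HI : is_lint (fun x => 2 * Cmod (g1 x) ^ 2 + 2 * Cmod (g2 x) ^ 2) (2 * L2norm2 g1 + 2 * L2norm2 g2)).
{ apply (is_lint_plus (fun x => 2 * Cmod (g1 x) ^ 2)); apply is_lint_scal; by apply L2_is_lint. }
assert (L : L2 f).
{ apply (ex_lint_comparison _ (fun x => 2 * Cmod (g1 x) ^ 2 + 2 * Cmod (g2 x) ^ 2)).
  - by apply Ccont_Cmod2.
  - apply Ccont_Cmod2 in c1. apply Ccont_Cmod2 in c2. cont_auto.
  - intros x. rewrite Rabs_pos_eq => //. apply pow2_ge_0.
  - eexists; apply HI. }
split => //. apply (is_lint_le (fun x => Cmod (f x) ^ 2) _ _ _ H) => //. by apply L2_is_lint.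
Qed.

Lemma L2_plus f g : Ccont f -> Ccont g -> L2 f -> L2 g ->
  L2 (fun x => Cplus (f x) (g x)) /\ L2norm2 (fun x => Cplus (f x) (g x)) <= 2 * L2norm2 f + 2 * L2norm2 g.
Proof. intros. apply L2_dominated => //. by apply Ccont_plus. intros; apply Cmod2_plus_le. Qed.

Lemma L2_minus f g : Ccont f -> Ccont g -> L2 f -> L2 g ->
  L2 (fun x => Cminus (f x) (g x)) /\ L2norm2 (fun x => Cminus (f x) (g x)) <= 2 * L2norm2 f + 2 * L2norm2 g.
Proof. intros. apply L2_dominated => //. by apply Ccont_minus. intros; apply Cmod2_minus_le. Qed.

Lemma L2_scal c f : L2 f -> L2 (fun x => Cmult c (f x)).
Proof.
intros H. apply (ex_lint_ext (fun x => Cmod c ^ 2 * Cmod (f x) ^ 2)).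
- intros x. rewrite Cmod_mult. ring.
- by apply ex_lint_scal.
Qed.

Lemma L2_ext f g : (forall x, f x = g x) -> L2 f -> L2 g.
Proof. intros H. apply ex_lint_ext => x. by rewrite H. Qed.

Lemma C2fun_derive f : C2fun f -> forall x,
  is_derive (fun y => fst (f y)) x (fst (Cderiv f x)) /\
  is_derive (fun y => snd (f y)) x (snd (Cderiv f x)).
Proof. intros [H _] x. destruct (H x). split; by apply Derive_correct. Qed.

Lemma C2fun_derive2 f : C2fun f -> forall x,
  is_derive (fun y => fst (Cderiv f y)) x (fst (Cderiv (Cderiv f) x)) /\
  is_derive (fun y => snd (Cderiv f y)) x (snd (Cderiv (Cderiv f) x)).
Proof. intros [_ [H _]] x. destruct (H x). split; by apply Derive_correct. Qed.

Lemma C2fun_Ccont f : C2fun f -> Ccont f.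
Proof.
intros H. split; apply cont_derive => x.
- eexists; exact (proj1 (C2fun_derive f H x)).
- eexists; exact (proj2 (C2fun_derive f H x)).
Qed.

Lemma C2fun_Ccont2 f : C2fun f -> Ccont (Cderiv (Cderiv f)).
Proof. intros [_ [_ H]]. split; intros x; [exact (proj1 (H x))|exact (proj2 (H x))]. Qed.

Lemma Hop_Ccont w f : C2fun f -> Ccont (Hop w f).
Proof.
intros H. apply Ccont_plus.
- apply Ccont_mult. apply Ccont_const. by apply C2fun_Ccont2.
- apply Ccont_mult. apply Ccont_RtoC. cont_auto. by apply C2fun_Ccont.
Qed.

Lemma Hop_L2 w f : in_dom f -> L2 (Hop w f).
Proof.
intros [H2 [_ [Hd Hx]]].
apply (L2_ext (fun x => Cplus (Cmult (RtoC (- / 2)) (Cderiv (Cderiv f) x))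
   (Cmult (RtoC (/ 2 * w ^ 2)) (Cmult (RtoC (x ^ 2)) (f x))))).
{ intros x. unfold Hop. rewrite (RtoC_mult (/ 2 * w ^ 2)). ring. }
apply L2_plus.
- apply Ccont_mult. apply Ccont_const. by apply C2fun_Ccont2.
- apply Ccont_mult. apply Ccont_const. apply Ccont_mult. apply Ccont_RtoC. cont_auto. by apply C2fun_Ccont.
- by apply L2_scal.
- by apply L2_scal.
Qed.

Lemma const_of_zero_derivative (N : R -> R) a b : a <= b ->
  (forall s, a <= s <= b -> forall eta, 0 < eta -> exists delta, 0 < delta /\
     forall h, h <> 0 -> Rabs h < delta -> a <= s + h <= b -> Rabs (N (s + h) - N s) <= eta * Rabs h) ->
  N b = N a.
Proof.
intros Hab H.
(* Clamping to the interval is 1-Lipschitz, so [N] composed with it has a two-sided zero derivative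
   even at the endpoints, and the mean value theorem applies. *)
set (cl := fun s => Rmax a (Rmin b s)).
assert (Hcl : forall s, a <= cl s <= b).
{ intros s. unfold cl, Rmax, Rmin. repeat destruct Rle_dec; lra. }
assert (Hid : forall s, a <= s <= b -> cl s = s).
{ intros s Hs. unfold cl, Rmax, Rmin. repeat destruct Rle_dec; lra. }
assert (Hlip : forall s h, Rabs (cl (s + h) - cl s) <= Rabs h).
{ intros s h. unfold cl, Rmax, Rmin, Rabs. repeat destruct Rle_dec; repeat destruct Rcase_abs; lra. }
assert (Hd : forall s, a <= s <= b -> is_derive (fun x => N (cl x)) s 0).
{ intros s Hs. apply is_derive_Reals. intros eps He.
  destruct (H s Hs (eps / 2) ltac:(lra)) as [d [Hd Hd']].
  exists (mkposreal d Hd). simpl. intros h Hh Hhd.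
  rewrite Rminus_0_r /Rdiv Rabs_mult Rabs_inv.
  assert (Hh' : 0 < Rabs h) by by apply Rabs_pos_lt.
  apply Rmult_lt_reg_r with (Rabs h) => //.
  rewrite Rmult_assoc Rinv_l; [|lra]. rewrite Rmult_1_r.
  rewrite (Hid s Hs).
  destruct (Req_dec (cl (s + h)) s) as [->|Hne].
  - rewrite Rminus_eq_0 Rabs_R0. nra.
  - specialize (Hlip s h). rewrite (Hid s Hs) in Hlip.
    assert (E : s + (cl (s + h) - s) = cl (s + h)) by ring.
    specialize (Hd' (cl (s + h) - s)). rewrite E in Hd'.
    specialize (Hd' ltac:(lra) ltac:(lra) (Hcl _)). nra. }
destruct (MVT_gen (fun x => N (cl x)) a b (fun _ => 0)) as [c [_ Hc]].
- rewrite Rmin_left // Rmax_right //. intros x Hx. apply Hd. lra.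
- rewrite Rmin_left // Rmax_right //. intros x Hx.
  apply continuity_pt_filterlim. apply: ex_derive_continuous. eexists; by apply Hd.
- rewrite !Hid in Hc; lra.
Qed.

(** In complex notation [e = d + h (r - i H)], where [r] is the residual of the Schrodinger
    equation. Expanding [|e|^2] leaves [2 h Re (conj d * r)], split by Young's inequality with
    weight [eta], and a term of order [h^2]. *)
Lemma norm_step_bound (d1 d2 e1 e2 H1 H2 h eta : R) : h <> 0 -> 0 < eta ->
  let r1 := / h * (e1 - d1) - H2 in let r2 := / h * (e2 - d2) + H1 in
  Rabs ((e1 ^ 2 + e2 ^ 2) - (d1 ^ 2 + d2 ^ 2) - 2 * h * (d1 * H2 - d2 * H1)) <=
  Rabs h * (eta * (d1 ^ 2 + d2 ^ 2) + / eta * (r1 ^ 2 + r2 ^ 2)) +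
  2 * h ^ 2 * ((r1 ^ 2 + r2 ^ 2) + (H1 ^ 2 + H2 ^ 2)).
Proof.
intros Hh He r1 r2.
assert (E1 : e1 = d1 + h * (r1 + H2)) by (unfold r1; field; lra).
assert (E2 : e2 = d2 + h * (r2 - H1)) by (unfold r2; field; lra).
rewrite E1 E2. clearbody r1 r2.
replace ((d1 + h * (r1 + H2)) ^ 2 + (d2 + h * (r2 - H1)) ^ 2 - (d1 ^ 2 + d2 ^ 2) - 2 * h * (d1 * H2 - d2 * H1))
  with (h * (2 * (d1 * r1 + d2 * r2)) + h ^ 2 * ((r1 + H2) ^ 2 + (r2 - H1) ^ 2)) by ring.
eapply Rle_trans; [apply Rabs_triang|]. apply Rplus_le_compat.
- rewrite Rabs_mult. apply Rmult_le_compat_l; [apply Rabs_pos|].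
  assert (K : forall d r, Rabs (2 * (d * r)) <= eta * d ^ 2 + / eta * r ^ 2).
  { intros d r.
    assert (0 <= / eta * (eta * d - r) ^ 2) by (apply Rmult_le_pos; [left; by apply Rinv_0_lt_compat|apply pow2_ge_0]).
    assert (0 <= / eta * (eta * d + r) ^ 2) by (apply Rmult_le_pos; [left; by apply Rinv_0_lt_compat|apply pow2_ge_0]).
    replace (/ eta * (eta * d - r) ^ 2) with (eta * d ^ 2 - 2 * (d * r) + / eta * r ^ 2) in H by (field; lra).
    replace (/ eta * (eta * d + r) ^ 2) with (eta * d ^ 2 + 2 * (d * r) + / eta * r ^ 2) in H0 by (field; lra).
    apply Rabs_le; split; lra. }
  replace (2 * (d1 * r1 + d2 * r2)) with (2 * (d1 * r1) + 2 * (d2 * r2)) by ring.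
  eapply Rle_trans; [apply Rabs_triang|]. pose proof (K d1 r1). pose proof (K d2 r2). lra.
- rewrite Rabs_pos_eq.
  + pose proof (pow2_ge_0 (r1 - H2)). pose proof (pow2_ge_0 (r2 + H1)). pose proof (pow2_ge_0 h). nra.
  + apply Rmult_le_pos; [apply pow2_ge_0|]. pose proof (pow2_ge_0 (r1 + H2)). pose proof (pow2_ge_0 (r2 - H1)). lra.
Qed.

(** The function whose squared norm [solves] requires to be small, kept convertible with the
    expression there. *)
Definition defect (alpha h s : R) (Psi : R -> R -> C) (x : R) : C :=
  Cplus (Cmult (RtoC (/ h)) (Cminus (Psi (s + h) x) (Psi s x)))
        (Cmult Ci (Hop (omega_s alpha s) (Psi s) x)).

Lemma defect_L2 alpha h s Psi : in_dom (Psi (s + h)) -> in_dom (Psi s) ->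
  Ccont (defect alpha h s Psi) /\ L2 (defect alpha h s Psi).
Proof.
intros H1 H2.
assert (c1 := C2fun_Ccont _ (proj1 H1)). assert (c2 := C2fun_Ccont _ (proj1 H2)).
assert (c3 := Hop_Ccont (omega_s alpha s) _ (proj1 H2)).
assert (l3 := Hop_L2 (omega_s alpha s) _ H2).
assert (k1 : Ccont (fun x => Cmult (RtoC (/ h)) (Cminus (Psi (s + h) x) (Psi s x)))).
{ apply Ccont_mult. apply Ccont_const. by apply Ccont_minus. }
assert (k2 : Ccont (fun x => Cmult Ci (Hop (omega_s alpha s) (Psi s) x))).
{ apply Ccont_mult => //. apply Ccont_const. }
split.
- by apply Ccont_plus.
- apply L2_plus => //.
  + apply L2_scal. apply L2_minus => //; [apply H1|apply H2].
  + by apply L2_scal.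
Qed.

(** For the difference [D] of two solutions the derivative of the squared norm is [2 Im <D, H D>],
    which is 0 by symmetry. At the end the norm is 0, and continuity in [x] turns this into equality
    at every point. *)
Lemma solves_unique alpha t Psi Phi : 0 < t -> solves alpha t Psi -> solves alpha t Phi ->
  forall x, Psi t x = Phi t x.
Proof.
intros Ht [I1 [dom1 S1]] [I2 [dom2 S2]].
set (D := fun s x => Cminus (Psi s x) (Phi s x)).
assert (cD : forall s, - t <= s <= t -> Ccont (D s)).
{ intros s Hs. apply Ccont_minus; apply C2fun_Ccont; [apply (dom1 s Hs)|apply (dom2 s Hs)]. }
assert (lD : forall s, - t <= s <= t -> L2 (D s)).
{ intros s Hs. destruct (dom1 s Hs) as [? [? _]]. destruct (dom2 s Hs) as [? [? _]].
  apply L2_minus => //; by apply C2fun_Ccont. }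
assert (E : L2norm2 (D t) = L2norm2 (D (- t))).
{ apply (const_of_zero_derivative (fun s => L2norm2 (D s))); [lra|].
  intros s Hs eta Heta.
  assert (ds1 := dom1 s Hs). assert (ds2 := dom2 s Hs).
  set (w := omega_s alpha s).
  set (HD := fun x => Cminus (Hop w (Psi s) x) (Hop w (Phi s) x)).
  assert (HDl : L2 HD).
  { apply L2_minus; try (apply Hop_Ccont; [apply ds1 || apply ds2]); by apply Hop_L2. }
  (* The integrand is [Im (conj D * HD)]. The potential multiplies [D] by a real number and drops
     out, leaving the kinetic term. *)
  assert (W0 : is_lint (fun x => fst (D s x) * snd (HD x) - snd (D s x) * fst (HD x)) 0).
  { destruct ds1 as [C1 [l1 [l1' _]]]. destruct ds2 as [C2 [l2 [l2' _]]].
    set (k1 := fun x => fst (Cderiv (Cderiv (Psi s)) x) - fst (Cderiv (Cderiv (Phi s)) x)).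
    set (k2 := fun x => snd (Cderiv (Cderiv (Psi s)) x) - snd (Cderiv (Cderiv (Phi s)) x)).
    replace 0 with (- / 2 * 0) by ring.
    apply (is_lint_ext (fun x => - / 2 * (fst (D s x) * k2 x - snd (D s x) * k1 x))).
    { intros x. unfold D, HD, Hop, k1, k2.
      destruct (Psi s x), (Phi s x), (Cderiv (Cderiv (Psi s)) x), (Cderiv (Cderiv (Phi s)) x). simpl. field. }
    apply is_lint_scal.
    assert (a1 := C2fun_Ccont2 _ C1). assert (a2 := C2fun_Ccont2 _ C2). destruct a1 as [a11 a12]. destruct a2 as [a21 a22].
    apply (is_lint_wronskian_derivative _ _
       (fun x => fst (Cderiv (Psi s) x) - fst (Cderiv (Phi s) x))
       (fun x => snd (Cderiv (Psi s) x) - snd (Cderiv (Phi s) x))).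
    - intros x. apply: is_derive_minus; [exact (proj1 (C2fun_derive _ C1 x))|exact (proj1 (C2fun_derive _ C2 x))].
    - intros x. apply: is_derive_minus; [exact (proj2 (C2fun_derive _ C1 x))|exact (proj2 (C2fun_derive _ C2 x))].
    - intros x. apply: is_derive_minus; [exact (proj1 (C2fun_derive2 _ C1 x))|exact (proj1 (C2fun_derive2 _ C2 x))].
    - intros x. apply: is_derive_minus; [exact (proj2 (C2fun_derive2 _ C1 x))|exact (proj2 (C2fun_derive2 _ C2 x))].
    - unfold k1. cont_auto.
    - unfold k2. cont_auto.
    - apply (ex_lint_ext (fun x => Cmod (D s x) ^ 2)); [intros x; apply Cmod_sqr|]. by apply lD.
    - apply (ex_lint_ext (fun x => Cmod (Cminus (Cderiv (Cderiv (Psi s)) x) (Cderiv (Cderiv (Phi s)) x)) ^ 2)).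
      { intros x. by rewrite Cmod_sqr. }
      apply L2_minus => //; by apply C2fun_Ccont2. }
  set (N := L2norm2 (D s)). set (K := L2norm2 HD).
  assert (HN : 0 <= N) by (apply L2norm2_ge0; auto).
  assert (HK : 0 <= K) by (by apply L2norm2_ge0).
  (* The bound [eta] is spent as follows: [e] makes [e * N] at most [eta / 4], [rho] makes [Rr / e]
     at most [eta / 4] through [Rr <= 4 * rho], and [del3] leaves at most [eta / 2] for the
     second-order term, where [Rr <= 4]. *)
  set (e := eta / (4 * (N + 1))).
  assert (He : 0 < e). { apply Rdiv_lt_0_compat; lra. }
  set (rho := Rmin 1 (e * eta / 16)).
  assert (Hrho : 0 < rho). { apply Rmin_pos; [lra|]. apply Rdiv_lt_0_compat; nra. }
  destruct (S1 s Hs rho Hrho) as [del1 [Hdel1 T1]]. destruct (S2 s Hs rho Hrho) as [del2 [Hdel2 T2]].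
  set (del3 := eta / (4 * (4 + K))).
  assert (Hdel3 : 0 < del3). { apply Rdiv_lt_0_compat; lra. }
  exists (Rmin del3 (Rmin del1 del2)). split. { repeat apply Rmin_pos => //. }
  intros h Hh Hlt Hsh.
  assert (Hl3 : Rabs h < del3) by (eapply Rlt_le_trans; [apply Hlt|apply Rmin_l]).
  assert (Hl' : Rabs h < Rmin del1 del2) by (eapply Rlt_le_trans; [apply Hlt|apply Rmin_r]).
  assert (Hl1 : Rabs h < del1) by (eapply Rlt_le_trans; [apply Hl'|apply Rmin_l]).
  assert (Hl2 : Rabs h < del2) by (eapply Rlt_le_trans; [apply Hl'|apply Rmin_r]).
  specialize (T1 h Hh Hl1 Hsh). specialize (T2 h Hh Hl2 Hsh).
  destruct (defect_L2 alpha h s Psi (dom1 _ Hsh) ds1) as [cd1 ld1].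
  destruct (defect_L2 alpha h s Phi (dom2 _ Hsh) ds2) as [cd2 ld2].
  set (r := fun x => Cminus (defect alpha h s Psi x) (defect alpha h s Phi x)).
  destruct (L2_minus _ _ cd1 cd2 ld1 ld2) as [lr nr]. fold r in lr, nr.
  set (Rr := L2norm2 r) in *.
  assert (HR : 0 <= Rr) by by apply L2norm2_ge0.
  assert (HR2 : Rr <= 4 * rho). { unfold defect in nr. lra. }
  assert (B : Rabs (L2norm2 (D (s + h)) - N - 2 * h * 0) <= Rabs h * (e * N + / e * Rr) + 2 * h ^ 2 * (Rr + K)).
  { apply (is_lint_abs
     (fun x => Cmod (D (s + h) x) ^ 2 - Cmod (D s x) ^ 2 -
         2 * h * (fst (D s x) * snd (HD x) - snd (D s x) * fst (HD x)))
     (fun x => Rabs h * (e * Cmod (D s x) ^ 2 + / e * Cmod (r x) ^ 2) +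
         2 * h ^ 2 * (Cmod (r x) ^ 2 + Cmod (HD x) ^ 2))).
    - intros x. rewrite !Cmod_sqr.
      assert (Q := norm_step_bound (fst (D s x)) (snd (D s x)) (fst (D (s + h) x)) (snd (D (s + h) x))
        (fst (HD x)) (snd (HD x)) h e Hh He). cbv zeta in Q.
      replace (fst (r x)) with (/ h * (fst (D (s + h) x) - fst (D s x)) - snd (HD x)).
      2:{ unfold r, defect, D, HD, w. destruct (Psi s x), (Phi s x), (Psi (s + h) x), (Phi (s + h) x),
          (Hop (omega_s alpha s) (Psi s) x), (Hop (omega_s alpha s) (Phi s) x). simpl. ring. }
      replace (snd (r x)) with (/ h * (snd (D (s + h) x) - snd (D s x)) + fst (HD x)).
      2:{ unfold r, defect, D, HD, w. destruct (Psi s x), (Phi s x), (Psi (s + h) x), (Phi (s + h) x),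
          (Hop (omega_s alpha s) (Psi s) x), (Hop (omega_s alpha s) (Phi s) x). simpl. ring. }
      exact Q.
    - apply is_lint_minus. apply is_lint_minus; apply L2_is_lint; auto. by apply is_lint_scal.
    - apply is_lint_plus; apply is_lint_scal; apply is_lint_plus.
      + apply is_lint_scal, L2_is_lint; auto.
      + by apply is_lint_scal, L2_is_lint.
      + by apply L2_is_lint.
      + by apply L2_is_lint. }
  rewrite Rmult_0_r Rminus_0_r in B.
  eapply Rle_trans; [apply B|].
  assert (Hh' : 0 < Rabs h) by by apply Rabs_pos_lt.
  assert (B1 : e * N <= eta / 4).
  { unfold e. apply Rmult_le_reg_r with (4 * (N + 1)); [lra|].
    replace (eta / (4 * (N + 1)) * N * (4 * (N + 1))) with (eta * N) by (field; lra). nra. }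
  assert (B2 : / e * Rr <= eta / 4).
  { apply Rmult_le_reg_l with e => //. rewrite -Rmult_assoc Rinv_r; [|lra].
    assert (rho <= e * eta / 16) by apply Rmin_r. lra. }
  assert (B3 : 2 * h ^ 2 * (Rr + K) <= Rabs h * (eta / 2)).
  { rewrite -(pow2_abs h). assert (rho <= 1) by apply Rmin_l.
    assert (Rabs h * (4 + K) <= eta / 4).
    { apply Rle_trans with (del3 * (4 + K)); [apply Rmult_le_compat_r; lra|].
      right. unfold del3. field. lra. }
    assert (Rabs h * (Rr + K) <= eta / 4). { eapply Rle_trans; [|apply H0]. apply Rmult_le_compat_l; lra. }
    nra. }
  nra. }
assert (E0 : L2norm2 (D (- t)) = 0).
{ apply is_lint_unique. apply (is_lint_ext (fun _ => 0)); [|apply is_lint_0].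
  intros x. unfold D. rewrite I1 I2 Cmod_sqr. simpl. ring. }
intros x.
assert (Hz : Cmod (D t x) ^ 2 = 0).
{ apply (is_lint_pos_eq0 (fun y => Cmod (D t y) ^ 2)).
  - apply Ccont_Cmod2, cD. lra.
  - intros; apply pow2_ge_0.
  - rewrite -E0 -E. apply L2_is_lint, lD. lra. }
assert (Hz' : Cmod (D t x) = 0). { pose proof (Cmod_ge_0 (D t x)). nra. }
apply Cmod_eq_0 in Hz'. unfold D in Hz'.
replace (Psi t x) with (Cplus (Phi t x) (Cminus (Psi t x) (Phi t x))) by ring.
rewrite Hz'. ring.
Qed.

(** * Calculus of complex-valued functions *)

Lemma is_derive_eq (f : R -> R) x a b : a = b -> is_derive f x a -> is_derive f x b.
Proof. by move=> ->. Qed.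

Lemma is_derive_fun_eq (f g : R -> R) x a : (forall y, f y = g y) -> is_derive f x a -> is_derive g x a.
Proof. intros H. apply is_derive_ext. exact H. Qed.

Lemma Rderive_plus (f g : R -> R) x a b : is_derive f x a -> is_derive g x b ->
  is_derive (fun y => f y + g y) x (a + b).
Proof. intros. by apply: is_derive_plus. Qed.

Lemma Rderive_minus (f g : R -> R) x a b : is_derive f x a -> is_derive g x b ->
  is_derive (fun y => f y - g y) x (a - b).
Proof. intros. by apply: is_derive_minus. Qed.

Lemma Rderive_mult (f g : R -> R) x a b : is_derive f x a -> is_derive g x b ->
  is_derive (fun y => f y * g y) x (a * g x + f x * b).
Proof.
intros H1 H2. auto_derive.
- split; [eexists; exact H1|split; [eexists; exact H2|easy]].
- rewrite (is_derive_unique _ _ _ H1) (is_derive_unique _ _ _ H2). ring.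
Qed.

Lemma Rderive_exp (f : R -> R) x a : is_derive f x a -> is_derive (fun y => exp (f y)) x (a * exp (f x)).
Proof.
intros H1. auto_derive; [by (try split; eexists; exact H1)|]. rewrite (is_derive_unique _ _ _ H1). ring.
Qed.

Lemma Rderive_cos (f : R -> R) x a : is_derive f x a -> is_derive (fun y => cos (f y)) x (- a * sin (f x)).
Proof.
intros H1. auto_derive; [by (try split; eexists; exact H1)|]. rewrite (is_derive_unique _ _ _ H1). ring.
Qed.

Lemma Rderive_sin (f : R -> R) x a : is_derive f x a -> is_derive (fun y => sin (f y)) x (a * cos (f x)).
Proof.
intros H1. auto_derive; [by (try split; eexists; exact H1)|]. rewrite (is_derive_unique _ _ _ H1). ring.
Qed.

Lemma Rderive_ln (f : R -> R) x a : 0 < f x -> is_derive f x a -> is_derive (fun y => ln (f y)) x (a / f x).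
Proof.
intros H0 H1. auto_derive; [split; [eexists; exact H1|easy]|]. rewrite (is_derive_unique _ _ _ H1). field. lra.
Qed.

Lemma Rderive_inv (f : R -> R) x a : f x <> 0 -> is_derive f x a -> is_derive (fun y => / f y) x (- a / f x ^ 2).
Proof.
intros H0 H1. auto_derive; [split; [eexists; exact H1|easy]|]. rewrite (is_derive_unique _ _ _ H1). field. lra.
Qed.

(** Componentwise like [Cderiv], but relational, so that it carries differentiability along with the
    value. *)
Definition is_Cder (f : R -> C) (x : R) (l : C) : Prop :=
  is_derive (fun y => fst (f y)) x (fst l) /\ is_derive (fun y => snd (f y)) x (snd l).

Lemma is_Cder_eq f x a b : a = b -> is_Cder f x a -> is_Cder f x b.
Proof. by move=> ->. Qed.

Lemma is_Cder_ext f g x a : (forall y, f y = g y) -> is_Cder f x a -> is_Cder g x a.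
Proof.
intros H [H1 H2]. split.
- apply (is_derive_fun_eq (fun y => fst (f y))) => // y; by rewrite H.
- apply (is_derive_fun_eq (fun y => snd (f y))) => // y; by rewrite H.
Qed.

Lemma is_Cder_const c x : is_Cder (fun _ => c) x (RtoC 0).
Proof. split; simpl; apply: is_derive_const. Qed.

Lemma is_Cder_RtoC (f : R -> R) x a : is_derive f x a -> is_Cder (fun y => RtoC (f y)) x (RtoC a).
Proof. intros H; split; simpl => //. apply: is_derive_const. Qed.

Lemma is_Cder_plus f g x a b : is_Cder f x a -> is_Cder g x b -> is_Cder (fun y => Cplus (f y) (g y)) x (Cplus a b).
Proof. intros [f1 f2] [g1 g2]. split; simpl; by apply Rderive_plus. Qed.

Lemma is_Cder_mult f g x a b : is_Cder f x a -> is_Cder g x b ->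
  is_Cder (fun y => Cmult (f y) (g y)) x (Cplus (Cmult a (g x)) (Cmult (f x) b)).
Proof.
intros [f1 f2] [g1 g2]. split; simpl.
- eapply is_derive_eq; [|apply Rderive_minus; apply Rderive_mult; eassumption]. simpl. ring.
- eapply is_derive_eq; [|apply Rderive_plus; apply Rderive_mult; eassumption]. simpl. ring.
Qed.

Lemma is_Cder_scal c f x a : is_Cder f x a -> is_Cder (fun y => Cmult c (f y)) x (Cmult c a).
Proof.
intros H. eapply is_Cder_eq; [|apply is_Cder_mult; [apply is_Cder_const|exact H]]. simpl. ring.
Qed.

Definition Cexp (z : C) : C := (exp (fst z) * cos (snd z), exp (fst z) * sin (snd z)).

Lemma is_Cder_Cexp f x a : is_Cder f x a -> is_Cder (fun y => Cexp (f y)) x (Cmult a (Cexp (f x))).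
Proof.
intros [f1 f2]. split; simpl.
- eapply is_derive_eq; [|apply Rderive_mult; [apply Rderive_exp, f1|apply Rderive_cos, f2]]. simpl. ring.
- eapply is_derive_eq; [|apply Rderive_mult; [apply Rderive_exp, f1|apply Rderive_sin, f2]]. simpl. ring.
Qed.

Lemma Cexp_plus a b : Cexp (Cplus a b) = Cmult (Cexp a) (Cexp b).
Proof.
unfold Cexp, Cmult. simpl. rewrite exp_plus cos_plus sin_plus. f_equal; ring.
Qed.

Lemma Cmod_Cexp z : Cmod (Cexp z) = exp (fst z).
Proof.
assert (H : Cmod (Cexp z) ^ 2 = exp (fst z) ^ 2).
{ rewrite Cmod_sqr. simpl. pose proof (sin2_cos2 (snd z)) as E. unfold Rsqr in E. nra. }
pose proof (Cmod_ge_0 (Cexp z)). pose proof (exp_pos (fst z)). nra.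
Qed.

Lemma Cexp_neq0 z : Cexp z <> RtoC 0.
Proof. apply Cmod_gt_0. rewrite Cmod_Cexp. apply exp_pos. Qed.

Lemma is_Cder_Cdiff f x a : is_Cder f x a -> Cdiff f x.
Proof. intros [H1 H2]. split; eexists; eassumption. Qed.

Lemma is_Cder_Cderiv f x a : is_Cder f x a -> Cderiv f x = a.
Proof.
intros [H1 H2]. unfold Cderiv. rewrite (is_derive_unique _ _ _ H1) (is_derive_unique _ _ _ H2).
by destruct a.
Qed.

Lemma is_Cder_Ccont f f' : (forall x, is_Cder f x (f' x)) -> Ccont f.
Proof.
intros H. split; apply cont_derive => x.
- eexists; exact (proj1 (H x)).
- eexists; exact (proj2 (H x)).
Qed.

Lemma Cderiv_ext f g x : (forall y, f y = g y) -> Cderiv f x = Cderiv g x.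
Proof. intros H. unfold Cderiv. f_equal; apply Derive_ext => y; by rewrite H. Qed.

Lemma Cderiv2 f f' f'' : (forall x, is_Cder f x (f' x)) -> (forall x, is_Cder f' x (f'' x)) ->
  forall x, Cderiv (Cderiv f) x = f'' x.
Proof.
intros H1 H2 x. rewrite (Cderiv_ext _ f').
- by apply is_Cder_Cderiv.
- intros y. by apply is_Cder_Cderiv.
Qed.

Lemma is_Cder_C2fun f f' f'' : (forall x, is_Cder f x (f' x)) -> (forall x, is_Cder f' x (f'' x)) ->
  Ccont f'' -> C2fun f.
Proof.
intros H1 H2 [c1 c2]. repeat split.
- exact (proj1 (is_Cder_Cdiff _ _ _ (H1 x))).
- exact (proj2 (is_Cder_Cdiff _ _ _ (H1 x))).
- apply (ex_derive_ext (fun y => fst (f' y))).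
  + intros y. by rewrite (is_Cder_Cderiv _ _ _ (H1 y)).
  + exact (proj1 (is_Cder_Cdiff _ _ _ (H2 x))).
- apply (ex_derive_ext (fun y => snd (f' y))).
  + intros y. by rewrite (is_Cder_Cderiv _ _ _ (H1 y)).
  + exact (proj2 (is_Cder_Cdiff _ _ _ (H2 x))).
- apply (continuous_ext (fun y => fst (f'' y))).
  + intros y. by rewrite (Cderiv2 f f' f'').
  + apply c1.
- apply (continuous_ext (fun y => snd (f'' y))).
  + intros y. by rewrite (Cderiv2 f f' f'').
  + apply c2.
Qed.

(** * Gaussian bounds and Taylor remainders *)

Lemma exp_pow_INR x n : exp x ^ n = exp (INR n * x).
Proof.
induction n as [|n IH].
- by rewrite Rmult_0_l exp_0.
- rewrite S_INR Rmult_plus_distr_r Rmult_1_l exp_plus -IH /=. ring.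
Qed.

(** From [1 + d x^2 <= exp (d x^2)] follows [1 + x^2 <= (1 + 1/d) exp (d x^2)]. With
    [d = beta / (n + 1)] the power [n + 1] of this costs exactly [exp (beta x^2)]; the extra power
    pays for the decay. *)
Lemma gauss_poly_decay beta n : 0 < beta ->
  exists C, 0 < C /\ forall x, (1 + x ^ 2) ^ n * exp (- (beta * x ^ 2)) <= C * / (1 + x ^ 2).
Proof.
intros Hb.
set (d := beta / INR (S n)).
assert (Hn : 0 < INR (S n)) by (apply lt_0_INR; lia).
assert (Hd : 0 < d) by (by apply Rdiv_lt_0_compat).
exists ((1 + / d) ^ S n). split.
{ apply pow_lt. assert (0 < / d) by (by apply Rinv_0_lt_compat). lra. }
intros x.
assert (H1 : 1 + x ^ 2 <= (1 + / d) * exp (d * x ^ 2)).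
{ assert (E : 1 + d * x ^ 2 <= exp (d * x ^ 2)) by (apply exp_ineq1_le).
  assert (0 < / d) by (by apply Rinv_0_lt_compat).
  apply Rle_trans with ((1 + / d) * (1 + d * x ^ 2)); [|apply Rmult_le_compat_l; lra].
  replace ((1 + / d) * (1 + d * x ^ 2)) with (1 + x ^ 2 + / d + d * x ^ 2) by (field; lra).
  assert (0 <= d * x ^ 2) by (apply Rmult_le_pos; [lra|apply pow2_ge_0]). lra. }
assert (H0 : 0 < 1 + x ^ 2) by (pose proof (pow2_ge_0 x); lra).
assert (H2 : (1 + x ^ 2) ^ S n <= (1 + / d) ^ S n * exp (beta * x ^ 2)).
{ replace (exp (beta * x ^ 2)) with (exp (d * x ^ 2) ^ S n).
  - rewrite -Rpow_mult_distr. apply pow_incr. lra.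
  - rewrite exp_pow_INR. f_equal. unfold d. field. lra. }
assert (E := exp_pos (- (beta * x ^ 2))).
apply Rmult_le_reg_r with (1 + x ^ 2) => //.
rewrite (Rmult_assoc _ (/ _)) Rinv_l; [|lra]. rewrite Rmult_1_r.
apply Rmult_le_compat_r with (r := exp (- (beta * x ^ 2))) in H2; [|lra].
rewrite Rmult_assoc -exp_plus Rplus_opp_r exp_0 in H2. simpl in *. lra.
Qed.

Lemma L2_gauss f C n beta : Ccont f -> 0 < beta ->
  (forall x, Cmod (f x) <= C * (1 + x ^ 2) ^ n * exp (- (beta * x ^ 2))) -> L2 f.
Proof.
intros cf Hb H.
destruct (gauss_poly_decay (2 * beta) (2 * n)) as [K [HK HK2]]; [lra|].
apply (ex_lint_decay _ (C ^ 2 * K)).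
- by apply Ccont_Cmod2.
- intros x. rewrite Rabs_pos_eq; [|apply pow2_ge_0].
  apply Rle_trans with ((C * (1 + x ^ 2) ^ n * exp (- (beta * x ^ 2))) ^ 2).
  + apply pow_incr. split; [apply Cmod_ge_0|apply H].
  + replace ((C * (1 + x ^ 2) ^ n * exp (- (beta * x ^ 2))) ^ 2) with
     (C ^ 2 * ((1 + x ^ 2) ^ (2 * n) * exp (- (2 * beta * x ^ 2)))).
    * rewrite (Rmult_assoc (C ^ 2) K). apply Rmult_le_compat_l; [apply pow2_ge_0|apply HK2].
    * replace (- (2 * beta * x ^ 2)) with (- (beta * x ^ 2) + - (beta * x ^ 2)) by ring.
      rewrite exp_plus. replace (2 * n)%nat with (n + n)%nat by lia. rewrite pow_add. ring.
Qed.

Lemma cont_bounded f a b : cont f -> a <= b -> exists K, 0 <= K /\ forall x, a <= x <= b -> Rabs (f x) <= K.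
Proof.
intros Hf Hab.
destruct (continuity_ab_maj (fun x => Rabs (f x)) a b Hab) as [m [Hm _]].
- intros c _. apply continuity_pt_filterlim. apply (cont_abs f Hf).
- exists (Rabs (f m)). split; [apply Rabs_pos|exact Hm].
Qed.

Lemma cont_pos_min f a b : cont f -> a <= b -> (forall x, 0 < f x) ->
  exists m, 0 < m /\ forall x, a <= x <= b -> m <= f x.
Proof.
intros Hf Hab H.
destruct (continuity_ab_min f a b Hab) as [m [Hm _]].
- intros c _. apply continuity_pt_filterlim. apply Hf.
- exists (f m). split => //.
Qed.

(** Two applications of the mean value theorem. The factor [1/2] of Taylor's formula is given up, as
    only the order [h^2] matters. *)
Lemma taylor1 (f f' f'' : R -> R) s h B :
  (forall x, is_derive f x (f' x)) -> (forall x, is_derive f' x (f'' x)) ->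
  (forall x, Rmin s (s + h) <= x <= Rmax s (s + h) -> Rabs (f'' x) <= B) ->
  Rabs (f (s + h) - f s - h * f' s) <= B * h ^ 2.
Proof.
intros H1 H2 HB.
destruct (MVT_gen f s (s + h) f') as [c [Hc Ec]].
{ intros; apply H1. }
{ intros; apply continuity_pt_filterlim. apply: ex_derive_continuous. eexists; apply H1. }
destruct (MVT_gen f' s c f'') as [d [Hd Ed]].
{ intros; apply H2. }
{ intros; apply continuity_pt_filterlim. apply: ex_derive_continuous. eexists; apply H2. }
replace (f (s + h) - f s - h * f' s) with (h * (f'' d * (c - s))).
2:{ rewrite -Ed Ec. ring. }
assert (Hcs : Rabs (c - s) <= Rabs h).
{ revert Hc. unfold Rmin, Rmax, Rabs. repeat destruct Rle_dec; repeat destruct Rcase_abs; lra. }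
assert (Hd' : Rmin s (s + h) <= d <= Rmax s (s + h)).
{ revert Hc Hd. unfold Rmin, Rmax. repeat destruct Rle_dec; lra. }
specialize (HB d Hd').
rewrite !Rabs_mult -(pow2_abs h).
pose proof (Rabs_pos h). pose proof (Rabs_pos (c - s)). pose proof (Rabs_pos (f'' d)).
assert (Rabs (f'' d) * Rabs (c - s) <= B * Rabs h) by (apply Rmult_le_compat => //).
nra.
Qed.

Lemma Cmod_le_abs z : Cmod z <= Rabs (fst z) + Rabs (snd z).
Proof.
apply Rsqr_incr_0_var.
- rewrite /Rsqr. pose proof (Cmod_sqr z) as E. rewrite -(pow2_abs (fst z)) -(pow2_abs (snd z)) in E.
  pose proof (Rabs_pos (fst z)). pose proof (Rabs_pos (snd z)). nra.
- pose proof (Rabs_pos (fst z)). pose proof (Rabs_pos (snd z)). lra.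
Qed.

Lemma fst_le_Cmod z : Rabs (fst z) <= Cmod z.
Proof. eapply Rle_trans; [apply Rmax_l|apply Rmax_Cmod]. Qed.
Lemma snd_le_Cmod z : Rabs (snd z) <= Cmod z.
Proof. eapply Rle_trans; [apply Rmax_r|apply Rmax_Cmod]. Qed.

Lemma Ctaylor1 (f f' f'' : R -> C) s h B :
  (forall x, is_Cder f x (f' x)) -> (forall x, is_Cder f' x (f'' x)) ->
  (forall x, Rmin s (s + h) <= x <= Rmax s (s + h) -> Cmod (f'' x) <= B) ->
  Cmod (Cminus (Cminus (f (s + h)) (f s)) (Cmult (RtoC h) (f' s))) <= 2 * B * h ^ 2.
Proof.
intros H1 H2 HB.
assert (T1 := taylor1 (fun y => fst (f y)) (fun y => fst (f' y)) (fun y => fst (f'' y)) s h B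
  (fun x => proj1 (H1 x)) (fun x => proj1 (H2 x))
  (fun x Hx => Rle_trans _ _ _ (fst_le_Cmod (f'' x)) (HB x Hx))).
assert (T2 := taylor1 (fun y => snd (f y)) (fun y => snd (f' y)) (fun y => snd (f'' y)) s h B
  (fun x => proj2 (H1 x)) (fun x => proj2 (H2 x))
  (fun x Hx => Rle_trans _ _ _ (snd_le_Cmod (f'' x)) (HB x Hx))).
eapply Rle_trans; [apply Cmod_le_abs|].
replace (2 * B * h ^ 2) with (B * h ^ 2 + B * h ^ 2) by ring.
apply Rplus_le_compat; [refine (Rle_trans _ _ _ _ T1)|refine (Rle_trans _ _ _ _ T2)]; right; f_equal; simpl; ring.
Qed.

(** * Gaussian wave packets driven by a Riccati equation *)

Definition gwave (l g : C) (x : R) : C :=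
  Cexp (Cplus l (Cmult (Cmult Ci g) (RtoC (x ^ 2 / 2)))).

Lemma gwave_der l g x : is_Cder (gwave l g) x (Cmult (Cmult (Cmult Ci g) (RtoC x)) (gwave l g x)).
Proof.
eapply is_Cder_eq; [|apply is_Cder_Cexp; apply is_Cder_plus;
  [apply is_Cder_const|apply is_Cder_scal, (is_Cder_RtoC _ x x)]].
- unfold gwave. ring.
- auto_derive. easy. field.
Qed.

Lemma gwave_der2 l g x :
  is_Cder (fun y => Cmult (Cmult (Cmult Ci g) (RtoC y)) (gwave l g y)) x
   (Cmult (Cminus (Cmult Ci g) (Cmult (Cmult g g) (RtoC (x ^ 2)))) (gwave l g x)).
Proof.
eapply is_Cder_eq; [|apply is_Cder_mult; [apply is_Cder_scal, (is_Cder_RtoC (fun y => y) x 1)|apply gwave_der]].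
- rewrite /= Rmult_1_r RtoC_mult.
  replace (Cmult g g) with (Copp (Cmult (Cmult Ci g) (Cmult Ci g))). ring.
  destruct g as [g1 g2]. unfold Ci, Cmult, Copp. simpl. f_equal; ring.
- apply: is_derive_id.
Qed.

Lemma Cmod_gwave l g x : Cmod (gwave l g x) = exp (fst l) * exp (- (snd g / 2 * x ^ 2)).
Proof.
unfold gwave. rewrite Cmod_Cexp -exp_plus. f_equal. destruct l, g. simpl. field.
Qed.

Lemma gwave_Ccont l g : Ccont (gwave l g).
Proof. exact (is_Cder_Ccont _ _ (gwave_der l g)). Qed.

Lemma Hop_gwave w l g x : Hop w (gwave l g) x =
  Cmult (Cplus (Cmult (RtoC (- / 2)) (Cminus (Cmult Ci g) (Cmult (Cmult g g) (RtoC (x ^ 2)))))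
    (RtoC (/ 2 * w ^ 2 * x ^ 2))) (gwave l g x).
Proof.
unfold Hop. rewrite (Cderiv2 _ _ _ (gwave_der l g) (gwave_der2 l g)). ring.
Qed.

Lemma exp_mono a b : a <= b -> exp a <= exp b.
Proof. intros [H| ->]; [left; by apply exp_increasing|lra]. Qed.

Lemma one_le_1px2 x : 1 <= 1 + x ^ 2.
Proof. pose proof (pow2_ge_0 x). lra. Qed.

Lemma gwave_in_dom l g : 0 < snd g -> in_dom (gwave l g).
Proof.
intros Hg.
assert (c2 : Ccont (fun x => Cmult (Cminus (Cmult Ci g) (Cmult (Cmult g g) (RtoC (x ^ 2)))) (gwave l g x))).
{ apply Ccont_mult; [|apply gwave_Ccont]. apply Ccont_minus; [apply Ccont_const|].
  apply Ccont_mult; [apply Ccont_const|apply Ccont_RtoC]. cont_auto. }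
split; [|split; [|split]].
- exact (is_Cder_C2fun _ _ _ (gwave_der l g) (gwave_der2 l g) c2).
- apply (L2_gauss _ (exp (fst l)) 0 (snd g / 2)); [apply gwave_Ccont|lra|].
  intros x. rewrite Cmod_gwave. simpl. right; ring.
- apply (L2_ext (fun x => Cmult (Cminus (Cmult Ci g) (Cmult (Cmult g g) (RtoC (x ^ 2)))) (gwave l g x))).
  { intros x. by rewrite (Cderiv2 _ _ _ (gwave_der l g) (gwave_der2 l g)). }
  apply (L2_gauss _ ((Cmod g + Cmod g ^ 2) * exp (fst l)) 1 (snd g / 2)) => //; [lra|].
  intros x. rewrite Cmod_mult Cmod_gwave.
  apply Rle_trans with ((Cmod g + Cmod g ^ 2) * (1 + x ^ 2) * (exp (fst l) * exp (- (snd g / 2 * x ^ 2)))).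
  2:{ right; ring. }
  apply Rmult_le_compat_r.
  { left. apply Rmult_lt_0_compat; apply exp_pos. }
  eapply Rle_trans; [apply Cmod_triangle|].
  rewrite Cmod_opp !Cmod_mult Cmod_Ci Cmod_R Rabs_pos_eq; [|apply pow2_ge_0].
  pose proof (Cmod_ge_0 g). pose proof (pow2_ge_0 x). nra.
- apply (L2_gauss _ (exp (fst l)) 1 (snd g / 2)); [|lra|].
  + apply Ccont_mult; [|apply gwave_Ccont]. apply Ccont_RtoC. cont_auto.
  + intros x. rewrite Cmod_mult Cmod_gwave Cmod_R Rabs_pos_eq; [|apply pow2_ge_0].
    replace (exp (fst l) * (1 + x ^ 2) ^ 1 * exp (- (snd g / 2 * x ^ 2))) with
      ((1 + x ^ 2) * (exp (fst l) * exp (- (snd g / 2 * x ^ 2)))) by ring.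
    apply Rmult_le_compat_r.
    { left. apply Rmult_lt_0_compat; apply exp_pos. }
    lra.
Qed.

Definition riccati (alpha : R) (riccati_sol : R -> C) : Prop := forall s,
  is_Cder riccati_sol s (Copp (Cplus (Cmult (riccati_sol s) (riccati_sol s)) (RtoC (alpha ^ 2 * s ^ 2)))) /\ 0 < snd (riccati_sol s).

(** The Riccati equation gives [(Im gamma)' = - 2 Re gamma Im gamma], so the real part of
    [- gamma / 2] has the primitive [ln (Im gamma) / 4], and the constant [PI] normalizes the packet
    at every time. The imaginary part only contributes a phase and stays an integral. *)
Definition log_amplitude (riccati_sol : R -> C) (t0 s : R) : C :=
  (/ 4 * ln (snd (riccati_sol s) / PI), - / 2 * RInt (fun r => snd (riccati_sol r)) t0 s).

Definition wave (riccati_sol : R -> C) (t0 s x : R) : C := gwave (log_amplitude riccati_sol t0 s) (riccati_sol s) x.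

Lemma riccati_Ccont alpha riccati_sol : riccati alpha riccati_sol -> Ccont riccati_sol.
Proof. intros H. exact (is_Cder_Ccont _ _ (fun s => proj1 (H s))). Qed.

Lemma log_amplitude_der alpha riccati_sol t0 s : riccati alpha riccati_sol ->
  is_Cder (log_amplitude riccati_sol t0) s (Cmult (RtoC (- / 2)) (riccati_sol s)).
Proof.
intros H. destruct (H s) as [[_ D2] Hpos]. destruct (riccati_Ccont _ _ H) as [_ cg].
split; simpl.
- eapply is_derive_eq; [|apply Rderive_mult; [apply: is_derive_const|apply Rderive_ln]].
  3:{ apply Rderive_mult; [exact D2|apply: is_derive_const]. }
  + rewrite /zero /=. destruct (riccati_sol s) as [g b]. simpl in *. pose proof PI_RGT_0. field. lra.
  + apply Rdiv_lt_0_compat => //. apply PI_RGT_0.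
- eapply is_derive_eq; [|apply Rderive_mult; [apply: is_derive_const|]].
  2:{ apply (is_derive_RInt (fun r => snd (riccati_sol r)) (fun r => RInt (fun r => snd (riccati_sol r)) t0 r) t0).
      - exists (mkposreal 1 Rlt_0_1) => y _. apply: RInt_correct. by apply cont_ex_RInt.
      - apply cg. }
  rewrite /zero /=. ring.
Qed.

(** The logarithmic time derivative [l' + i gamma' x^2 / 2] of the packet, with [l'] and [gamma']
    replaced by their equations. *)
Definition wave_rate (alpha : R) (riccati_sol : R -> C) (x s : R) : C :=
  Cminus (Cmult (RtoC (- / 2)) (riccati_sol s))
    (Cmult (Cmult Ci (RtoC (x ^ 2 / 2))) (Cplus (Cmult (riccati_sol s) (riccati_sol s)) (RtoC (alpha ^ 2 * s ^ 2)))).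

Definition wave_rate_der (alpha : R) (riccati_sol : R -> C) (x s : R) : C :=
  let gam' := Copp (Cplus (Cmult (riccati_sol s) (riccati_sol s)) (RtoC (alpha ^ 2 * s ^ 2))) in
  Cminus (Cmult (RtoC (- / 2)) gam')
    (Cmult (Cmult Ci (RtoC (x ^ 2 / 2))) (Cplus (Cmult (RtoC 2) (Cmult (riccati_sol s) gam')) (RtoC (2 * alpha ^ 2 * s)))).

Lemma wave_der alpha riccati_sol t0 x s : riccati alpha riccati_sol ->
  is_Cder (fun r => wave riccati_sol t0 r x) s (Cmult (wave_rate alpha riccati_sol x s) (wave riccati_sol t0 s x)).
Proof.
intros H. unfold wave, gwave.
eapply is_Cder_eq; [|apply is_Cder_Cexp, is_Cder_plus; [by eapply log_amplitude_der|]].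
2:{ apply is_Cder_mult; [apply is_Cder_scal, (proj1 (H s))|apply is_Cder_const]. }
unfold wave_rate. ring.
Qed.

Lemma wave_rate_is_der alpha riccati_sol x s : riccati alpha riccati_sol ->
  is_Cder (wave_rate alpha riccati_sol x) s (wave_rate_der alpha riccati_sol x s).
Proof.
intros H.
apply (is_Cder_ext (fun s => Cplus (Cmult (RtoC (- / 2)) (riccati_sol s))
    (Cmult (Copp (Cmult Ci (RtoC (x ^ 2 / 2)))) (Cplus (Cmult (riccati_sol s) (riccati_sol s)) (RtoC (alpha ^ 2 * s ^ 2)))))).
{ intros y. unfold wave_rate. ring. }
eapply is_Cder_eq; [|apply is_Cder_plus; [apply is_Cder_scal, (proj1 (H s))|
  apply is_Cder_scal, is_Cder_plus; [apply is_Cder_mult; exact (proj1 (H s))|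
    apply (is_Cder_RtoC _ s (2 * alpha ^ 2 * s))]]].
- unfold wave_rate_der. ring.
- auto_derive. easy. ring.
Qed.

Lemma wave_der2 alpha riccati_sol t0 x s : riccati alpha riccati_sol ->
  is_Cder (fun r => Cmult (wave_rate alpha riccati_sol x r) (wave riccati_sol t0 r x)) s
   (Cmult (Cplus (Cmult (wave_rate alpha riccati_sol x s) (wave_rate alpha riccati_sol x s)) (wave_rate_der alpha riccati_sol x s))
      (wave riccati_sol t0 s x)).
Proof.
intros H.
eapply is_Cder_eq; [|apply is_Cder_mult; [by apply wave_rate_is_der|by apply wave_der]]. cbv beta. ring.
Qed.

Lemma wave_schrodinger alpha riccati_sol t0 s x :
  Cmult Ci (Hop (omega_s alpha s) (wave riccati_sol t0 s) x) = Copp (Cmult (wave_rate alpha riccati_sol x s) (wave riccati_sol t0 s x)).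
Proof.
rewrite Hop_gwave -/(wave riccati_sol t0 s x).
assert (E : omega_s alpha s ^ 2 = alpha ^ 2 * s ^ 2).
{ unfold omega_s. rewrite Rpow_mult_distr pow2_abs. ring. }
rewrite E /wave_rate. destruct (wave riccati_sol t0 s x) as [w1 w2], (riccati_sol s) as [g b].
unfold Ci, Cminus, Cplus, Copp, Cmult, RtoC; simpl. f_equal; field.
Qed.

(** A bound on the second time derivative that is uniform in time and Gaussian in [x] turns the
    pointwise Taylor remainder into an estimate in [L^2]. The Gaussian rate is half the minimum of
    [Im gamma] on the compact time interval. *)
Lemma wave_der2_bound alpha riccati_sol t0 t : riccati alpha riccati_sol -> 0 < t -> exists K beta, 0 < K /\ 0 < beta /\
  forall s x, - t <= s <= t ->
  Cmod (Cmult (Cplus (Cmult (wave_rate alpha riccati_sol x s) (wave_rate alpha riccati_sol x s)) (wave_rate_der alpha riccati_sol x s))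
      (wave riccati_sol t0 s x)) <= K * (1 + x ^ 2) ^ 2 * exp (- (beta * x ^ 2)).
Proof.
intros H Ht.
assert (cg := riccati_Ccont _ _ H). destruct cg as [cg1 cg2].
destruct (cont_bounded _ (- t) t cg1) as [G1 [HG1 B1]]; [lra|].
destruct (cont_bounded _ (- t) t cg2) as [G2 [HG2 B2]]; [lra|].
destruct (cont_pos_min _ (- t) t cg2) as [m [Hm B3]]; [lra|intros x; apply (proj2 (H x))|].
assert (cl : cont (fun s => fst (log_amplitude riccati_sol t0 s))).
{ apply cont_derive => s. eexists. exact (proj1 (log_amplitude_der alpha riccati_sol t0 s H)). }
destruct (cont_bounded _ (- t) t cl) as [L [HL B4]]; [lra|].
(* On the time interval [G] bounds [gamma] and [A] bounds [gamma'], while [A1] and [A2] bound the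
   rate and its derivative relative to [1 + x^2]. *)
set (G := G1 + G2). set (A := G ^ 2 + alpha ^ 2 * t ^ 2).
assert (HG : 0 <= G) by (unfold G; lra).
assert (HA : 0 <= A). { unfold A. pose proof (pow2_ge_0 G). pose proof (pow2_ge_0 (alpha * t)). rewrite Rpow_mult_distr in H1. lra. }
set (A1 := G + A). set (A2 := A + (2 * (G * A) + 2 * alpha ^ 2 * t)).
assert (HA2 : 0 <= A2).
{ unfold A2. assert (0 <= alpha ^ 2 * t). { apply Rmult_le_pos; [apply pow2_ge_0|lra]. } nra. }
exists ((A1 ^ 2 + A2 + 1) * exp L), (m / 2).
split; [|split; [lra|]].
{ apply Rmult_lt_0_compat; [|apply exp_pos]. pose proof (pow2_ge_0 A1). lra. }
intros s x Hs.
assert (Hg : Cmod (riccati_sol s) <= G).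
{ eapply Rle_trans; [apply Cmod_le_abs|]. unfold G. apply Rplus_le_compat; [by apply B1|by apply B2]. }
assert (Hs2 : s ^ 2 <= t ^ 2). { nra. }
assert (Hx : 0 <= x ^ 2) by apply pow2_ge_0.
assert (Hc := Cmod_ge_0 (riccati_sol s)).
assert (Hg' : Cmod (Cplus (Cmult (riccati_sol s) (riccati_sol s)) (RtoC (alpha ^ 2 * s ^ 2))) <= A).
{ eapply Rle_trans; [apply Cmod_triangle|]. rewrite Cmod_mult Cmod_R Rabs_pos_eq.
  2:{ apply Rmult_le_pos; apply pow2_ge_0. }
  unfold A. apply Rplus_le_compat; [nra|]. apply Rmult_le_compat_l => //. apply pow2_ge_0. }
assert (Hx2 : Rabs (x ^ 2 / 2) = x ^ 2 / 2) by (apply Rabs_pos_eq; lra).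
assert (Hh : Rabs (- / 2) = / 2). { rewrite Rabs_left; lra. }
assert (Hr : Cmod (wave_rate alpha riccati_sol x s) <= A1 * (1 + x ^ 2)).
{ unfold wave_rate, Cminus. eapply Rle_trans; [apply Cmod_triangle|].
  rewrite Cmod_opp !(Cmod_mult) Cmod_Ci !Cmod_R Hx2 Hh. unfold A1.
  set (c := Cmod (Cplus _ _)) in *. pose proof (Cmod_ge_0 (Cplus (Cmult (riccati_sol s) (riccati_sol s)) (RtoC (alpha ^ 2 * s ^ 2)))) as Hc0.
  fold c in Hc0. nra. }
assert (Hr' : Cmod (wave_rate_der alpha riccati_sol x s) <= A2 * (1 + x ^ 2)).
{ unfold wave_rate_der, Cminus. eapply Rle_trans; [apply Cmod_triangle|].
  rewrite Cmod_opp !(Cmod_mult) Cmod_Ci !Cmod_R Hx2 Hh Cmod_opp.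
  assert (Hd : Cmod (Cplus (Cmult (RtoC 2) (Cmult (riccati_sol s) (Copp (Cplus (Cmult (riccati_sol s) (riccati_sol s)) (RtoC (alpha ^ 2 * s ^ 2))))))
       (RtoC (2 * alpha ^ 2 * s))) <= 2 * (G * A) + 2 * alpha ^ 2 * t).
  { eapply Rle_trans; [apply Cmod_triangle|]. rewrite !Cmod_mult Cmod_opp !Cmod_R.
    apply Rplus_le_compat.
    - rewrite Rabs_pos_eq; [|lra]. apply Rmult_le_compat_l; [lra|]. apply Rmult_le_compat => //. apply Cmod_ge_0.
    - rewrite Rabs_mult Rabs_pos_eq.
      + apply Rmult_le_compat_l. { pose proof (pow2_ge_0 alpha); lra. } apply Rabs_le; lra.
      + pose proof (pow2_ge_0 alpha); lra. }
  set (c := Cmod (Cplus (Cmult (riccati_sol s) (riccati_sol s)) (RtoC (alpha ^ 2 * s ^ 2)))) in *.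
  assert (Hc0 : 0 <= c) by apply Cmod_ge_0. clearbody c.
  set (d := Cmod (Cplus _ _)) in *.
  assert (Hd0 : 0 <= d) by apply Cmod_ge_0.
  unfold A2. set (Q := 2 * (G * A) + 2 * alpha ^ 2 * t) in *.
  assert (x ^ 2 * d <= x ^ 2 * Q) by (by apply Rmult_le_compat_l).
  assert (0 <= x ^ 2 * A) by (by apply Rmult_le_pos).
  assert (0 <= x ^ 2 * d) by (by apply Rmult_le_pos).
  lra. }
rewrite Cmod_mult /wave Cmod_gwave.
assert (Hw : exp (fst (log_amplitude riccati_sol t0 s)) * exp (- (snd (riccati_sol s) / 2 * x ^ 2)) <= exp L * exp (- (m / 2 * x ^ 2))).
{ apply Rmult_le_compat; try (left; apply exp_pos).
  - apply exp_mono. eapply Rle_trans; [apply Rle_abs|]. by apply B4.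
  - apply exp_mono. specialize (B3 s Hs). nra. }
assert (Hp : Cmod (Cplus (Cmult (wave_rate alpha riccati_sol x s) (wave_rate alpha riccati_sol x s)) (wave_rate_der alpha riccati_sol x s))
   <= (A1 ^ 2 + A2 + 1) * (1 + x ^ 2) ^ 2).
{ eapply Rle_trans; [apply Cmod_triangle|]. rewrite Cmod_mult.
  set (c := Cmod (wave_rate alpha riccati_sol x s)) in *.
  assert (Hc0 : 0 <= c) by apply Cmod_ge_0.
  assert (c * c <= (A1 * (1 + x ^ 2)) ^ 2) by (generalize (A1 * (1 + x ^ 2)) Hr; intros; nra).
  assert (A2 * (1 + x ^ 2) <= A2 * (1 + x ^ 2) ^ 2).
  { apply Rmult_le_compat_l => //. generalize (x ^ 2) Hx. intros; nra. }
  assert (0 <= (1 + x ^ 2) ^ 2) by apply pow2_ge_0.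
  rewrite Rpow_mult_distr in H0. lra. }
eapply Rle_trans; [apply Rmult_le_compat; [apply Cmod_ge_0| |apply Hp|apply Hw]|].
- left. apply Rmult_lt_0_compat; apply exp_pos.
- right; ring.
Qed.

(** The packet satisfies the equation pointwise, so its defect is a first-order Taylor remainder
    divided by [h]; its squared norm is at most [h^2] times a constant. *)
Lemma wave_solves alpha riccati_sol t : 0 < alpha -> 0 < t -> riccati alpha riccati_sol -> riccati_sol (- t) = (0, alpha * t) ->
  solves alpha t (wave riccati_sol (- t)).
Proof.
intros Ha Ht H H0. split; [|split].
- intros x. unfold wave, gwave, log_amplitude, psi0.
  rewrite H0 RInt_point /zero /=. unfold Cexp, RtoC. simpl.
  replace (- / 2 * 0 + ((0 * 0 - 1 * (alpha * t)) * 0 + (0 * (alpha * t) + 1 * 0) * (x * (x * 1) / 2))) with 0 by field.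
  rewrite sin_0 cos_0 /Rpower -exp_plus. f_equal; [|ring]. rewrite Rmult_1_r. f_equal. field.
- intros s Hs. apply gwave_in_dom. apply (proj2 (H s)).
- intros s Hs eps Heps.
  destruct (wave_der2_bound alpha riccati_sol (- t) t H Ht) as [K [beta [HK [Hb B]]]].
  destruct (gauss_poly_decay (2 * beta) 4) as [M [HM BM]]; [lra|].
  destruct ex_lint_inv_1px2 as [I HI].
  assert (I0 : 0 <= I).
  { apply (is_lint_ge0 (fun x => / (1 + x ^ 2))) => // x. left. apply Rinv_0_lt_compat. pose proof (one_le_1px2 x); lra. }
  set (Q := 4 * K ^ 2 * M * I).
  assert (HQ : 0 <= Q). { unfold Q. apply Rmult_le_pos => //. apply Rmult_le_pos; [|lra]. pose proof (pow2_ge_0 K); lra. }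
  set (d := Rmin 1 (eps / (Q + 1))).
  assert (Hd : 0 < d). { apply Rmin_pos; [lra|]. apply Rdiv_lt_0_compat; lra. }
  exists d. split => //. intros h Hh Hhd Hsh.
  change (L2norm2 (defect alpha h s (wave riccati_sol (- t))) < eps).
  assert (dom : forall r, in_dom (wave riccati_sol (- t) r)) by (intros r; apply gwave_in_dom, (proj2 (H r))).
  destruct (defect_L2 alpha h s (wave riccati_sol (- t)) (dom _) (dom _)) as [cd ld].
  assert (Bd : forall x, Cmod (defect alpha h s (wave riccati_sol (- t)) x) <= 2 * (K * (1 + x ^ 2) ^ 2 * exp (- (beta * x ^ 2))) * Rabs h).
  { intros x. unfold defect. rewrite wave_schrodinger.
    assert (T := Ctaylor1 (fun r => wave riccati_sol (- t) r x) _ _ s h (K * (1 + x ^ 2) ^ 2 * exp (- (beta * x ^ 2)))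
      (fun r => wave_der alpha riccati_sol (- t) x r H) (fun r => wave_der2 alpha riccati_sol (- t) x r H)).
    assert (T' := T (fun r Hr => B r x ltac:(revert Hr; unfold Rmin, Rmax; repeat destruct Rle_dec; lra))). clear T.
    set (P := 2 * (K * (1 + x ^ 2) ^ 2 * exp (- (beta * x ^ 2)))) in *.
    replace (Cplus _ _) with (Cmult (RtoC (/ h)) (Cminus (Cminus (wave riccati_sol (- t) (s + h) x) (wave riccati_sol (- t) s x))
       (Cmult (RtoC h) (Cmult (wave_rate alpha riccati_sol x s) (wave riccati_sol (- t) s x))))).
    2:{ rewrite (RtoC_inv h Hh). field. intros E. apply Hh. by apply (f_equal fst) in E. }
    rewrite Cmod_mult Cmod_R Rabs_inv.
    assert (Hh' : 0 < Rabs h) by by apply Rabs_pos_lt.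
    apply Rmult_le_reg_l with (Rabs h) => //. rewrite -Rmult_assoc Rinv_r; [|lra]. rewrite Rmult_1_l.
    rewrite -(pow2_abs h) in T'. eapply Rle_trans; [apply T'|]. right; ring. }
  assert (Hle : L2norm2 (defect alpha h s (wave riccati_sol (- t))) <= 4 * K ^ 2 * h ^ 2 * M * I).
  { apply (is_lint_le (fun x => Cmod (defect alpha h s (wave riccati_sol (- t)) x) ^ 2)
      (fun x => 4 * K ^ 2 * h ^ 2 * M * / (1 + x ^ 2))).
    - intros x. eapply Rle_trans; [apply pow_incr; split; [apply Cmod_ge_0|apply Bd]|].
      replace ((2 * (K * (1 + x ^ 2) ^ 2 * exp (- (beta * x ^ 2))) * Rabs h) ^ 2) with
        (4 * K ^ 2 * h ^ 2 * ((1 + x ^ 2) ^ 4 * exp (- (2 * beta * x ^ 2)))).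
      + rewrite (Rmult_assoc _ M). apply Rmult_le_compat_l; [|apply BM].
        pose proof (pow2_ge_0 K). pose proof (pow2_ge_0 h). nra.
      + replace (- (2 * beta * x ^ 2)) with (- (beta * x ^ 2) + - (beta * x ^ 2)) by ring.
        rewrite exp_plus -(pow2_abs h). ring.
    - by apply L2_is_lint.
    - by apply is_lint_scal. }
  eapply Rle_lt_trans; [apply Hle|].
  replace (4 * K ^ 2 * h ^ 2 * M * I) with (h ^ 2 * Q) by (unfold Q; ring).
  rewrite -(pow2_abs h). assert (0 <= Rabs h) by apply Rabs_pos.
  assert (Rabs h < 1) by (eapply Rlt_le_trans; [apply Hhd|apply Rmin_l]).
  assert (Rabs h < eps / (Q + 1)) by (eapply Rlt_le_trans; [apply Hhd|apply Rmin_r]).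
  assert (eps / (Q + 1) * (Q + 1) = eps) by (field; lra).
  assert (Rabs h ^ 2 <= Rabs h) by nra.
  nra.
Qed.

(** * The complex Gaussian integral *)

Definition is_Clint (f : R -> C) (l : C) : Prop :=
  is_lint (fun x => fst (f x)) (fst l) /\ is_lint (fun x => snd (f x)) (snd l).

Lemma is_Clint_ext f g l : (forall x, f x = g x) -> is_Clint f l -> is_Clint g l.
Proof.
intros H [H1 H2]. split.
- apply (is_lint_ext (fun x => fst (f x))) => // x; by rewrite H.
- apply (is_lint_ext (fun x => snd (f x))) => // x; by rewrite H.
Qed.

Lemma is_Clint_plus f g a b : is_Clint f a -> is_Clint g b ->
  is_Clint (fun x => Cplus (f x) (g x)) (Cplus a b).
Proof. intros [] []. split; simpl; by apply is_lint_plus. Qed.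

Lemma is_Clint_scal c f a : is_Clint f a -> is_Clint (fun x => Cmult c (f x)) (Cmult c a).
Proof.
intros [H1 H2]. split; simpl.
- apply is_lint_minus; by apply is_lint_scal.
- apply is_lint_plus; by apply is_lint_scal.
Qed.

Lemma is_Clint_inj f a b : is_Clint f a -> is_Clint f b -> a = b.
Proof.
intros [H1 H2] [H3 H4]. destruct a, b. f_equal; [exact (is_lint_inj _ _ _ H1 H3)|exact (is_lint_inj _ _ _ H2 H4)].
Qed.

Lemma gauss_bound_decay (f : R -> C) C n beta : 0 < beta ->
  (forall x, Cmod (f x) <= C * (1 + x ^ 2) ^ n * exp (- (beta * x ^ 2))) ->
  exists K, forall x, Cmod (f x) <= C * K * / (1 + x ^ 2).
Proof.
intros Hb H.
destruct (gauss_poly_decay beta n Hb) as [K [HK HK2]].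
assert (HC : 0 <= C).
{ specialize (H 0). pose proof (Cmod_ge_0 (f 0)).
  replace (C * (1 + 0 ^ 2) ^ n * exp (- (beta * 0 ^ 2))) with C in H. lra.
  replace (1 + 0 ^ 2) with 1 by ring. rewrite pow1. replace (- (beta * 0 ^ 2)) with 0 by ring. rewrite exp_0. ring. }
exists K. intros x. eapply Rle_trans; [apply H|]. rewrite !Rmult_assoc. by apply Rmult_le_compat_l.
Qed.

Lemma ex_Clint_gauss f C n beta : Ccont f -> 0 < beta ->
  (forall x, Cmod (f x) <= C * (1 + x ^ 2) ^ n * exp (- (beta * x ^ 2))) -> exists l, is_Clint f l.
Proof.
intros [c1 c2] Hb H.
destruct (gauss_bound_decay f C n beta Hb H) as [K B].
destruct (ex_lint_decay _ (C * K) c1) as [l1 H1].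
{ intros x. eapply Rle_trans; [apply fst_le_Cmod|apply B]. }
destruct (ex_lint_decay _ (C * K) c2) as [l2 H2].
{ intros x. eapply Rle_trans; [apply snd_le_Cmod|apply B]. }
exists (l1, l2). by split.
Qed.

(** The form in which integration by parts is used below: a total derivative integrates to 0, since
    Gaussian decay kills the boundary terms. *)
Lemma is_Clint_derive_gauss F f C n beta : (forall x, is_Cder F x (f x)) -> Ccont f -> 0 < beta ->
  (forall x, Cmod (F x) <= C * (1 + x ^ 2) ^ n * exp (- (beta * x ^ 2))) -> is_Clint f (RtoC 0).
Proof.
intros D [c1 c2] Hb H.
destruct (gauss_bound_decay F C n beta Hb H) as [K B].
split; simpl.
- apply (is_lint_derive_decay (fun x => fst (F x)) _ (C * K)) => //.
  + intros x. exact (proj1 (D x)).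
  + intros x. eapply Rle_trans; [apply fst_le_Cmod|apply B].
- apply (is_lint_derive_decay (fun x => snd (F x)) _ (C * K)) => //.
  + intros x. exact (proj2 (D x)).
  + intros x. eapply Rle_trans; [apply snd_le_Cmod|apply B].
Qed.

Definition cgauss (z : C) (x : R) : C := Cexp (Cmult (Copp z) (RtoC (x ^ 2))).

Lemma cgauss_der z x : is_Cder (cgauss z) x (Cmult (Cmult (Copp z) (RtoC (2 * x))) (cgauss z x)).
Proof.
eapply is_Cder_eq; [|apply is_Cder_Cexp, is_Cder_scal, (is_Cder_RtoC _ x (2 * x))].
- reflexivity.
- auto_derive. easy. ring.
Qed.

Lemma Cmod_cgauss z x : Cmod (cgauss z x) = exp (- (fst z * x ^ 2)).
Proof. unfold cgauss. rewrite Cmod_Cexp. f_equal. simpl. ring. Qed.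

Lemma cgauss_Ccont z : Ccont (cgauss z).
Proof. exact (is_Cder_Ccont _ _ (cgauss_der z)). Qed.

Definition CRInt (f : R -> C) (a b : R) : C := (RInt (fun x => fst (f x)) a b, RInt (fun x => snd (f x)) a b).

Lemma CRInt_der f a x : Ccont f -> is_Cder (CRInt f a) x (f x).
Proof.
intros [c1 c2]. split; simpl.
- apply (is_derive_RInt (fun r => fst (f r)) (fun r => RInt (fun r => fst (f r)) a r) a).
  + exists (mkposreal 1 Rlt_0_1) => y _. apply: RInt_correct. by apply cont_ex_RInt.
  + apply c1.
- apply (is_derive_RInt (fun r => snd (f r)) (fun r => RInt (fun r => snd (f r)) a r) a).
  + exists (mkposreal 1 Rlt_0_1) => y _. apply: RInt_correct. by apply cont_ex_RInt.
  + apply c2.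
Qed.

Ltac ringR := match goal with |- @eq _ ?u ?v => change (@eq R u v) end; ring.

Lemma RInt_lin (f g : R -> R) k l a b : cont f -> cont g ->
  RInt (fun x => k * f x + l * g x) a b = k * RInt f a b + l * RInt g a b.
Proof.
intros cf cg. apply is_RInt_unique.
apply: (is_RInt_plus (fun x => k * f x)); apply: is_RInt_scal; apply: RInt_correct; by apply cont_ex_RInt.
Qed.

Lemma CRInt_scal c f a b : Ccont f -> CRInt (fun x => Cmult c (f x)) a b = Cmult c (CRInt f a b).
Proof.
intros [c1 c2]. unfold CRInt, Cmult; simpl. f_equal.
- transitivity (RInt (fun x => fst c * fst (f x) + - snd c * snd (f x)) a b).
  + apply RInt_ext. intros; ringR.
  + rewrite (RInt_lin (fun x => fst (f x)) (fun x => snd (f x)) _ _ _ _ c1 c2). ringR.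
- transitivity (RInt (fun x => fst c * snd (f x) + snd c * fst (f x)) a b).
  + apply RInt_ext. intros; ringR.
  + exact (RInt_lin (fun x => snd (f x)) (fun x => fst (f x)) _ _ _ _ c2 c1).
Qed.

Lemma CRInt_comp_scal f s b : Ccont f -> CRInt (fun q => Cmult (RtoC s) (f (s * q))) 0 b = CRInt f 0 (s * b).
Proof.
intros [c1 c2]. unfold CRInt. f_equal.
- assert (E := RInt_comp_lin (fun x => fst (f x)) s 0 0 b (cont_ex_RInt _ _ _ c1)).
  rewrite Rmult_0_r !Rplus_0_r in E. rewrite -E. apply RInt_ext => x _.
  rewrite /scal /= /mult /= Rplus_0_r. ringR.
- assert (E := RInt_comp_lin (fun x => snd (f x)) s 0 0 b (cont_ex_RInt _ _ _ c2)).
  rewrite Rmult_0_r !Rplus_0_r in E. rewrite -E. apply RInt_ext => x _.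
  rewrite /scal /= /mult /= Rplus_0_r. ringR.
Qed.

Lemma CRInt_bound f B : Ccont f -> (forall x, 0 <= x <= 1 -> Cmod (f x) <= B) -> Cmod (CRInt f 0 1) <= 2 * B.
Proof.
intros [c1 c2] H.
eapply Rle_trans; [apply Cmod_le_abs|]. simpl.
assert (K : forall g, cont g -> (forall x, 0 <= x <= 1 -> Rabs (g x) <= B) -> Rabs (RInt g 0 1) <= B).
{ intros g cg Hg. eapply Rle_trans; [apply (abs_RInt_le_const g 0 1 B); [lra|by apply cont_ex_RInt|exact Hg]|]. lra. }
assert (T1 := K _ c1 (fun x Hx => Rle_trans _ _ _ (fst_le_Cmod _) (H x Hx))).
assert (T2 := K _ c2 (fun x Hx => Rle_trans _ _ _ (snd_le_Cmod _) (H x Hx))).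
lra.
Qed.

(** Integrated over [q] in [[0, 1]], this is the classical companion of the squared Gaussian
    integral. It yields the value for complex [z] at once, without a double integral or analytic
    continuation. *)
Definition gtail (z : C) (s q : R) : C := Cmult (RtoC (/ (1 + q ^ 2))) (cgauss (Cmult z (RtoC (1 + q ^ 2))) s).

Lemma gtail_der z q s : is_Cder (fun r => gtail z r q) s
  (Cmult (Cmult (Cmult (Copp (RtoC 2)) z) (cgauss z s)) (Cmult (RtoC s) (cgauss z (s * q)))).
Proof.
eapply is_Cder_eq; [|apply is_Cder_scal, cgauss_der].
assert (H : 1 + q ^ 2 <> 0) by (pose proof (one_le_1px2 q); lra).
assert (E : cgauss (Cmult z (RtoC (1 + q ^ 2))) s = Cmult (cgauss z s) (cgauss z (s * q))).
{ unfold cgauss. rewrite -Cexp_plus. f_equal. rewrite Rpow_mult_distr RtoC_plus !RtoC_mult. ring. }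
rewrite E (RtoC_inv _ H) !RtoC_mult. field.
intros E'. apply H. by apply (f_equal fst) in E'.
Qed.

Lemma continuous_cgauss_2d z (g : R * R -> R) p : continuous g p ->
  continuous (fun y => fst (cgauss z (g y))) p /\ continuous (fun y => snd (cgauss z (g y))) p.
Proof.
intros Hg. destruct (cgauss_Ccont z) as [c1 c2]. split.
- exact (continuous_comp g (fun x => fst (cgauss z x)) p Hg (c1 (g p))).
- exact (continuous_comp g (fun x => snd (cgauss z x)) p Hg (c2 (g p))).
Qed.

Lemma gtail_Ccont z s : Ccont (gtail z s).
Proof.
apply Ccont_mult.
- apply Ccont_RtoC. apply cont_derive => x. auto_derive. pose proof (one_le_1px2 x). simpl in *; lra.
- apply (is_Cder_Ccont _ (fun q => Cmult (Cmult (Copp z) (RtoC (2 * q * s ^ 2))) (cgauss (Cmult z (RtoC (1 + q ^ 2))) s))).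
  intros q. unfold cgauss.
  apply (is_Cder_ext (fun q => Cexp (Cmult (Copp z) (RtoC ((1 + q ^ 2) * s ^ 2))))).
  { intros y. f_equal. rewrite (RtoC_mult (1 + y ^ 2) (s ^ 2)). ring. }
  eapply is_Cder_eq; [|apply is_Cder_Cexp, is_Cder_scal, (is_Cder_RtoC _ q (2 * q * s ^ 2))].
  + cbv beta. rewrite (RtoC_mult (1 + q ^ 2) (s ^ 2)). f_equal. f_equal. ring.
  + auto_derive. easy. ring.
Qed.

Lemma continuity_2d_of_continuous (f : R -> R -> R) x y :
  continuous (fun p : R * R => f (fst p) (snd p)) (x, y) -> continuity_2d_pt f x y.
Proof. intros H. apply continuity_2d_pt_filterlim. exact H. Qed.

(** Differentiation under the integral cancels the factor [1 + q^2] and splits off [cgauss z s]. The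
    remaining factor [s] is the Jacobian of [q -> s q], which maps [[0, 1]] to [[0, s]]. *)
Lemma CRInt_gtail_der z s : is_Cder (fun r => CRInt (gtail z r) 0 1) s
  (Cmult (Cmult (Cmult (Copp (RtoC 2)) z) (cgauss z s)) (CRInt (cgauss z) 0 s)).
Proof.
set (D := fun r q => Cmult (Cmult (Cmult (Copp (RtoC 2)) z) (cgauss z r)) (Cmult (RtoC r) (cgauss z (r * q)))).
assert (E : Cmult (Cmult (Cmult (Copp (RtoC 2)) z) (cgauss z s)) (CRInt (cgauss z) 0 s) = CRInt (D s) 0 1).
{ unfold D. rewrite CRInt_scal.
  - rewrite CRInt_comp_scal; [by rewrite Rmult_1_r|apply cgauss_Ccont].
  - apply Ccont_mult; [apply Ccont_const|]. destruct (cgauss_Ccont z). split.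
    + apply (cont_comp (fun x => fst (cgauss z x)) (fun q => s * q)); [assumption|cont_auto].
    + apply (cont_comp (fun x => snd (cgauss z x)) (fun q => s * q)); [assumption|cont_auto]. }
rewrite E.
assert (cf : forall p : R * R, continuous (fun p : R * R => fst p) p) by (intros; apply continuous_fst).
assert (cs : forall p : R * R, continuous (fun p : R * R => snd p) p) by (intros; apply continuous_snd).
assert (cm : forall (f g : R * R -> R) p, continuous f p -> continuous g p -> continuous (fun p => f p * g p) p)
  by (intros; by apply: continuous_mult).
assert (cp : forall (f g : R * R -> R) p, continuous f p -> continuous g p -> continuous (fun p => f p + g p) p)
  by (intros; by apply: continuous_plus).
assert (cn : forall (f g : R * R -> R) p, continuous f p -> continuous g p -> continuous (fun p => f p - g p) p)
  by (intros; by apply: continuous_minus).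
assert (cc : forall c (p : R * R), continuous (fun _ => c : R) p) by (intros; apply continuous_const).
split; unfold CRInt; simpl fst; simpl snd.
- rewrite (RInt_ext (fun x => fst (D s x)) (fun q => Derive (fun r => fst (gtail z r q)) s)).
  2:{ intros q _. symmetry. apply is_derive_unique. exact (proj1 (gtail_der z q s)). }
  apply (is_derive_RInt_param (fun r q => fst (gtail z r q))).
  + exists (mkposreal 1 Rlt_0_1) => r _ q _. eexists. exact (proj1 (gtail_der z q r)).
  + intros q _. apply (continuity_2d_pt_ext (fun r q => fst (D r q))).
    { intros r y. symmetry. apply is_derive_unique. exact (proj1 (gtail_der z y r)). }
    apply continuity_2d_of_continuous. unfold D; simpl.
    destruct (continuous_cgauss_2d z (fun p => fst p) (s, q) (cf _)) as [a1 a2].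
    destruct (continuous_cgauss_2d z (fun p => fst p * snd p) (s, q) (cm _ _ _ (cf _) (cs _))) as [b1 b2].
    repeat match goal with
      | H : continuous ?f ?p |- continuous ?f ?p => exact H
      | |- continuous (fun _ => ?c) _ => apply (cc c)
      | |- continuous (fun p => fst p) _ => apply cf
      | |- continuous (fun p => @?f p + @?g p) _ => apply (cp f g)
      | |- continuous (fun p => @?f p - @?g p) _ => apply (cn f g)
      | |- continuous (fun p => @?f p * @?g p) _ => apply (cm f g)
      end.
  + exists (mkposreal 1 Rlt_0_1) => r _. apply cont_ex_RInt. exact (proj1 (gtail_Ccont z r)).
- rewrite (RInt_ext (fun x => snd (D s x)) (fun q => Derive (fun r => snd (gtail z r q)) s)).
  2:{ intros q _. symmetry. apply is_derive_unique. exact (proj2 (gtail_der z q s)). }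
  apply (is_derive_RInt_param (fun r q => snd (gtail z r q))).
  + exists (mkposreal 1 Rlt_0_1) => r _ q _. eexists. exact (proj2 (gtail_der z q r)).
  + intros q _. apply (continuity_2d_pt_ext (fun r q => snd (D r q))).
    { intros r y. symmetry. apply is_derive_unique. exact (proj2 (gtail_der z y r)). }
    apply continuity_2d_of_continuous. unfold D; simpl.
    destruct (continuous_cgauss_2d z (fun p => fst p) (s, q) (cf _)) as [a1 a2].
    destruct (continuous_cgauss_2d z (fun p => fst p * snd p) (s, q) (cm _ _ _ (cf _) (cs _))) as [b1 b2].
    repeat match goal with
      | H : continuous ?f ?p |- continuous ?f ?p => exact H
      | |- continuous (fun _ => ?c) _ => apply (cc c)
      | |- continuous (fun p => fst p) _ => apply cf
      | |- continuous (fun p => @?f p + @?g p) _ => apply (cp f g)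
      | |- continuous (fun p => @?f p - @?g p) _ => apply (cn f g)
      | |- continuous (fun p => @?f p * @?g p) _ => apply (cm f g)
      end.
  + exists (mkposreal 1 Rlt_0_1) => r _. apply cont_ex_RInt. exact (proj2 (gtail_Ccont z r)).
Qed.

Lemma derive_zero_const (g : R -> R) : (forall x, is_derive g x 0) -> forall x y, g x = g y.
Proof.
intros Hg x y. destruct (MVT_gen g y x (fun _ => 0)) as [c [_ E]].
- intros; apply Hg.
- intros; apply continuity_pt_filterlim. apply: ex_derive_continuous. eexists; apply Hg.
- lra.
Qed.

Lemma Cder_zero_const f : (forall x, is_Cder f x (RtoC 0)) -> forall x y, f x = f y.
Proof.
intros H x y. apply injective_projections.
- apply (derive_zero_const (fun x => fst (f x)) (fun x => proj1 (H x))).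
- apply (derive_zero_const (fun x => snd (f x)) (fun x => proj2 (H x))).
Qed.

(* Both sides agree at [s = 0], and the derivatives in [s] of the two summands cancel; the second summand
   vanishes as [s] grows. *)
Lemma gauss_square z s :
  Cplus (Cmult z (Cmult (CRInt (cgauss z) 0 s) (CRInt (cgauss z) 0 s))) (CRInt (gtail z s) 0 1) = RtoC (PI / 4).
Proof.
transitivity (Cplus (Cmult z (Cmult (CRInt (cgauss z) 0 0) (CRInt (cgauss z) 0 0))) (CRInt (gtail z 0) 0 1)).
- apply (Cder_zero_const (fun s => Cplus (Cmult z (Cmult (CRInt (cgauss z) 0 s) (CRInt (cgauss z) 0 s))) (CRInt (gtail z s) 0 1))).
  intros x.
  assert (E := CRInt_der (cgauss z) 0 x (cgauss_Ccont z)).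
  eapply is_Cder_eq; [|apply is_Cder_plus; [apply is_Cder_scal, is_Cder_mult; exact E|apply CRInt_gtail_der]].
  cbv beta. ring.
- unfold CRInt at 1 2. rewrite !RInt_point. unfold zero; simpl.
  replace (CRInt (gtail z 0) 0 1) with (RtoC (PI / 4)).
  + change (0, 0) with (RtoC 0). ring.
  + assert (E : forall q, gtail z 0 q = RtoC (/ (1 + q ^ 2))).
    { intros q. unfold gtail, cgauss. replace (0 ^ 2) with 0 by ring. rewrite Cmult_0_r /Cexp /= exp_0 cos_0 sin_0.
      apply injective_projections; simpl; ring. }
    unfold CRInt, RtoC. symmetry. f_equal; apply is_RInt_unique.
    * apply (is_RInt_ext (fun q => / (1 + q ^ 2))). { intros q _. by rewrite E. }
      replace (PI / 4) with (atan 1 - atan 0) by (rewrite atan_1 atan_0; ring).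
      apply: is_RInt_derive.
      -- intros x _. auto_derive. easy. unfold Rsqr. field. pose proof (one_le_1px2 x). simpl in *; lra.
      -- intros x _. apply: ex_derive_continuous. auto_derive. pose proof (one_le_1px2 x). simpl in *; lra.
    * apply (is_RInt_ext (fun q => 0)). { intros q _. by rewrite E. }
      assert (K := is_RInt_const 0 1 (0 : R)). rewrite /scal /= /mult /= Rmult_0_r in K. exact K.
Qed.

Lemma RInt_even g s : cont g -> (forall x, g (- x) = g x) -> RInt g (- s) s = 2 * RInt g 0 s.
Proof.
intros cg He.
assert (E := fun a b => cont_ex_RInt g a b cg).
rewrite -(RInt_Chasles g (- s) 0 s) // /plus /=.
assert (H := RInt_reflect g 0 s cg). rewrite Ropp_0 in H. rewrite -H.
rewrite (RInt_ext (fun x => g (- x)) g) //. ring.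
Qed.

Lemma is_lim_half_lint g l : cont g -> (forall x, g (- x) = g x) -> is_lint g l ->
  is_lim (fun s => 2 * RInt g 0 s) p_infty l.
Proof.
intros cg He Hl. apply is_lim_spec. intros eps.
destruct (proj1 (is_lintP g l cg) Hl eps (cond_pos eps)) as [M HM].
exists M. intros s Hs. rewrite -RInt_even //. apply HM; lra.
Qed.

Lemma is_lim_exp_gauss a : 0 < a -> is_lim (fun s => exp (- (a * s ^ 2))) p_infty 0.
Proof.
intros Ha. destruct (gauss_poly_decay a 0 Ha) as [K [HK H]].
apply (is_lim_decay _ K). intros x. specialize (H x). simpl in H. rewrite Rmult_1_l in H.
rewrite Rabs_pos_eq; [exact H|left; apply exp_pos].
Qed.

Lemma cgauss_lint z : 0 < fst z -> exists J, is_Clint (cgauss z) J.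
Proof.
intros Hz. apply (ex_Clint_gauss _ 1 0 (fst z) (cgauss_Ccont z) Hz).
intros x. rewrite Cmod_cgauss. simpl. right; ring.
Qed.

(** * Limits at infinity of real and complex functions *)

Lemma is_lim_Rabs_le (f g : R -> R) : (forall s, Rabs (f s) <= g s) -> is_lim g p_infty 0 -> is_lim f p_infty 0.
Proof.
intros H Hg. apply is_lim_spec. apply is_lim_spec in Hg. intros eps. destruct (Hg eps) as [M HM].
exists M. intros x Hx. specialize (HM x Hx). rewrite Rminus_0_r. rewrite Rminus_0_r in HM.
eapply Rle_lt_trans; [apply H|]. eapply Rle_lt_trans; [apply Rle_abs|exact HM].
Qed.

Lemma is_lim_Rmult f g a b : is_lim f p_infty (Finite a) -> is_lim g p_infty (Finite b) ->
  is_lim (fun s => f s * g s) p_infty (Finite (a * b)).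
Proof. intros H1 H2. by apply (is_lim_mult f g p_infty a b). Qed.
Lemma is_lim_Rplus f g a b : is_lim f p_infty (Finite a) -> is_lim g p_infty (Finite b) ->
  is_lim (fun s => f s + g s) p_infty (Finite (a + b)).
Proof. intros H1 H2. by apply (is_lim_plus f g p_infty a b). Qed.
Lemma is_lim_Rminus f g a b : is_lim f p_infty (Finite a) -> is_lim g p_infty (Finite b) ->
  is_lim (fun s => f s - g s) p_infty (Finite (a - b)).
Proof. intros H1 H2. by apply (is_lim_minus f g p_infty a b). Qed.

Definition is_Clim (f : R -> C) (l : C) : Prop :=
  is_lim (fun t => fst (f t)) p_infty (Finite (fst l)) /\ is_lim (fun t => snd (f t)) p_infty (Finite (snd l)).

Lemma is_Clim_mult f g a b : is_Clim f a -> is_Clim g b -> is_Clim (fun t => Cmult (f t) (g t)) (Cmult a b).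
Proof.
intros [f1 f2] [g1 g2]. split; simpl.
- apply is_lim_Rminus; by apply is_lim_Rmult.
- apply is_lim_Rplus; by apply is_lim_Rmult.
Qed.
Lemma is_Clim_plus f g a b : is_Clim f a -> is_Clim g b -> is_Clim (fun t => Cplus (f t) (g t)) (Cplus a b).
Proof. intros [f1 f2] [g1 g2]. split; simpl; by apply is_lim_Rplus. Qed.
Lemma is_Clim_const c : is_Clim (fun _ => c) c.
Proof. split; apply is_lim_const. Qed.
Lemma is_Clim_unique f a b : is_Clim f a -> is_Clim f b -> a = b.
Proof.
intros [f1 f2] [g1 g2]. apply injective_projections.
- apply is_lim_unique in f1. apply is_lim_unique in g1. rewrite f1 in g1. by injection g1.
- apply is_lim_unique in f2. apply is_lim_unique in g2. rewrite f2 in g2. by injection g2.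
Qed.
Lemma is_Clim_0 f : is_lim (fun t => Cmod (f t)) p_infty 0 -> is_Clim f (RtoC 0).
Proof.
intros H. split; simpl.
- by apply (is_lim_Rabs_le _ (fun t => Cmod (f t))) => // s; apply fst_le_Cmod.
- by apply (is_lim_Rabs_le _ (fun t => Cmod (f t))) => // s; apply snd_le_Cmod.
Qed.
Lemma is_Clim_ext f g l : (forall t, f t = g t) -> is_Clim f l -> is_Clim g l.
Proof.
intros H [H1 H2]. split.
- apply (is_lim_ext (fun t => fst (f t))) => // t; by rewrite H.
- apply (is_lim_ext (fun t => snd (f t))) => // t; by rewrite H.
Qed.

(** Four times [gauss_square] in the limit: evenness doubles the half-line integral. Giving only the
    square of [J] avoids choosing a branch of the complex root; the uses below need [J^2] or [|J|],
    or have a positive real [J]. *)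
Lemma cgauss_lint_square z J : 0 < fst z -> is_Clint (cgauss z) J -> Cmult z (Cmult J J) = RtoC PI.
Proof.
intros Hz [J1 J2].
assert (Hev : forall x, cgauss z (- x) = cgauss z x).
{ intros x. unfold cgauss. do 3 f_equal. ring. }
destruct (cgauss_Ccont z) as [c1 c2].
assert (LE : is_Clim (fun s => Cmult (RtoC 2) (CRInt (cgauss z) 0 s)) J).
{ split.
  - apply (is_lim_ext (fun s => 2 * RInt (fun x => fst (cgauss z x)) 0 s)). { intros; simpl; ring. }
    apply is_lim_half_lint => // x. by rewrite Hev.
  - apply (is_lim_ext (fun s => 2 * RInt (fun x => snd (cgauss z x)) 0 s)). { intros; simpl; ring. }
    apply is_lim_half_lint => // x. by rewrite Hev. }
assert (LK : is_Clim (fun s => CRInt (gtail z s) 0 1) (RtoC 0)).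
{ apply is_Clim_0. apply (is_lim_Rabs_le _ (fun s => 2 * exp (- (fst z * s ^ 2)))).
  - intros s. rewrite Rabs_pos_eq; [|apply Cmod_ge_0].
    apply CRInt_bound; [apply gtail_Ccont|]. intros q _. unfold gtail.
    pose proof (one_le_1px2 q) as Hq. pose proof (pow2_ge_0 s) as Hs.
    rewrite Cmod_mult Cmod_cgauss Cmod_R Rabs_pos_eq.
    2:{ left; apply Rinv_0_lt_compat; lra. }
    rewrite -[X in _ <= X]Rmult_1_l. apply Rmult_le_compat.
    + left; apply Rinv_0_lt_compat; lra.
    + left; apply exp_pos.
    + rewrite -Rinv_1. apply Rinv_le_contravar; lra.
    + apply exp_mono. destruct z as [z1 z2]. cbn [fst snd RtoC Cmult].
      simpl fst. simpl in Hz. pose proof (pow2_ge_0 q). assert (0 <= z1 * (q ^ 2 * s ^ 2)).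
      { apply Rmult_le_pos; [lra|]. by apply Rmult_le_pos. } lra.
  - replace 0 with (2 * 0) by ring. apply is_lim_Rmult; [apply is_lim_const|by apply is_lim_exp_gauss]. }
apply (is_Clim_unique (fun s => Cplus (Cmult z (Cmult (Cmult (RtoC 2) (CRInt (cgauss z) 0 s)) (Cmult (RtoC 2) (CRInt (cgauss z) 0 s))))
   (Cmult (RtoC 4) (CRInt (gtail z s) 0 1)))).
- replace (Cmult z (Cmult J J)) with (Cplus (Cmult z (Cmult J J)) (Cmult (RtoC 4) (RtoC 0))) by ring.
  apply is_Clim_plus; apply is_Clim_mult; [apply is_Clim_const|by apply is_Clim_mult|apply is_Clim_const|exact LK].
- apply (is_Clim_ext (fun _ => RtoC PI)); [|exact (is_Clim_const (RtoC PI))].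
  intros s. replace PI with (4 * (PI / 4)) by field. rewrite RtoC_mult -(gauss_square z s).
  replace (RtoC 4) with (Cmult (RtoC 2) (RtoC 2)); [ring|]. rewrite -RtoC_mult. f_equal; ring.
Qed.

(** * The moments of the Weber integral *)

Lemma is_derive_quadratic (F : R -> R) s l K :
  (forall h, Rabs h <= 1 -> Rabs (F (s + h) - F s - h * l) <= K * h ^ 2) -> is_derive F s l.
Proof.
intros H. apply is_derive_Reals. intros eps He.
assert (HK : 0 <= K).
{ specialize (H 1 ltac:(rewrite Rabs_R1; lra)). pose proof (Rabs_pos (F (s + 1) - F s - 1 * l)). lra. }
assert (Hd : 0 < Rmin 1 (eps / (K + 1))).
{ apply Rmin_pos; [lra|]. apply Rdiv_lt_0_compat; lra. }
exists (mkposreal _ Hd). simpl. intros h Hh Hlt.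
assert (H1 : Rabs h < 1) by (eapply Rlt_le_trans; [exact Hlt|apply Rmin_l]).
assert (H2 : Rabs h < eps / (K + 1)) by (eapply Rlt_le_trans; [exact Hlt|apply Rmin_r]).
assert (Hh' : 0 < Rabs h) by by apply Rabs_pos_lt.
replace ((F (s + h) - F s) / h - l) with ((F (s + h) - F s - h * l) * / h) by (field; lra).
rewrite Rabs_mult Rabs_inv. specialize (H h ltac:(lra)). rewrite -(pow2_abs h) in H.
apply Rmult_lt_reg_r with (Rabs h) => //. rewrite Rmult_assoc Rinv_l; [|lra]. rewrite Rmult_1_r.
assert (E : eps / (K + 1) * (K + 1) = eps) by (field; lra).
eapply Rle_lt_trans; [exact H|].
apply Rmult_lt_compat_r with (r := K + 1) in H2; [|lra]. rewrite E in H2.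
apply Rmult_lt_compat_r with (r := Rabs h) in H2 => //. nra.
Qed.

Lemma is_Clint_bound f g l b : (forall x, Cmod (f x) <= g x) -> is_Clint f l -> is_lint g b -> Cmod l <= 2 * b.
Proof.
intros H [H1 H2] Hb. eapply Rle_trans; [apply Cmod_le_abs|].
assert (Rabs (fst l) <= b).
{ apply (is_lint_abs (fun x => fst (f x)) g) => // x. eapply Rle_trans; [apply fst_le_Cmod|apply H]. }
assert (Rabs (snd l) <= b).
{ apply (is_lint_abs (fun x => snd (f x)) g) => // x. eapply Rle_trans; [apply snd_le_Cmod|apply H]. }
lra.
Qed.

(** Differentiation under an improper integral. The Taylor remainder of the kernel is at most
    [2 h^2] times the integrable function [B], so its integral is of order [h^2] and no limit has to
    be exchanged with the integral. *)
Lemma is_Cder_param (k k' k'' : R -> R -> C) (F : R -> C) (B : R -> R) s l b :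
  (forall r q, is_Cder (fun r => k r q) r (k' r q)) ->
  (forall r q, is_Cder (fun r => k' r q) r (k'' r q)) ->
  (forall r q, s - 1 <= r <= s + 1 -> Cmod (k'' r q) <= B q) ->
  is_lint B b -> (forall r, is_Clint (k r) (F r)) -> is_Clint (k' s) l -> is_Cder F s l.
Proof.
intros D1 D2 HB Hb HF Hl.
assert (K : forall h, Rabs h <= 1 ->
   Cmod (Cminus (Cminus (F (s + h)) (F s)) (Cmult (RtoC h) l)) <= 2 * (2 * h ^ 2 * b)).
{ intros h Hh.
  apply (is_Clint_bound (fun q => Cminus (Cminus (k (s + h) q) (k s q)) (Cmult (RtoC h) (k' s q)))
    (fun q => 2 * h ^ 2 * B q)).
  - intros q. replace (2 * h ^ 2 * B q) with (2 * B q * h ^ 2) by ring.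
    apply (Ctaylor1 (fun r => k r q) (fun r => k' r q) (fun r => k'' r q)) => // r Hr.
    apply HB. apply Rabs_le_between in Hh. revert Hr. unfold Rmin, Rmax. repeat destruct Rle_dec; lra.
  - apply (is_Clint_ext (fun q => Cplus (Cplus (k (s + h) q) (Cmult (Copp (RtoC 1)) (k s q))) (Cmult (Copp (RtoC h)) (k' s q)))).
    { intros q. ring. }
    replace (Cminus (Cminus (F (s + h)) (F s)) (Cmult (RtoC h) l)) with
      (Cplus (Cplus (F (s + h)) (Cmult (Copp (RtoC 1)) (F s))) (Cmult (Copp (RtoC h)) l)) by ring.
    apply is_Clint_plus; [apply is_Clint_plus => //|]; by apply is_Clint_scal.
  - by apply is_lint_scal. }
split; apply (is_derive_quadratic _ _ _ (4 * b)); intros h Hh; specialize (K h Hh).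
- assert (T := fst_le_Cmod (Cminus (Cminus (F (s + h)) (F s)) (Cmult (RtoC h) l))).
  replace (fst (F (s + h)) - fst (F s) - h * fst l) with (fst (Cminus (Cminus (F (s + h)) (F s)) (Cmult (RtoC h) l)))
    by (simpl; ring). lra.
- assert (T := snd_le_Cmod (Cminus (Cminus (F (s + h)) (F s)) (Cmult (RtoC h) l))).
  replace (snd (F (s + h)) - snd (F s) - h * snd l) with (snd (Cminus (Cminus (F (s + h)) (F s)) (Cmult (RtoC h) l)))
    by (simpl; ring). lra.
Qed.

(** Substituting [y = q^2] shows that for [k = 0] the integral over [q] is [sqrt PI * exp (c^2 s^2 /
    4) * D_{-1/2} (c s)]. The even powers are those brought down by differentiating in [s]. *)
Definition weber_kernel (c : C) (k : nat) (s q : R) : C :=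
  Cmult (RtoC (q ^ (2 * k))) (Cexp (Cplus (Cmult (Copp c) (RtoC (s * q ^ 2))) (RtoC (- (q ^ 4 / 2))))).

Definition moment (c : C) (k : nat) (s : R) : C :=
  (Rline_int (fun q => fst (weber_kernel c k s q)), Rline_int (fun q => snd (weber_kernel c k s q))).

Lemma pow_even_ge0 q k : 0 <= q ^ (2 * k).
Proof. rewrite pow_mult. apply pow_le, pow2_ge_0. Qed.

Lemma Cmod_weber_kernel c k s q : Cmod (weber_kernel c k s q) = q ^ (2 * k) * exp (- (fst c * s * q ^ 2) - q ^ 4 / 2).
Proof.
unfold weber_kernel. rewrite Cmod_mult Cmod_Cexp Cmod_R Rabs_pos_eq; [|apply pow_even_ge0].
f_equal. f_equal. simpl. field.
Qed.

Lemma weber_kernel_bound c k S : exists C, 0 <= C /\ forall s q, Rabs s <= S ->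
  Cmod (weber_kernel c k s q) <= C * (1 + q ^ 2) ^ k * exp (- (1 * q ^ 2)).
Proof.
set (A := Rabs (fst c) * S).
(* With [y = q^2], completing the square gives [A y - y^2 / 2 <= (A + 1)^2 / 2 - y]. *)
exists (exp ((A + 1) ^ 2 / 2)). split; [left; apply exp_pos|].
intros s q Hs. rewrite Cmod_weber_kernel.
replace (exp ((A + 1) ^ 2 / 2) * (1 + q ^ 2) ^ k * exp (- (1 * q ^ 2))) with
  ((1 + q ^ 2) ^ k * exp ((A + 1) ^ 2 / 2 + - (1 * q ^ 2))) by (rewrite exp_plus; ring).
apply Rmult_le_compat; [apply pow_even_ge0|left; apply exp_pos| |].
- rewrite pow_mult. apply pow_incr. pose proof (pow2_ge_0 q). lra.
- apply exp_mono.
  assert (H : - (fst c * s) <= A).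
  { eapply Rle_trans; [apply Rle_abs|]. rewrite Rabs_Ropp Rabs_mult. unfold A.
    apply Rmult_le_compat_l => //. apply Rabs_pos. }
  assert (Hq := pow2_ge_0 q). replace (q ^ 4) with ((q ^ 2) ^ 2) by ring.
  set (y := q ^ 2) in *. assert (- (fst c * s) * y <= A * y) by (by apply Rmult_le_compat_r).
  pose proof (pow2_ge_0 (y - (A + 1))). lra.
Qed.

Lemma weber_kernel_qder c s q : is_Cder (fun q => Cexp (Cplus (Cmult (Copp c) (RtoC (s * q ^ 2))) (RtoC (- (q ^ 4 / 2))))) q
  (Cmult (Cminus (Cmult (Copp c) (RtoC (2 * s * q))) (RtoC (2 * q ^ 3)))
    (Cexp (Cplus (Cmult (Copp c) (RtoC (s * q ^ 2))) (RtoC (- (q ^ 4 / 2)))))).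
Proof.
eapply is_Cder_eq; [|apply is_Cder_Cexp, is_Cder_plus; [apply is_Cder_scal, (is_Cder_RtoC _ q (2 * s * q))|
  apply (is_Cder_RtoC _ q (- (2 * q ^ 3)))]].
- rewrite RtoC_opp. cbv beta. ring.
- auto_derive. easy. ring.
- auto_derive. easy. field.
Qed.

Lemma weber_kernel_Ccont c k s : Ccont (weber_kernel c k s).
Proof.
apply Ccont_mult.
- apply Ccont_RtoC. cont_auto.
- exact (is_Cder_Ccont _ _ (weber_kernel_qder c s)).
Qed.

Lemma moment_lint c k s : is_Clint (weber_kernel c k s) (moment c k s).
Proof.
destruct (weber_kernel_bound c k (Rabs s)) as [C [HC HB]].
destruct (ex_Clint_gauss (weber_kernel c k s) C k 1 (weber_kernel_Ccont c k s) Rlt_0_1) as [l [H1 H2]].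
{ intros x. apply HB. lra. }
split; simpl; apply ex_lint_correct; [by exists (fst l)|by exists (snd l)].
Qed.

Lemma weber_kernel_sder c k q s : is_Cder (fun s => weber_kernel c k s q) s (Cmult (Copp c) (weber_kernel c (S k) s q)).
Proof.
eapply is_Cder_eq; [|apply is_Cder_scal, is_Cder_Cexp, is_Cder_plus; [apply is_Cder_scal, (is_Cder_RtoC _ s (q ^ 2))|
  apply is_Cder_const]].
- unfold weber_kernel. replace (2 * S k)%nat with (2 * k + 2)%nat by lia. rewrite (pow_add q (2 * k) 2) (RtoC_mult (q ^ (2 * k))). cbv beta. ring.
- auto_derive. easy. ring.
Qed.

Lemma moment_der c k s : is_Cder (moment c k) s (Cmult (Copp c) (moment c (S k) s)).
Proof.
destruct (weber_kernel_bound c (S (S k)) (Rabs s + 1)) as [C [HC HB]].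
destruct (gauss_poly_decay 1 (S (S k)) Rlt_0_1) as [K [HK HK2]].
destruct ex_lint_inv_1px2 as [I HI].
set (D := Cmod (Copp c) ^ 2 * C * K).
apply (is_Cder_param (weber_kernel c k) (fun s q => Cmult (Copp c) (weber_kernel c (S k) s q))
  (fun s q => Cmult (Copp c) (Cmult (Copp c) (weber_kernel c (S (S k)) s q))) _ (fun q => D * / (1 + q ^ 2)) s _ (D * I)).
- intros r q. apply weber_kernel_sder.
- intros r q. apply is_Cder_scal, weber_kernel_sder.
- intros r q Hr. rewrite !(Cmod_mult (Copp c)).
  assert (Hr' : Rabs r <= Rabs s + 1).
  { replace r with (s + (r - s)) by ring. eapply Rle_trans; [apply Rabs_triang|]. apply Rplus_le_compat_l. apply Rabs_le; lra. }
  specialize (HB r q Hr'). specialize (HK2 q).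
  apply Rle_trans with (Cmod (Copp c) ^ 2 * (C * (K * / (1 + q ^ 2)))).
  + apply Rle_trans with (Cmod (Copp c) ^ 2 * Cmod (weber_kernel c (S (S k)) r q)); [right; ring|].
    apply (Rmult_le_compat_l (Cmod (Copp c) ^ 2)); [apply pow2_ge_0|]. eapply Rle_trans; [apply HB|].
    rewrite Rmult_assoc. by apply Rmult_le_compat_l.
  + unfold D. right; ring.
- by apply is_lint_scal.
- intros r. apply moment_lint.
- apply is_Clint_scal, moment_lint.
Qed.

(** The left side is the integral of the [q]-derivative of [q * weber_kernel c 0 s q]. *)
Lemma moment_recurrence c s :
  Cminus (Cminus (moment c 0 s) (Cmult (Cmult (RtoC (2 * s)) c) (moment c 1 s))) (Cmult (RtoC 2) (moment c 2 s)) = RtoC 0.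
Proof.
set (g := fun q => Cplus (Cplus (weber_kernel c 0 s q) (Cmult (Copp (Cmult (RtoC (2 * s)) c)) (weber_kernel c 1 s q))) (Cmult (Copp (RtoC 2)) (weber_kernel c 2 s q))).
transitivity (Cplus (Cplus (moment c 0 s) (Cmult (Copp (Cmult (RtoC (2 * s)) c)) (moment c 1 s))) (Cmult (Copp (RtoC 2)) (moment c 2 s))).
{ ring. }
apply (is_Clint_inj g).
{ apply is_Clint_plus; [apply is_Clint_plus; [apply moment_lint|]|]; apply is_Clint_scal, moment_lint. }
destruct (weber_kernel_bound c 0 (Rabs s)) as [C [HC HB]].
apply (is_Clint_derive_gauss (fun q => Cmult (RtoC q) (weber_kernel c 0 s q)) _ C 1 1).
- intros q.
  apply (is_Cder_ext (fun q => Cmult (RtoC q) (Cexp (Cplus (Cmult (Copp c) (RtoC (s * q ^ 2))) (RtoC (- (q ^ 4 / 2))))))).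
  { intros y. unfold weber_kernel. simpl (2 * 0)%nat. rewrite pow_O. ring. }
  eapply is_Cder_eq; [|apply is_Cder_mult; [apply (is_Cder_RtoC (fun y => y) q 1); apply: is_derive_id|apply weber_kernel_qder]].
  unfold g, weber_kernel. simpl (2 * 0)%nat. simpl (2 * 1)%nat. simpl (2 * 2)%nat. rewrite pow_O.
  set (e := Cexp _).
  replace (q ^ 4) with (q * q ^ 3) by ring. replace (q ^ 2) with (q * q) by ring.
  rewrite (RtoC_mult (2 * s) q) (RtoC_mult 2 (q ^ 3)) (RtoC_mult q q) (RtoC_mult q (q ^ 3)). ring.
- unfold g. apply Ccont_plus; [apply Ccont_plus; [apply weber_kernel_Ccont|]|];
    (apply Ccont_mult; [apply Ccont_const|apply weber_kernel_Ccont]).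
- lra.
- intros q. rewrite Cmod_mult Cmod_R. specialize (HB s q ltac:(lra)). rewrite pow_O Rmult_1_r in HB.
  rewrite pow_1. replace (C * (1 + q ^ 2) * exp (- (1 * q ^ 2))) with ((1 + q ^ 2) * (C * exp (- (1 * q ^ 2)))) by ring.
  apply Rmult_le_compat => //; [apply Rabs_pos|apply Cmod_ge_0|].
  rewrite -(pow2_abs q). pose proof (pow2_ge_0 (Rabs q - 1)). pose proof (Rabs_pos q). nra.
Qed.

Lemma moment_at_0 c k : exists a, 0 < a /\ moment c k 0 = RtoC a.
Proof.
destruct (moment_lint c k 0) as [H1 H2].
assert (E : forall q, weber_kernel c k 0 q = RtoC (q ^ (2 * k) * exp (- (q ^ 4 / 2)))).
{ intros q. unfold weber_kernel. rewrite Rmult_0_l Cmult_0_r Cplus_0_l /Cexp /= cos_0 sin_0.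
  apply injective_projections; simpl; ring. }
exists (fst (moment c k 0)). split.
- assert (H0 : 0 <= fst (moment c k 0)).
  { apply (is_lint_ge0 (fun q => fst (weber_kernel c k 0 q))) => // q. rewrite E /=.
    apply Rmult_le_pos; [apply pow_even_ge0|left; apply exp_pos]. }
  destruct H0 as [H0|H0] => //. exfalso. rewrite -H0 in H1.
  assert (Z := is_lint_pos_eq0 (fun q => fst (weber_kernel c k 0 q)) (proj1 (weber_kernel_Ccont c k 0))).
  (* The point [q = 1] is used because the kernel vanishes at [q = 0] when [k > 0]. *)
  assert (Z' : fst (weber_kernel c k 0 1) = 0).
  { apply Z => // q. rewrite E /=. apply Rmult_le_pos; [apply pow_even_ge0|left; apply exp_pos]. }
  rewrite E in Z'. rewrite /= pow1 in Z'. pose proof (exp_pos (- (1 * (1 * (1 * (1 * 1))) / 2))). lra.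
- apply injective_projections; simpl => //.
  apply is_lint_unique. apply (is_lint_ext (fun _ => 0)); [|apply is_lint_0].
  intros q. change (0 = snd (weber_kernel c k 0 q)). by rewrite E.
Qed.

(** * Scaling, and the moments for large time *)

Lemma is_lint_comp_scal g l k : cont g -> 0 < k -> is_lint g l -> is_lint (fun x => g (k * x)) (l / k).
Proof.
intros cg Hk Hl.
assert (cgk : cont (fun x => g (k * x))) by (apply (cont_comp g (fun x => k * x)); [exact cg|cont_auto]).
apply is_lintP => // eps He.
destruct (proj1 (is_lintP g l cg) Hl (eps * k)) as [M HM]; [by apply Rmult_lt_0_compat|].
exists (M / k). intros a b Ha Hb.
assert (E := RInt_comp_lin g k 0 a b (cont_ex_RInt _ _ _ cg)). rewrite !Rplus_0_r in E.
assert (E2 : RInt (fun x => g (k * x)) a b = RInt g (k * a) (k * b) / k).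
{ rewrite -E. apply Rmult_eq_reg_l with k; [|lra].
  transitivity (RInt (fun y => scal k (g (k * y + 0))) a b : R).
  2:{ unfold Rdiv. rewrite (Rmult_comm _ (/ k)) -Rmult_assoc Rinv_r; [|lra]. by rewrite Rmult_1_l. }
  symmetry. apply is_RInt_unique. apply (is_RInt_ext (fun x => scal k (g (k * x)))).
  { intros x _. by rewrite Rplus_0_r. }
  apply: is_RInt_scal. apply: RInt_correct. by apply cont_ex_RInt. }
rewrite E2.
assert (H : Rabs (RInt g (k * a) (k * b) - l) < eps * k).
{ apply HM.
  - apply Rmult_lt_compat_l with (r := k) in Ha => //. replace (k * - (M / k)) with (- M) in Ha by (field; lra). lra.
  - apply Rmult_lt_compat_l with (r := k) in Hb => //. replace (k * (M / k)) with M in Hb by (field; lra). lra. }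
replace (RInt g (k * a) (k * b) / k - l / k) with ((RInt g (k * a) (k * b) - l) * / k)
  by (unfold Rdiv; ringR).
rewrite Rabs_mult Rabs_inv (Rabs_pos_eq k); [|lra].
apply Rmult_lt_reg_r with k => //. rewrite Rmult_assoc Rinv_l; [|lra]. by rewrite Rmult_1_r.
Qed.

Lemma is_Clint_comp_scal f l k : Ccont f -> 0 < k -> is_Clint f l ->
  is_Clint (fun x => f (k * x)) (Cmult (RtoC (/ k)) l).
Proof.
intros [c1 c2] Hk [H1 H2]. split.
- replace (fst (Cmult (RtoC (/ k)) l)) with (fst l / k) by (simpl; field; lra).
  by apply (is_lint_comp_scal (fun x => fst (f x))).
- replace (snd (Cmult (RtoC (/ k)) l)) with (snd l / k) by (simpl; field; lra).
  by apply (is_lint_comp_scal (fun x => snd (f x))).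
Qed.

Lemma gauss_moment beta n : 0 < beta -> exists l, 0 <= l /\ is_lint (fun x => x ^ (2 * n) * exp (- (beta * x ^ 2))) l.
Proof.
intros Hb. destruct (gauss_poly_decay beta n Hb) as [K [HK HK2]].
destruct (ex_lint_decay (fun x => x ^ (2 * n) * exp (- (beta * x ^ 2))) K) as [l Hl].
- cont_auto.
- intros x. rewrite Rabs_pos_eq.
  + eapply Rle_trans; [|apply HK2]. apply Rmult_le_compat_r; [left; apply exp_pos|].
    rewrite pow_mult. apply pow_incr. pose proof (pow2_ge_0 x). lra.
  + apply Rmult_le_pos; [apply pow_even_ge0|left; apply exp_pos].
- exists l. split => //. apply (is_lint_ge0 _ _) in Hl => // x.
  apply Rmult_le_pos; [apply pow_even_ge0|left; apply exp_pos].
Qed.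

Lemma gauss_moment_scaled beta n l t : 0 < t -> is_lint (fun x => x ^ (2 * n) * exp (- (beta * x ^ 2))) l ->
  is_lint (fun x => x ^ (2 * n) * exp (- (beta * t * x ^ 2))) (/ t ^ n * (l / sqrt t)).
Proof.
intros Ht Hl.
assert (Hs := sqrt_lt_R0 t Ht).
apply (is_lint_comp_scal _ _ (sqrt t)) in Hl => //; [|cont_auto].
apply (is_lint_ext (fun x => / t ^ n * ((sqrt t * x) ^ (2 * n) * exp (- (beta * (sqrt t * x) ^ 2))))).
- intros x. rewrite !Rpow_mult_distr pow_mult pow2_sqrt; [|lra].
  rewrite -Rmult_assoc -Rmult_assoc Rinv_l; [|apply pow_nonzero; lra]. rewrite Rmult_1_l.
  do 3 f_equal. ring.
- by apply is_lint_scal.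
Qed.

(** Dropping the quartic leaves a Gaussian of width [1 / sqrt t], with integral [J / sqrt t]. The
    error is at most [q^4 / 2] times the modulus of that Gaussian; the fourth moment scales like
    [t^(-5/2)], and [sqrt t] makes it [t^(-2)]. *)
Lemma moment0_asymp c J : 0 < fst c -> is_Clint (cgauss c) J -> exists K, 0 <= K /\ forall t, 0 < t ->
  Cmod (Cminus (Cmult (RtoC (sqrt t)) (moment c 0 t)) J) <= K * (/ t ^ 2).
Proof.
intros Hc HJ.
destruct (gauss_moment (fst c) 2 Hc) as [l [Hl0 Hl]].
exists l. split => // t Ht.
assert (Hs := sqrt_lt_R0 t Ht).
assert (HJt := is_Clint_comp_scal _ _ _ (cgauss_Ccont c) Hs HJ).
assert (Hlt := is_lint_scal _ (/ 2) _ (gauss_moment_scaled _ _ _ _ Ht Hl)).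
assert (Hd := is_Clint_plus _ _ _ _ (moment_lint c 0 t) (is_Clint_scal (Copp (RtoC 1)) _ _ HJt)).
assert (P : forall x, Cmod (Cplus (weber_kernel c 0 t x) (Cmult (Copp (RtoC 1)) (cgauss c (sqrt t * x)))) <=
   / 2 * (x ^ (2 * 2) * exp (- (fst c * t * x ^ 2)))).
{ intros q. cbv beta.
assert (E : Cplus (weber_kernel c 0 t q) (Cmult (Copp (RtoC 1)) (cgauss c (sqrt t * q))) =
   Cmult (RtoC (exp (- (q ^ 4 / 2)) - 1)) (cgauss c (sqrt t * q))).
{ unfold weber_kernel, cgauss. rewrite Cexp_plus. simpl (2 * 0)%nat. rewrite pow_O.
  rewrite Rpow_mult_distr pow2_sqrt; [|lra].
  replace (Cexp (RtoC (- (q ^ 4 / 2)))) with (RtoC (exp (- (q ^ 4 / 2)))).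
  - rewrite RtoC_minus. ring.
  - unfold Cexp. simpl. rewrite cos_0 sin_0. apply injective_projections; simpl; ring. }
rewrite E Cmod_mult Cmod_cgauss Cmod_R Rpow_mult_distr pow2_sqrt; [|lra].
rewrite -(Rmult_assoc (/ 2)) (Rmult_assoc (fst c)).
apply Rmult_le_compat_r; [left; apply exp_pos|].
assert (H4 : 0 <= q ^ 4) by (replace (q ^ 4) with ((q ^ 2) ^ 2) by ring; apply pow2_ge_0).
rewrite Rabs_left1.
- assert (T := exp_ineq1_le (- (q ^ 4 / 2))). simpl in *. lra.
- assert (exp (- (q ^ 4 / 2)) <= exp 0) by (apply exp_mono; lra). rewrite exp_0 in H. lra. }
assert (B := is_Clint_bound _ _ _ _ P Hd Hlt).
replace (Cminus (Cmult (RtoC (sqrt t)) (moment c 0 t)) J) with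
  (Cmult (RtoC (sqrt t)) (Cplus (moment c 0 t) (Cmult (Copp (RtoC 1)) (Cmult (RtoC (/ sqrt t)) J)))).
2:{ rewrite RtoC_inv; [|lra]. field. intros E. apply (f_equal fst) in E. simpl in E. lra. }
rewrite Cmod_mult Cmod_R Rabs_pos_eq; [|lra].
apply Rmult_le_compat_l with (r := sqrt t) in B; [|lra].
eapply Rle_trans; [apply B|]. right. field. split; lra.
Qed.

Lemma moment1_asymp c : 0 < fst c -> exists K, 0 <= K /\ forall t, 0 < t ->
  sqrt t * Cmod (moment c 1 t) <= K * (/ t).
Proof.
intros Hc.
destruct (gauss_moment (fst c) 1 Hc) as [l [Hl0 Hl]].
exists (2 * l). split; [lra|]. intros t Ht.
assert (Hs := sqrt_lt_R0 t Ht).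
assert (Hlt := gauss_moment_scaled _ _ _ _ Ht Hl).
assert (B : Cmod (moment c 1 t) <= 2 * (/ t ^ 1 * (l / sqrt t))).
{ refine (is_Clint_bound _ _ _ _ _ (moment_lint c 1 t) Hlt).
  intros q. rewrite Cmod_weber_kernel. apply Rmult_le_compat_l; [apply pow_even_ge0|]. apply exp_mono.
  assert (H4 : 0 <= q ^ 4) by (replace (q ^ 4) with ((q ^ 2) ^ 2) by ring; apply pow2_ge_0). lra. }
apply Rmult_le_compat_l with (r := sqrt t) in B; [|lra].
eapply Rle_trans; [apply B|]. right. field. split; lra.
Qed.

(** * Solutions of the classical oscillator and the squeezing ratio *)

(** The square root of [- 2 i alpha] with positive real part: the square makes the moment recurrence
    equivalent to the oscillator equation, and the sign gives a decaying Gaussian as [s] tends to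
    plus infinity. *)
Definition weber_coef (alpha : R) : C := (sqrt alpha, - sqrt alpha).

Definition osc (alpha s : R) : C := Cexp (Cmult Ci (RtoC (alpha * s ^ 2 / 2))).

Definition weber (alpha s : R) : C := Cmult (osc alpha s) (moment (weber_coef alpha) 0 s).

Definition weber' (alpha s : R) : C :=
  Cmult (osc alpha s) (Cplus (Cmult (Cmult Ci (RtoC (alpha * s))) (moment (weber_coef alpha) 0 s))
                             (Cmult (Copp (weber_coef alpha)) (moment (weber_coef alpha) 1 s))).

Lemma weber_coef_square alpha : 0 < alpha -> Cmult (weber_coef alpha) (weber_coef alpha) = Cmult (Copp (RtoC (2 * alpha))) Ci.
Proof.
intros Ha. assert (E := sqrt_sqrt alpha ltac:(lra)).
apply injective_projections; simpl; nra.
Qed.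

Lemma Ci_square : Cmult Ci Ci = Copp (RtoC 1).
Proof. apply injective_projections; simpl; ring. Qed.

Lemma osc_der alpha s : is_Cder (osc alpha) s (Cmult (Cmult Ci (RtoC (alpha * s))) (osc alpha s)).
Proof.
eapply is_Cder_eq; [|apply is_Cder_Cexp, is_Cder_scal, (is_Cder_RtoC _ s (alpha * s))].
- reflexivity.
- auto_derive. easy. field.
Qed.

Lemma weber_der alpha s : is_Cder (weber alpha) s (weber' alpha s).
Proof.
eapply is_Cder_eq; [|apply is_Cder_mult; [apply osc_der|apply moment_der]].
unfold weber'. ring.
Qed.

Lemma weber'_der alpha s : 0 < alpha ->
  is_Cder (weber' alpha) s (Cmult (Copp (RtoC (alpha ^ 2 * s ^ 2))) (weber alpha s)).
Proof.
intros Ha.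
assert (D1 : is_derive (fun s => alpha * s) s alpha) by (auto_derive; [easy|ring]).
eapply is_Cder_eq; [|apply is_Cder_mult; [apply osc_der|apply is_Cder_plus;
  [apply is_Cder_mult; [apply is_Cder_scal, (is_Cder_RtoC _ s alpha D1)|apply moment_der]|
   apply is_Cder_scal, moment_der]]].
cbv beta. unfold weber.
assert (R := moment_recurrence (weber_coef alpha) s).
set (M0 := moment _ 0 s) in *. set (M1 := moment _ 1 s) in *. set (M2 := moment _ 2 s) in *.
assert (E2 : Cminus M0 (Cmult (Cmult (RtoC (2 * s)) (weber_coef alpha)) M1) = Cmult (RtoC 2) M2).
{ transitivity (Cplus (Cminus (Cminus M0 (Cmult (Cmult (RtoC (2 * s)) (weber_coef alpha)) M1)) (Cmult (RtoC 2) M2))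
   (Cmult (RtoC 2) M2)); [ring|]. rewrite R. ring. }
set (e := osc alpha s).
(* The terms are grouped so that the recurrence turns the bracket with [M0] and [M1] into [2 M2];
   then [2 i alpha M2] cancels against [c^2 M2]. *)
transitivity (Cplus (Cmult (Cmult (Cmult Ci Ci) (RtoC (alpha ^ 2 * s ^ 2))) (Cmult e M0))
  (Cmult e (Cplus (Cmult (Cmult Ci (RtoC alpha)) (Cminus M0 (Cmult (Cmult (RtoC (2 * s)) (weber_coef alpha)) M1)))
     (Cmult (Cmult (weber_coef alpha) (weber_coef alpha)) M2)))).
- replace (alpha ^ 2 * s ^ 2) with ((alpha * s) * (alpha * s)) by ring.
  rewrite !RtoC_mult. replace (RtoC 2) with (Cplus (RtoC 1) (RtoC 1)) by (rewrite -RtoC_plus; f_equal; ring). ring.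
- rewrite E2 Ci_square weber_coef_square // (RtoC_mult 2 alpha). ring.
Qed.

Lemma osc_0 alpha : osc alpha 0 = RtoC 1.
Proof.
unfold osc. replace (alpha * 0 ^ 2 / 2) with 0 by field. rewrite Cmult_0_r /Cexp /= exp_0 cos_0 sin_0.
apply injective_projections; simpl; ring.
Qed.

(** The derivative at 0 is [- c] times a positive moment, hence lies along [-1 + i]. So
    [Re f + Im f] has derivative 0 there and [Im f] has value 0. *)
Lemma weber_0 alpha : 0 < alpha -> exists a k, 0 < a /\ 0 < k /\ weber alpha 0 = (a, 0) /\ weber' alpha 0 = (- k, k).
Proof.
intros Ha. destruct (moment_at_0 (weber_coef alpha) 0) as [a [Pa Ea]]. destruct (moment_at_0 (weber_coef alpha) 1) as [b [Pb Eb]].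
exists a, (sqrt alpha * b). split => //. split. { apply Rmult_lt_0_compat => //. by apply sqrt_lt_R0. }
unfold weber, weber'. rewrite osc_0 Ea Eb. split; apply injective_projections; simpl; ring.
Qed.

Definition weber_even alpha s := fst (weber alpha s) + snd (weber alpha s).
Definition weber_even' alpha s := fst (weber' alpha s) + snd (weber' alpha s).
Definition weber_odd alpha s := snd (weber alpha s).
Definition weber_odd' alpha s := snd (weber' alpha s).

Lemma weber_even_der alpha s : is_derive (weber_even alpha) s (weber_even' alpha s).
Proof. destruct (weber_der alpha s). by apply Rderive_plus. Qed.
Lemma weber_odd_der alpha s : is_derive (weber_odd alpha) s (weber_odd' alpha s).
Proof. exact (proj2 (weber_der alpha s)). Qed.
Lemma weber_even'_der alpha s : 0 < alpha -> is_derive (weber_even' alpha) s (- (alpha ^ 2 * s ^ 2) * weber_even alpha s).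
Proof.
intros Ha. destruct (weber'_der alpha s Ha) as [H1 H2].
eapply is_derive_eq; [|apply Rderive_plus; [exact H1|exact H2]]. unfold weber_even. simpl. ring.
Qed.
Lemma weber_odd'_der alpha s : 0 < alpha -> is_derive (weber_odd' alpha) s (- (alpha ^ 2 * s ^ 2) * weber_odd alpha s).
Proof.
intros Ha. destruct (weber'_der alpha s Ha) as [H1 H2].
eapply is_derive_eq; [|exact H2]. unfold weber_odd. simpl. ring.
Qed.

Lemma wronskian_const (d d' e e' w : R -> R) :
  (forall s, is_derive d s (d' s)) -> (forall s, is_derive e s (e' s)) ->
  (forall s, is_derive d' s (w s * d s)) -> (forall s, is_derive e' s (w s * e s)) ->
  forall s, d s * e' s - d' s * e s = d 0 * e' 0 - d' 0 * e 0.
Proof.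
intros D E D' E' s.
apply (derive_zero_const (fun s => d s * e' s - d' s * e s)).
intros x. eapply is_derive_eq; [|apply Rderive_minus; apply Rderive_mult; [apply D|apply E'|apply D'|apply E]]. ringR.
Qed.

Lemma weber_wronskian alpha : 0 < alpha -> exists w0, 0 < w0 /\
  forall s, weber_even alpha s * weber_odd' alpha s - weber_even' alpha s * weber_odd alpha s = w0.
Proof.
intros Ha. destruct (weber_0 alpha Ha) as [a [k [Pa [Pk [E1 E2]]]]].
exists (a * k). split. { by apply Rmult_lt_0_compat. }
intros s. rewrite (wronskian_const (weber_even alpha) (weber_even' alpha) (weber_odd alpha) (weber_odd' alpha) (fun s => - (alpha ^ 2 * s ^ 2))).
- unfold weber_even, weber_even', weber_odd, weber_odd'. rewrite E1 E2. simpl. ring.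
- apply weber_even_der.
- apply weber_odd_der.
- intros; by apply weber_even'_der.
- intros; by apply weber_odd'_der.
Qed.

(** The Wronskians of [d] with the two explicit solutions are constant and vanish at 0; as those
    solutions are independent, Cramer's rule leaves only [d = d' = 0]. Uniqueness serves to
    establish the parities. *)
Lemma ode_zero alpha (d d' : R -> R) : 0 < alpha ->
  (forall s, is_derive d s (d' s)) -> (forall s, is_derive d' s (- (alpha ^ 2 * s ^ 2) * d s)) ->
  d 0 = 0 -> d' 0 = 0 -> forall s, d s = 0 /\ d' s = 0.
Proof.
intros Ha D D' H0 H0' s.
destruct (weber_wronskian alpha Ha) as [w0 [Pw Ew]]. specialize (Ew s).
assert (W1 := wronskian_const d d' (weber_even alpha) (weber_even' alpha) (fun s => - (alpha ^ 2 * s ^ 2)) D (weber_even_der alpha) D'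
   (fun s => weber_even'_der alpha s Ha) s).
assert (W2 := wronskian_const d d' (weber_odd alpha) (weber_odd' alpha) (fun s => - (alpha ^ 2 * s ^ 2)) D (weber_odd_der alpha) D'
   (fun s => weber_odd'_der alpha s Ha) s).
rewrite H0 H0' in W1 W2.
split; apply Rmult_eq_reg_l with w0; try lra; rewrite -Ew.
- transitivity (weber_even alpha s * (d s * weber_odd' alpha s - d' s * weber_odd alpha s) - weber_odd alpha s * (d s * weber_even' alpha s - d' s * weber_even alpha s)); [ring|].
  rewrite W1 W2. ring.
- transitivity (weber_even' alpha s * (d s * weber_odd' alpha s - d' s * weber_odd alpha s) - weber_odd' alpha s * (d s * weber_even' alpha s - d' s * weber_even alpha s)); [ring|].
  rewrite W1 W2. ring.
Qed.

Lemma Rderive_reflect (f : R -> R) x a : is_derive f (- x) a -> is_derive (fun y => f (- y)) x (- a).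
Proof.
intros H. auto_derive. eexists; exact H. rewrite (is_derive_unique _ _ _ H). ring.
Qed.

Lemma weber_even_sym alpha s : 0 < alpha -> weber_even alpha (- s) = weber_even alpha s /\ weber_even' alpha (- s) = - weber_even' alpha s.
Proof.
intros Ha. destruct (weber_0 alpha Ha) as [a [k [_ [_ [E1 E2]]]]].
destruct (ode_zero alpha (fun s => weber_even alpha s - weber_even alpha (- s)) (fun s => weber_even' alpha s + weber_even' alpha (- s)) Ha) with s as [H1 H2].
- intros x. eapply is_derive_eq; [|apply Rderive_minus; [apply weber_even_der|apply Rderive_reflect, weber_even_der]]. ringR.
- intros x. eapply is_derive_eq; [|apply Rderive_plus; [by apply weber_even'_der|by apply Rderive_reflect, weber_even'_der]]. ringR.
- rewrite Ropp_0. ring.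
- rewrite Ropp_0. unfold weber_even'. rewrite E2. simpl. ring.
- split; lra.
Qed.

Lemma weber_odd_antisym alpha s : 0 < alpha -> weber_odd alpha (- s) = - weber_odd alpha s /\ weber_odd' alpha (- s) = weber_odd' alpha s.
Proof.
intros Ha. destruct (weber_0 alpha Ha) as [a [k [_ [_ [E1 E2]]]]].
destruct (ode_zero alpha (fun s => weber_odd alpha s + weber_odd alpha (- s)) (fun s => weber_odd' alpha s - weber_odd' alpha (- s)) Ha) with s as [H1 H2].
- intros x. eapply is_derive_eq; [|apply Rderive_plus; [apply weber_odd_der|apply Rderive_reflect, weber_odd_der]]. ringR.
- intros x. eapply is_derive_eq; [|apply Rderive_minus; [by apply weber_odd'_der|by apply Rderive_reflect, weber_odd'_der]]. ringR.
- rewrite Ropp_0. unfold weber_odd. rewrite E1. simpl. ring.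
- rewrite Ropp_0. ring.
- split; lra.
Qed.

Lemma is_Cder_inv f x a : f x <> RtoC 0 -> is_Cder f x a ->
  is_Cder (fun y => Cinv (f y)) x (Copp (Cdiv a (Cmult (f x) (f x)))).
Proof.
intros Hf [H1 H2].
assert (Hn : fst (f x) ^ 2 + snd (f x) ^ 2 <> 0).
{ rewrite -Cmod_sqr. apply pow_nonzero. apply Cmod_gt_0 in Hf. lra. }
assert (Hn' : fst (f x) * fst (f x) + snd (f x) * snd (f x) <> 0).
{ intros E. apply Hn. rewrite -E. ring. }
assert (Dn : is_derive (fun y => fst (f y) * fst (f y) + snd (f y) * snd (f y)) x
   (fst a * fst (f x) + fst (f x) * fst a + (snd a * snd (f x) + snd (f x) * snd a))).
{ apply Rderive_plus; by apply Rderive_mult. }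
assert (Di := Rderive_inv _ x _ Hn' Dn). cbv beta in Di.
split.
- apply (is_derive_fun_eq (fun y => fst (f y) * / (fst (f y) * fst (f y) + snd (f y) * snd (f y)))).
  { intros y. simpl. unfold Rdiv. do 3 f_equal; ring. }
  eapply is_derive_eq; [|apply Rderive_mult; [exact H1|exact Di]].
  cbv beta. destruct (f x) as [p q], a as [b c]. simpl in *. field.
  split; [|lra]. intros E.
  assert (E' : (p * p + q * q) * (p * p + q * q) = 0) by (ring_simplify; ring_simplify in E; lra).
  apply Rmult_integral in E'. lra.
- apply (is_derive_fun_eq (fun y => (0 - snd (f y)) * / (fst (f y) * fst (f y) + snd (f y) * snd (f y)))).
  { intros y. simpl. unfold Rdiv. rewrite Rminus_0_l. do 3 f_equal; ring. }
  eapply is_derive_eq; [|apply Rderive_mult; [apply Rderive_minus; [apply: is_derive_const|exact H2]|exact Di]].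
  cbv beta. destruct (f x) as [p q], a as [b c]. rewrite /zero. simpl in *. field.
  split; [|lra]. intros E.
  assert (E' : (p * p + q * q) * (p * p + q * q) = 0) by (ring_simplify; ring_simplify in E; lra).
  apply Rmult_integral in E'. lra.
Qed.

(* The complex solution of [y'' + alpha^2 s^2 y = 0] with [y'(-t) = i alpha t y(-t)], up to a constant factor. *)
Definition classical_sol (alpha t s : R) : C :=
  (weber_odd' alpha t * weber_even alpha s + weber_even' alpha t * weber_odd alpha s,
   alpha * t * (weber_odd alpha t * weber_even alpha s + weber_even alpha t * weber_odd alpha s)).
Definition classical_sol' (alpha t s : R) : C :=
  (weber_odd' alpha t * weber_even' alpha s + weber_even' alpha t * weber_odd' alpha s,
   alpha * t * (weber_odd alpha t * weber_even' alpha s + weber_even alpha t * weber_odd' alpha s)).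

Lemma Rderive_lin (f g : R -> R) k l x a b : is_derive f x a -> is_derive g x b ->
  is_derive (fun y => k * f y + l * g y) x (k * a + l * b).
Proof.
intros H1 H2. eapply is_derive_eq; [|apply Rderive_plus; apply Rderive_mult;
  [apply: is_derive_const|exact H1|apply: is_derive_const|exact H2]]. rewrite /zero /=. ring.
Qed.

Lemma classical_sol_der alpha t s : is_Cder (classical_sol alpha t) s (classical_sol' alpha t s).
Proof.
split; simpl.
- apply Rderive_lin; [apply weber_even_der|apply weber_odd_der].
- eapply is_derive_eq; [|apply Rderive_mult; [apply: is_derive_const|apply Rderive_lin; [apply weber_even_der|apply weber_odd_der]]].
  rewrite /zero /=. ring.
Qed.

Lemma classical_sol'_der alpha t s : 0 < alpha ->
  is_Cder (classical_sol' alpha t) s (Cmult (Copp (RtoC (alpha ^ 2 * s ^ 2))) (classical_sol alpha t s)).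
Proof.
intros Ha. split; simpl.
- eapply is_derive_eq; [|apply Rderive_lin; [by apply weber_even'_der|by apply weber_odd'_der]]. simpl. ring.
- eapply is_derive_eq; [|apply Rderive_mult; [apply: is_derive_const|apply Rderive_lin; [by apply weber_even'_der|by apply weber_odd'_der]]].
  rewrite /zero /=. ring.
Qed.

Definition riccati_sol (alpha t s : R) : C := Cdiv (classical_sol' alpha t s) (classical_sol alpha t s).

(** The left side is [Im (conj y * y')] for the complex solution [y]: the determinant [alpha t w0]
    of its coefficients in the even-odd basis, times [w0]. Its positivity shows both that [y] never
    vanishes and that [y' / y] has positive imaginary part. *)
Lemma classical_sol_wronskian alpha t s w0 :
  (forall r, weber_even alpha r * weber_odd' alpha r - weber_even' alpha r * weber_odd alpha r = w0) ->
  fst (classical_sol alpha t s) * snd (classical_sol' alpha t s) - snd (classical_sol alpha t s) * fst (classical_sol' alpha t s) = alpha * t * w0 ^ 2.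
Proof.
intros W. simpl.
transitivity (alpha * t * ((weber_even alpha t * weber_odd' alpha t - weber_even' alpha t * weber_odd alpha t) * (weber_even alpha s * weber_odd' alpha s - weber_even' alpha s * weber_odd alpha s))); [ring|].
rewrite !W. ring.
Qed.

Lemma classical_sol_neq0 alpha t s : 0 < alpha -> 0 < t -> classical_sol alpha t s <> RtoC 0.
Proof.
intros Ha Ht E. destruct (weber_wronskian alpha Ha) as [w0 [Pw W]].
assert (H := classical_sol_wronskian alpha t s w0 W). rewrite E in H.
simpl in H. assert (0 < alpha * t * w0 ^ 2).
{ apply Rmult_lt_0_compat; [by apply Rmult_lt_0_compat|by apply pow_lt]. }
simpl in *. lra.
Qed.

Lemma riccati_sol_riccati alpha t : 0 < alpha -> 0 < t -> riccati alpha (riccati_sol alpha t).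
Proof.
intros Ha Ht s. assert (Hy := classical_sol_neq0 alpha t s Ha Ht). split.
- eapply is_Cder_eq; [|apply is_Cder_mult; [by apply classical_sol'_der|apply is_Cder_inv; [exact Hy|apply classical_sol_der]]].
  unfold riccati_sol. field. exact Hy.
- destruct (weber_wronskian alpha Ha) as [w0 [Pw W]].
  assert (H := classical_sol_wronskian alpha t s w0 W).
  assert (P : 0 < alpha * t * w0 ^ 2).
  { apply Rmult_lt_0_compat; [by apply Rmult_lt_0_compat|by apply pow_lt]. }
  assert (Hn : 0 < fst (classical_sol alpha t s) ^ 2 + snd (classical_sol alpha t s) ^ 2).
  { rewrite -Cmod_sqr. apply pow_lt. by apply Cmod_gt_0. }
  unfold riccati_sol. destruct (classical_sol alpha t s) as [p q], (classical_sol' alpha t s) as [p' q']. simpl in *.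
  replace (p' * (- q / (p * (p * 1) + q * (q * 1))) + q' * (p / (p * (p * 1) + q * (q * 1)))) with
    ((p * q' - q * p') / (p * (p * 1) + q * (q * 1))) by (field; lra).
  apply Rdiv_lt_0_compat; lra.
Qed.

Lemma riccati_sol_start alpha t : 0 < alpha -> 0 < t -> riccati_sol alpha t (- t) = (0, alpha * t).
Proof.
intros Ha Ht. assert (Hy := classical_sol_neq0 alpha t (- t) Ha Ht).
assert (E : classical_sol' alpha t (- t) = Cmult (0, alpha * t) (classical_sol alpha t (- t))).
{ unfold classical_sol, classical_sol'. destruct (weber_even_sym alpha t Ha) as [-> ->]. destruct (weber_odd_antisym alpha t Ha) as [-> ->].
  apply injective_projections; simpl; ring. }
unfold riccati_sol. rewrite E. field. exact Hy.
Qed.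

Definition squeeze (w : R) (g : C) : C := Copp (Cdiv (Cplus (RtoC w) (Cmult Ci g)) (Cminus (RtoC w) (Cmult Ci g))).

(** The phase-space point [w y + i y'] of a real solution [y], with [w = alpha t]; its argument is
    the phase of the oscillation. *)
Definition even_phase alpha t : C := (alpha * t * weber_even alpha t, weber_even' alpha t).
Definition odd_phase alpha t : C := (alpha * t * weber_odd alpha t, weber_odd' alpha t).

Lemma phase_product_neq0 alpha t : 0 < alpha -> 0 < t -> Cmult (even_phase alpha t) (odd_phase alpha t) <> RtoC 0.
Proof.
intros Ha Ht. destruct (weber_wronskian alpha Ha) as [w0 [Pw W]]. specialize (W t).
assert (P : 0 < alpha * t) by by apply Rmult_lt_0_compat.
apply Cmult_neq_0; intros E; apply (f_equal fst) in E as E1; apply (f_equal snd) in E as E2; simpl in E1, E2;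
  apply Rmult_integral in E1; destruct E1 as [E1|E1]; try lra; rewrite E1 E2 in W; lra.
Qed.

(** With [P], [Q] the even and odd points, [w y + i y'] is [2 i Re (conj P * Q)] and [w y - i y'] is
    [2 i conj (P Q)]. So the modulus of the ratio is the cosine, up to sign, of the angle between
    [P] and [Q], and up to sign its phase is that of [P Q]. *)
Lemma squeeze_riccati_sol alpha t : 0 < alpha -> 0 < t -> squeeze (alpha * t) (riccati_sol alpha t t) =
  Copp (Cdiv (RtoC (fst (Cmult (Cconj (even_phase alpha t)) (odd_phase alpha t)))) (Cconj (Cmult (even_phase alpha t) (odd_phase alpha t)))).
Proof.
intros Ha Ht. assert (Hy := classical_sol_neq0 alpha t t Ha Ht). assert (Hpq := phase_product_neq0 alpha t Ha Ht).
set (R := RtoC (fst (Cmult (Cconj (even_phase alpha t)) (odd_phase alpha t)))).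
set (Q := Cconj (Cmult (even_phase alpha t) (odd_phase alpha t))).
assert (HQ : Q <> RtoC 0).
{ intros E. apply Hpq. apply Cmod_eq_0. rewrite -Cmod_conj -/Q E. apply Cmod_0. }
assert (E1 : Cplus (Cmult (RtoC (alpha * t)) (classical_sol alpha t t)) (Cmult Ci (classical_sol' alpha t t)) = Cmult (Cmult (RtoC 2) Ci) R).
{ unfold R, classical_sol, classical_sol', even_phase, odd_phase. apply injective_projections; simpl; ring. }
assert (E2 : Cminus (Cmult (RtoC (alpha * t)) (classical_sol alpha t t)) (Cmult Ci (classical_sol' alpha t t)) = Cmult (Cmult (RtoC 2) Ci) Q).
{ unfold Q, classical_sol, classical_sol', even_phase, odd_phase. apply injective_projections; simpl; ring. }
assert (H2i : Cmult (RtoC 2) Ci <> RtoC 0).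
{ intros E. apply (f_equal snd) in E. simpl in E. lra. }
assert (HQ2 : Cmult (Cmult (RtoC 2) Ci) Q <> RtoC 0) by by apply Cmult_neq_0.
unfold squeeze, riccati_sol.
replace (Cplus (RtoC (alpha * t)) (Cmult Ci (Cdiv (classical_sol' alpha t t) (classical_sol alpha t t)))) with
  (Cdiv (Cplus (Cmult (RtoC (alpha * t)) (classical_sol alpha t t)) (Cmult Ci (classical_sol' alpha t t))) (classical_sol alpha t t)) by (field; exact Hy).
replace (Cminus (RtoC (alpha * t)) (Cmult Ci (Cdiv (classical_sol' alpha t t) (classical_sol alpha t t)))) with
  (Cdiv (Cminus (Cmult (RtoC (alpha * t)) (classical_sol alpha t t)) (Cmult Ci (classical_sol' alpha t t))) (classical_sol alpha t t)) by (field; exact Hy).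
rewrite E1 E2. clearbody Q R. generalize dependent (Cmult (RtoC 2) Ci). intros k _ _ Hk HkQ. field.
repeat split => //.
Qed.

(** * Asymptotics of the squeezing ratio *)

Lemma is_Clim_ext_pos f g l : (forall t, 0 < t -> f t = g t) -> is_Clim f l -> is_Clim g l.
Proof.
intros H [H1 H2]. split.
- apply (is_lim_ext_loc (fun t => fst (f t))) => //. exists 0. intros t Ht. by rewrite H.
- apply (is_lim_ext_loc (fun t => snd (f t))) => //. exists 0. intros t Ht. by rewrite H.
Qed.

Lemma is_lim_0_inv (f : R -> R) K : (forall t, 1 <= t -> Rabs (f t) <= K * / t) -> is_lim f p_infty 0.
Proof.
intros H. apply is_lim_spec. intros eps. assert (He := cond_pos eps).
exists (Rmax 1 (Rabs K / eps)). intros t Ht.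
assert (H1 : 1 < t) by (eapply Rle_lt_trans; [apply Rmax_l|exact Ht]).
assert (H2 : Rabs K / eps < t) by (eapply Rle_lt_trans; [apply Rmax_r|exact Ht]).
rewrite Rminus_0_r. eapply Rle_lt_trans; [apply H; lra|].
apply Rmult_lt_reg_r with t; [lra|]. rewrite Rmult_assoc Rinv_l; [|lra]. rewrite Rmult_1_r.
apply Rmult_lt_compat_r with (r := eps) in H2 => //.
unfold Rdiv in H2. rewrite Rmult_assoc Rinv_l in H2; [|lra]. rewrite Rmult_1_r in H2.
pose proof (Rle_abs K). lra.
Qed.

Lemma is_Clim_0_inv f K : (forall t, 1 <= t -> Cmod (f t) <= K * / t) -> is_Clim f (RtoC 0).
Proof.
intros H. apply is_Clim_0. apply (is_lim_0_inv _ K). intros t Ht. rewrite Rabs_pos_eq; [by apply H|apply Cmod_ge_0].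
Qed.

Lemma is_Clim_conj f l : is_Clim f l -> is_Clim (fun t => Cconj (f t)) (Cconj l).
Proof.
intros [H1 H2]. split; simpl => //. by apply (is_lim_opp (fun t => snd (f t)) p_infty (snd l)).
Qed.

Lemma is_Clim_opp f l : is_Clim f l -> is_Clim (fun t => Copp (f t)) (Copp l).
Proof.
intros [H1 H2]. split; simpl.
- by apply (is_lim_opp (fun t => fst (f t)) p_infty (fst l)).
- by apply (is_lim_opp (fun t => snd (f t)) p_infty (snd l)).
Qed.

Lemma is_Clim_re f l : is_Clim f l -> is_Clim (fun t => RtoC (fst (f t))) (RtoC (fst l)).
Proof. intros [H1 H2]. split; simpl => //. apply is_lim_const. Qed.

Lemma is_Clim_inv f l : l <> RtoC 0 -> is_Clim f l -> is_Clim (fun t => Cinv (f t)) (Cinv l).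
Proof.
intros Hl [H1 H2].
assert (Hn : fst l * fst l + snd l * snd l <> 0).
{ apply Cmod_gt_0 in Hl. pose proof (Cmod_sqr l). assert (0 < Cmod l ^ 2) by by apply pow_lt. simpl in *. lra. }
assert (Ln : is_lim (fun t => / (fst (f t) * fst (f t) + snd (f t) * snd (f t))) p_infty (Finite (/ (fst l * fst l + snd l * snd l)))).
{ apply (is_lim_inv (fun t => fst (f t) * fst (f t) + snd (f t) * snd (f t)) p_infty (Finite (fst l * fst l + snd l * snd l))).
  - apply is_lim_Rplus; by apply is_lim_Rmult.
  - intros E. injection E. exact Hn. }
split; simpl.
- apply (is_lim_ext (fun t => fst (f t) * / (fst (f t) * fst (f t) + snd (f t) * snd (f t)))).
  { intros t. unfold Rdiv. do 3 f_equal; ring. }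
  replace (fst l / _) with (fst l * / (fst l * fst l + snd l * snd l)) by (unfold Rdiv; do 3 f_equal; ring).
  by apply is_lim_Rmult.
- apply (is_lim_ext (fun t => (0 - snd (f t)) * / (fst (f t) * fst (f t) + snd (f t) * snd (f t)))).
  { intros t. unfold Rdiv. rewrite Rminus_0_l. do 3 f_equal; ring. }
  replace (- snd l / _) with ((0 - snd l) * / (fst l * fst l + snd l * snd l)) by (unfold Rdiv; rewrite Rminus_0_l; do 3 f_equal; ring).
  apply is_lim_Rmult => //. apply is_lim_Rminus => //. apply is_lim_const.
Qed.

Definition leading_part alpha t : C := Cmult (RtoC (sqrt t)) (moment (weber_coef alpha) 0 t).
Definition error_part alpha t : C :=
  Cmult (RtoC (sqrt t / (2 * (alpha * t)))) (Cmult (Copp (weber_coef alpha)) (moment (weber_coef alpha) 1 t)).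

(** As [f' = i w f] up to the term with [moment 1], the leading part cancels in [w f + i f'] and
    doubles in [w conj f + i conj f']. Since [Re f + Im f = Re ((1 - i) f)] and [Im f = Re (- i f)],
    the leading parts of the two points are [1 + i] and [i] times [conj (leading_part) / 2]. *)
Definition even_phase_scaled alpha t : C :=
  Cmult (RtoC (/ 2)) (Cplus (Cmult (1, 1) (Cmult (Cmult (osc alpha t) (osc alpha t)) (error_part alpha t)))
    (Cmult (1, 1) (Cplus (Cconj (leading_part alpha t)) (Cmult Ci (Cconj (error_part alpha t)))))).
Definition odd_phase_scaled alpha t : C :=
  Cmult (RtoC (/ 2)) (Cplus (Cmult (Cmult (osc alpha t) (osc alpha t)) (error_part alpha t))
    (Cmult Ci (Cplus (Cconj (leading_part alpha t)) (Cmult Ci (Cconj (error_part alpha t)))))).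

Lemma osc_conj alpha t : Cmult (osc alpha t) (Cconj (osc alpha t)) = RtoC 1.
Proof.
unfold osc, Cexp. apply injective_projections; simpl.
- replace (0 * (alpha * (t * (t * 1)) / 2) - 1 * 0) with 0 by ring. rewrite exp_0.
  set (x := _ + _). pose proof (sin2_cos2 x) as E. unfold Rsqr in E. lra.
- ring.
Qed.

Lemma even_phase_eq alpha t : 0 < alpha -> 0 < t ->
  even_phase alpha t = Cmult (RtoC (2 * (alpha * t) / sqrt t)) (Cmult (Cconj (osc alpha t)) (even_phase_scaled alpha t)).
Proof.
intros Ha Ht. assert (Hs := sqrt_lt_R0 t Ht). assert (Hat : 0 < alpha * t) by by apply Rmult_lt_0_compat.
assert (Ho := osc_conj alpha t).
unfold even_phase_scaled, leading_part, error_part, even_phase, weber_even, weber_even', weber, weber'.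
destruct (osc alpha t) as [c s]. destruct (moment (weber_coef alpha) 0 t) as [x y].
destruct (Cmult (Copp (weber_coef alpha)) (moment (weber_coef alpha) 1 t)) as [g h].
assert (Ho' : c * c + s * s = 1). { apply (f_equal fst) in Ho. simpl in Ho. lra. }
set (w := alpha * t) in *.
transitivity (Cmult (RtoC (/ 2)) (Cplus (Cmult (1, 1) (Cmult (Cmult (c, s) (Cconj (c, s))) (Cmult (c, s) (g, h))))
  (Cmult (1, 1) (Cmult (Cconj (c, s)) (Cplus (Cmult (RtoC (2 * w)) (Cconj (x, y))) (Cmult Ci (Cconj (g, h)))))))).
- rewrite Ho. apply injective_projections; simpl; field.
- apply injective_projections; simpl; field; lra.
Qed.

Lemma odd_phase_eq alpha t : 0 < alpha -> 0 < t ->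
  odd_phase alpha t = Cmult (RtoC (2 * (alpha * t) / sqrt t)) (Cmult (Cconj (osc alpha t)) (odd_phase_scaled alpha t)).
Proof.
intros Ha Ht. assert (Hs := sqrt_lt_R0 t Ht). assert (Hat : 0 < alpha * t) by by apply Rmult_lt_0_compat.
assert (Ho := osc_conj alpha t).
unfold odd_phase_scaled, leading_part, error_part, odd_phase, weber_odd, weber_odd', weber, weber'.
destruct (osc alpha t) as [c s]. destruct (moment (weber_coef alpha) 0 t) as [x y].
destruct (Cmult (Copp (weber_coef alpha)) (moment (weber_coef alpha) 1 t)) as [g h].
set (w := alpha * t) in *.
transitivity (Cmult (RtoC (/ 2)) (Cplus (Cmult (Cmult (c, s) (Cconj (c, s))) (Cmult (c, s) (g, h)))
  (Cmult Ci (Cmult (Cconj (c, s)) (Cplus (Cmult (RtoC (2 * w)) (Cconj (x, y))) (Cmult Ci (Cconj (g, h)))))))).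
- rewrite Ho. apply injective_projections; simpl; field.
- apply injective_projections; simpl; field; lra.
Qed.

Lemma Cconj_mult a b : Cconj (Cmult a b) = Cmult (Cconj a) (Cconj b).
Proof. apply injective_projections; simpl; ring. Qed.
Lemma Cconj_conj a : Cconj (Cconj a) = a.
Proof. apply injective_projections; simpl; ring. Qed.
Lemma Cconj_RtoC r : Cconj (RtoC r) = RtoC r.
Proof. apply injective_projections; simpl; ring. Qed.

(** The common real prefactor of the two points cancels. Their common unimodular factor [conj osc]
    disappears from [conj P * Q] and leaves [osc^2] in [conj (P Q)], which the product on the left
    removes. *)
Lemma squeeze_scaled alpha t : 0 < alpha -> 0 < t ->
  Cmult (squeeze (alpha * t) (riccati_sol alpha t t)) (Cmult (osc alpha t) (osc alpha t)) =
  Copp (Cmult (RtoC (fst (Cmult (Cconj (even_phase_scaled alpha t)) (odd_phase_scaled alpha t)))) (Cinv (Cconj (Cmult (even_phase_scaled alpha t) (odd_phase_scaled alpha t))))).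
Proof.
intros Ha Ht. rewrite squeeze_riccati_sol //. assert (Hpq := phase_product_neq0 alpha t Ha Ht). revert Hpq.
rewrite (even_phase_eq alpha t Ha Ht) (odd_phase_eq alpha t Ha Ht).
set (k := 2 * (alpha * t) / sqrt t). set (e := osc alpha t). set (p := even_phase_scaled alpha t). set (q := odd_phase_scaled alpha t).
intros Hpq.
assert (Hk : k <> 0).
{ intros E. apply Hpq. rewrite E. ring. }
assert (He : Cmult e (Cconj e) = RtoC 1) by apply osc_conj.
assert (He0 : e <> RtoC 0). { intros E. rewrite E in He. apply (f_equal fst) in He. simpl in He. lra. }
assert (Hpq0 : Cconj (Cmult p q) <> RtoC 0).
{ intros E. apply Hpq. assert (E' : Cmult p q = RtoC 0). { rewrite -(Cconj_conj (Cmult p q)) E. apply Cconj_RtoC. }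
  transitivity (Cmult (Cmult (Cmult (RtoC k) (RtoC k)) (Cmult (Cconj e) (Cconj e))) (Cmult p q)); [ring|]. rewrite E'. ring. }
assert (E1 : RtoC (fst (Cmult (Cconj (Cmult (RtoC k) (Cmult (Cconj e) p))) (Cmult (RtoC k) (Cmult (Cconj e) q)))) =
   Cmult (Cmult (RtoC k) (RtoC k)) (RtoC (fst (Cmult (Cconj p) q)))).
{ assert (E0 : Cmult (Cconj (Cmult (RtoC k) (Cmult (Cconj e) p))) (Cmult (RtoC k) (Cmult (Cconj e) q)) =
    Cmult (RtoC (k * k)) (Cmult (Cconj p) q)).
  { rewrite (Cconj_mult (RtoC k)) (Cconj_mult (Cconj e) p) Cconj_conj Cconj_RtoC RtoC_mult.
    transitivity (Cmult (Cmult e (Cconj e)) (Cmult (Cmult (RtoC k) (RtoC k)) (Cmult (Cconj p) q))); [ring|].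
    rewrite He. ring. }
  rewrite E0 -RtoC_mult. clearbody k e p q. apply injective_projections; simpl; ring. }
assert (E2 : Cconj (Cmult (Cmult (RtoC k) (Cmult (Cconj e) p)) (Cmult (RtoC k) (Cmult (Cconj e) q))) =
  Cmult (Cmult (Cmult (RtoC k) (RtoC k)) (Cmult e e)) (Cconj (Cmult p q))).
{ clearbody k e p q. rewrite !Cconj_mult !Cconj_conj !Cconj_RtoC. ring. }
rewrite E1 E2. generalize dependent (Cconj (Cmult p q)). intros z Hz _.
generalize (RtoC (fst (Cmult (Cconj p) q))). intros r.
assert (Hk' : RtoC k <> RtoC 0). { intros E. apply Hk. by apply (f_equal fst) in E. }
field. repeat split => //.
Qed.

Lemma inv_t2_le t : 1 <= t -> / t ^ 2 <= / t.
Proof. intros Ht. apply Rinv_le_contravar; [lra|]. nra. Qed.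

Lemma leading_part_lim alpha J : 0 < alpha -> is_Clint (cgauss (weber_coef alpha)) J -> is_Clim (leading_part alpha) J.
Proof.
intros Ha HJ.
destruct (moment0_asymp (weber_coef alpha) J) as [K [HK B]] => //. { by apply sqrt_lt_R0. }
apply (is_Clim_ext (fun t => Cplus (Cminus (leading_part alpha t) J) J)). { intros t. ring. }
rewrite -[X in is_Clim _ X]Cplus_0_l.
apply is_Clim_plus; [|apply is_Clim_const].
apply (is_Clim_0_inv _ K). intros t Ht. eapply Rle_trans; [apply B; lra|].
apply Rmult_le_compat_l => //. by apply inv_t2_le.
Qed.

(** The unimodular factor is included because [osc^2] has no limit of its own. *)
Lemma error_part_lim alpha (e : R -> C) : 0 < alpha -> (forall t, Cmod (e t) = 1) ->
  is_Clim (fun t => Cmult (e t) (error_part alpha t)) (RtoC 0).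
Proof.
intros Ha He.
destruct (moment1_asymp (weber_coef alpha)) as [K [HK B]]. { by apply sqrt_lt_R0. }
apply (is_Clim_0_inv _ (/ (2 * alpha) * (Cmod (weber_coef alpha) * K))). intros t Ht.
assert (Hs := sqrt_lt_R0 t ltac:(lra)).
rewrite Cmod_mult He Rmult_1_l /error_part !Cmod_mult Cmod_opp Cmod_R Rabs_pos_eq.
2:{ left. apply Rdiv_lt_0_compat => //. nra. }
specialize (B t ltac:(lra)).
replace (sqrt t / (2 * (alpha * t)) * (Cmod (weber_coef alpha) * Cmod (moment (weber_coef alpha) 1 t))) with
  (/ (2 * alpha) * (Cmod (weber_coef alpha) * (/ t * (sqrt t * Cmod (moment (weber_coef alpha) 1 t))))) by (field; lra).
rewrite !Rmult_assoc.
assert (H2 : 0 < / (2 * alpha)) by (apply Rinv_0_lt_compat; lra).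
apply Rmult_le_compat_l; [lra|]. apply Rmult_le_compat_l; [apply Cmod_ge_0|].
apply Rle_trans with (1 * (sqrt t * Cmod (moment (weber_coef alpha) 1 t))); [|lra].
apply Rmult_le_compat_r.
- apply Rmult_le_pos; [lra|apply Cmod_ge_0].
- rewrite -Rinv_1. apply Rinv_le_contravar; lra.
Qed.

Lemma Cmod_osc alpha t : Cmod (osc alpha t) = 1.
Proof. unfold osc. rewrite Cmod_Cexp. simpl. replace (_ - _) with 0 by ring. apply exp_0. Qed.

(** The equation [sqrt alpha (1 - i) J^2 = PI] puts [J^2] on the ray of [1 + i]: real and imaginary
    parts agree and are positive, and [|J|^2 = |J^2|] is [sqrt 2] times either. *)
Lemma weber_coef_gauss alpha J : 0 < alpha -> is_Clint (cgauss (weber_coef alpha)) J ->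
  0 < 2 * (fst J * snd J) /\ fst J * fst J - snd J * snd J = 2 * (fst J * snd J) /\
  fst J * fst J + snd J * snd J = sqrt 2 * (2 * (fst J * snd J)).
Proof.
intros Ha HJ. assert (Hs := sqrt_lt_R0 alpha Ha).
assert (E := cgauss_lint_square (weber_coef alpha) J Hs HJ).
destruct J as [x y].
assert (E1 := f_equal fst E). assert (E2 := f_equal snd E). simpl in E1, E2. simpl.
assert (Hpi := PI_RGT_0).
assert (D : x * x - y * y = 2 * (x * y)).
{ apply Rmult_eq_reg_l with (sqrt alpha); [|lra]. lra. }
assert (P : 0 < 2 * (x * y)).
{ apply Rmult_lt_reg_l with (sqrt alpha) => //. nra. }
split => //. split => //.
apply Rsqr_inj.
- nra.
- apply Rmult_le_pos; [apply sqrt_pos|lra].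
- rewrite Rsqr_mult Rsqr_sqrt; [|lra]. unfold Rsqr.
  replace ((x * x + y * y) * (x * x + y * y)) with ((x * x - y * y) * (x * x - y * y) + (2 * (x * y)) * (2 * (x * y))) by ring.
  rewrite D. ring.
Qed.

Lemma squeeze_limit alpha : 0 < alpha ->
  is_Clim (fun t => Cmult (squeeze (alpha * t) (riccati_sol alpha t t)) (Cmult (osc alpha t) (osc alpha t))) (0, - / sqrt 2).
Proof.
intros Ha.
destruct (cgauss_lint (weber_coef alpha)) as [J HJ]. { by apply sqrt_lt_R0. }
destruct (weber_coef_gauss alpha J Ha HJ) as [P [D N]].
assert (LA := leading_part_lim alpha J Ha HJ).
assert (Ld : is_Clim (error_part alpha) (RtoC 0)).
{ apply (is_Clim_ext (fun t => Cmult (RtoC 1) (error_part alpha t))). { intros; ring. }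
  apply error_part_lim => // t. apply Cmod_1. }
assert (Led : is_Clim (fun t => Cmult (Cmult (osc alpha t) (osc alpha t)) (error_part alpha t)) (RtoC 0)).
{ apply error_part_lim => // t. rewrite Cmod_mult !Cmod_osc. ring. }
set (Pl := Cmult (RtoC (/ 2)) (Cplus (Cmult (1, 1) (RtoC 0)) (Cmult (1, 1) (Cplus (Cconj J) (Cmult Ci (Cconj (RtoC 0))))))).
set (Ql := Cmult (RtoC (/ 2)) (Cplus (RtoC 0) (Cmult Ci (Cplus (Cconj J) (Cmult Ci (Cconj (RtoC 0))))))).
assert (LB : is_Clim (fun t => Cplus (Cconj (leading_part alpha t)) (Cmult Ci (Cconj (error_part alpha t))))
   (Cplus (Cconj J) (Cmult Ci (Cconj (RtoC 0))))).
{ apply is_Clim_plus; [by apply is_Clim_conj|]. apply is_Clim_mult; [apply is_Clim_const|by apply is_Clim_conj]. }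
assert (LP : is_Clim (even_phase_scaled alpha) Pl).
{ apply is_Clim_mult; [apply is_Clim_const|]. apply is_Clim_plus; apply is_Clim_mult => //; apply is_Clim_const. }
assert (LQ : is_Clim (odd_phase_scaled alpha) Ql).
{ apply is_Clim_mult; [apply is_Clim_const|]. apply is_Clim_plus => //. apply is_Clim_mult => //; apply is_Clim_const. }
(* Here [Pl = (1 + i) conj J / 2] and [Ql = i conj J / 2]; the phase [3 PI / 4] of the constants and
   the phase [- PI / 4] of [conj J^2] add up to [PI / 2]. *)
assert (EQ : Cconj (Cmult Pl Ql) = (0, - (fst J * snd J))).
{ unfold Pl, Ql. destruct J as [x y]. simpl in D, P. apply injective_projections; simpl; field_simplify; lra. }
assert (HQ : Cconj (Cmult Pl Ql) <> RtoC 0).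
{ rewrite EQ. intros E. apply (f_equal snd) in E. simpl in E. lra. }
apply (is_Clim_ext_pos (fun t => Copp (Cmult (RtoC (fst (Cmult (Cconj (even_phase_scaled alpha t)) (odd_phase_scaled alpha t))))
   (Cinv (Cconj (Cmult (even_phase_scaled alpha t) (odd_phase_scaled alpha t))))))).
{ intros t Ht. by rewrite squeeze_scaled. }
replace (0, - / sqrt 2) with (Copp (Cmult (RtoC (fst (Cmult (Cconj Pl) Ql))) (Cinv (Cconj (Cmult Pl Ql))))).
- apply is_Clim_opp, is_Clim_mult.
  + apply (is_Clim_re (fun t => Cmult (Cconj (even_phase_scaled alpha t)) (odd_phase_scaled alpha t))). apply is_Clim_mult => //. by apply is_Clim_conj.
  + apply is_Clim_inv => //. apply is_Clim_conj. by apply is_Clim_mult.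
- rewrite EQ. replace (fst (Cmult (Cconj Pl) Ql)) with (/ 4 * (sqrt 2 * (2 * (fst J * snd J)))).
  + assert (Hs := sqrt_lt_R0 2 ltac:(lra)). assert (Hss := sqrt_sqrt 2 ltac:(lra)).
    destruct J as [x y]. simpl in P |- *. set (z := x * y) in *.
    apply injective_projections; simpl.
    * field. lra.
    * replace (/ sqrt 2) with (sqrt 2 / 2). { field. lra. }
      apply Rmult_eq_reg_l with (2 * sqrt 2); [|lra]. field_simplify; lra.
  + rewrite -N. unfold Pl, Ql. destruct J as [x y]. simpl. field.
Qed.

(** * Overlaps with the number states *)

Lemma aop_gwave w l g x : aop w (gwave l g) x =
  Cmult (Cmult (RtoC (/ sqrt (2 * w))) (Cmult (Cplus (RtoC w) (Cmult Ci g)) (RtoC x))) (gwave l g x).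
Proof. unfold aop. rewrite (is_Cder_Cderiv _ _ _ (gwave_der l g x)) RtoC_mult. ring. Qed.

Lemma astar_gwave w l g x : astar w (gwave l g) x =
  Cmult (Cmult (RtoC (/ sqrt (2 * w))) (Cmult (Cminus (RtoC w) (Cmult Ci g)) (RtoC x))) (gwave l g x).
Proof. unfold astar. rewrite (is_Cder_Cderiv _ _ _ (gwave_der l g x)) RtoC_mult. ring. Qed.

Lemma wminus_neq0 w g : 0 < w -> 0 < snd g -> Cminus (RtoC w) (Cmult Ci g) <> RtoC 0.
Proof. intros Hw Hg E. apply (f_equal fst) in E. simpl in E. lra. Qed.

Lemma squeeze_eq w g : 0 < w -> 0 < snd g ->
  Cmult (squeeze w g) (Cminus (RtoC w) (Cmult Ci g)) = Copp (Cplus (RtoC w) (Cmult Ci g)).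
Proof. intros Hw Hg. unfold squeeze. field. by apply wminus_neq0. Qed.

Lemma Cmod_squeeze w g : 0 < w -> 0 < snd g ->
  Cmod (squeeze w g) ^ 2 = 1 - 4 * w * snd g / Cmod (Cminus (RtoC w) (Cmult Ci g)) ^ 2.
Proof.
intros Hw Hg. assert (H := wminus_neq0 w g Hw Hg).
unfold squeeze. rewrite Cmod_opp Cmod_div //.
assert (Hp : 0 < Cmod (Cminus (RtoC w) (Cmult Ci g))) by by apply Cmod_gt_0.
apply Rmult_eq_reg_r with (Cmod (Cminus (RtoC w) (Cmult Ci g)) ^ 2); [|apply pow_nonzero; lra].
transitivity (Cmod (Cplus (RtoC w) (Cmult Ci g)) ^ 2). { field. lra. }
transitivity (Cmod (Cminus (RtoC w) (Cmult Ci g)) ^ 2 - 4 * w * snd g). 2:{ field. lra. }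
rewrite !Cmod_sqr. destruct g as [g b]. simpl. ring.
Qed.

Lemma Cmod_squeeze_lt1 w g : 0 < w -> 0 < snd g -> Cmod (squeeze w g) < 1.
Proof.
intros Hw Hg. assert (E := Cmod_squeeze w g Hw Hg). assert (H := wminus_neq0 w g Hw Hg).
apply Cmod_gt_0 in H.
assert (0 < 4 * w * snd g / Cmod (Cminus (RtoC w) (Cmult Ci g)) ^ 2).
{ apply Rdiv_lt_0_compat; [nra|by apply pow_lt]. }
pose proof (Cmod_ge_0 (squeeze w g)). nra.
Qed.

(** Both operators multiply the packet by a constant times [x], so the condition at the single point
    [x = 1] fixes the ratio. It holds for every admissible pair, as the asymptotic claim quantifies
    over all squeezing parameters. *)
Lemma squeezed_ratio w l g lam mu : 0 < w -> 0 < snd g -> Cmod mu < Cmod lam ->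
  (forall x, Cplus (Cmult lam (aop w (gwave l g) x)) (Cmult mu (astar w (gwave l g) x)) = RtoC 0) ->
  Cdiv mu lam = squeeze w g.
Proof.
intros Hw Hg Hlt H. specialize (H 1). rewrite aop_gwave astar_gwave in H.
assert (Hl : lam <> RtoC 0). { apply Cmod_gt_0. pose proof (Cmod_ge_0 mu). lra. }
assert (Hs := sqrt_lt_R0 (2 * w) ltac:(lra)).
assert (Hm := wminus_neq0 w g Hw Hg).
assert (Hr : RtoC (/ sqrt (2 * w)) <> RtoC 0).
{ intros E. apply (f_equal fst) in E. simpl in E. assert (0 < / sqrt (2 * w)) by by apply Rinv_0_lt_compat. lra. }
assert (E : Cmult (Cmult (RtoC (/ sqrt (2 * w))) (gwave l g 1))
   (Cplus (Cmult lam (Cplus (RtoC w) (Cmult Ci g))) (Cmult mu (Cminus (RtoC w) (Cmult Ci g)))) = RtoC 0).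
{ rewrite -H. ring. }
assert (E2 : Cplus (Cmult lam (Cplus (RtoC w) (Cmult Ci g))) (Cmult mu (Cminus (RtoC w) (Cmult Ci g))) = RtoC 0).
{ destruct (Ceq_dec (Cplus (Cmult lam (Cplus (RtoC w) (Cmult Ci g))) (Cmult mu (Cminus (RtoC w) (Cmult Ci g)))) (RtoC 0)) => //.
  exfalso. revert E. apply Cmult_neq_0 => //. apply Cmult_neq_0 => //. apply Cexp_neq0. }
unfold squeeze.
assert (E3 : mu = Cdiv (Cmult (Copp lam) (Cplus (RtoC w) (Cmult Ci g))) (Cminus (RtoC w) (Cmult Ci g))).
{ set (D := Cminus _ _) in *. transitivity (Cdiv (Cminus (Cplus (Cmult lam (Cplus (RtoC w) (Cmult Ci g))) (Cmult mu D))
     (Cmult lam (Cplus (RtoC w) (Cmult Ci g)))) D); [field => //|]. rewrite E2. field => //. }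
rewrite E3. field. split => //.
Qed.

Lemma real_gauss b : 0 < b -> is_lint (fun x => exp (- (b * x ^ 2))) (sqrt (PI / b)).
Proof.
intros Hb.
destruct (cgauss_lint (RtoC b) Hb) as [J HJ].
assert (E := cgauss_lint_square (RtoC b) J Hb HJ). destruct HJ as [J1 J2].
assert (Eg : forall x, cgauss (RtoC b) x = RtoC (exp (- (b * x ^ 2)))).
{ intros x. unfold cgauss, Cexp. simpl.
  replace (- b * 0 + - 0 * (x * (x * 1))) with 0 by ring. rewrite cos_0 sin_0.
  apply injective_projections; simpl; [|ring]. rewrite Rmult_1_r. f_equal. ring. }
assert (Z : snd J = 0).
{ apply (is_lint_inj _ _ _ J2). apply (is_lint_ext (fun _ => 0)); [|apply is_lint_0]. intros x. by rewrite Eg. }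
assert (K : is_lint (fun x => exp (- (b * x ^ 2))) (fst J)).
{ apply (is_lint_ext (fun x => fst (cgauss (RtoC b) x))) => // x. by rewrite Eg. }
replace (sqrt (PI / b)) with (fst J) => //.
assert (P : 0 <= fst J). { apply (is_lint_ge0 (fun x => exp (- (b * x ^ 2)))) => // x. left; apply exp_pos. }
apply (f_equal fst) in E. simpl in E. rewrite Z in E.
symmetry. apply sqrt_lem_1 => //.
- left. apply Rdiv_lt_0_compat => //. apply PI_RGT_0.
- apply Rmult_eq_reg_l with b; [|lra]. replace (b * (PI / b)) with PI by (field; lra). lra.
Qed.

Lemma gwave_norm l g : 0 < snd g -> fst l = / 4 * ln (snd g / PI) -> L2norm2 (gwave l g) = 1.
Proof.
intros Hg Hl. apply is_lint_unique.
assert (Hpi := PI_RGT_0). assert (H0 : 0 < snd g / PI) by by apply Rdiv_lt_0_compat.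
assert (E : exp (fst l) ^ 2 = sqrt (snd g / PI)).
{ rewrite exp_pow_INR Hl. replace (INR 2 * (/ 4 * ln (snd g / PI))) with (/ 2 * ln (snd g / PI)) by (simpl; field).
  rewrite -(Rpower_sqrt (snd g / PI)) //. }
apply (is_lint_ext (fun x => exp (fst l) ^ 2 * exp (- (snd g * x ^ 2)))).
{ intros x. rewrite Cmod_gwave. replace (- (snd g * x ^ 2)) with (- (snd g / 2 * x ^ 2) + - (snd g / 2 * x ^ 2)) by field.
  rewrite exp_plus. ring. }
replace 1 with (exp (fst l) ^ 2 * sqrt (PI / snd g)).
- apply is_lint_scal. by apply real_gauss.
- rewrite E -sqrt_mult_alt; [|lra]. replace (snd g / PI * (PI / snd g)) with 1 by (field; lra). apply sqrt_1.
Qed.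

(** The probabilists' Hermite polynomials at [k x]. With [k = sqrt (2 w)] their recurrence is
    exactly the action of [astar] on the vacuum Gaussian times a polynomial. *)
Fixpoint hermite_poly (k : R) (n : nat) (x : R) : R :=
  match n with
  | O => 1
  | S O => k * x
  | S (S m as p) => k * x * hermite_poly k p x - INR p * hermite_poly k m x
  end.

(** At [n = 0] the truncated [n - 1] is harmless because of the factor [INR n]; the same convention
    holds in the formulas below. *)
Lemma hermite_poly_S k n x : hermite_poly k (S n) x = k * x * hermite_poly k n x - INR n * hermite_poly k (n - 1) x.
Proof. destruct n as [|n]; [simpl; ring|]. replace (S n - 1)%nat with n by lia. reflexivity. Qed.

Lemma nat_ind2 (P : nat -> Prop) : P 0%nat -> P 1%nat -> (forall n, P n -> P (S n) -> P (S (S n))) -> forall n, P n.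
Proof. intros H0 H1 H n. assert (P n /\ P (S n)); [|tauto]. induction n; intuition. Qed.

Lemma hermite_poly_der k n x : is_derive (hermite_poly k n) x (k * (INR n * hermite_poly k (n - 1) x)).
Proof.
revert x. induction n as [| |n IH1 IH2] using nat_ind2; intros x.
- eapply is_derive_eq; [|apply: is_derive_const]. rewrite /zero /=. ring.
- simpl. auto_derive. easy. ring.
- apply (is_derive_fun_eq (fun x => (k * x) * hermite_poly k (S n) x - INR (S n) * hermite_poly k n x)).
  { intros y. by rewrite (hermite_poly_S k (S n)) /= Nat.sub_0_r. }
  assert (D : is_derive (fun x => k * x) x k) by (auto_derive; [easy|ring]).
  eapply is_derive_eq; [|apply Rderive_minus; apply Rderive_mult; [exact D|apply IH2|apply: is_derive_const|apply IH1]].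
  replace (S n - 1)%nat with n by lia. replace (S (S n) - 1)%nat with (S n) by lia.
  rewrite /zero !S_INR (hermite_poly_S k n x). simpl. ringR.
Qed.

Lemma hermite_poly_bound k n : 0 < k -> exists C, 0 <= C /\ forall x, Rabs (hermite_poly k n x) <= C * (1 + x ^ 2) ^ n.
Proof.
intros Hk. induction n as [| |n [C1 [H1 B1]] [C2 [H2 B2]]] using nat_ind2.
- exists 1. split; [lra|]. intros x. simpl. rewrite Rabs_R1. lra.
- exists k. split; [lra|]. intros x. simpl (hermite_poly k 1 x). rewrite Rabs_mult (Rabs_pos_eq k); [|lra].
  apply Rmult_le_compat_l; [lra|]. rewrite -(pow2_abs x). pose proof (pow2_ge_0 (Rabs x - 1)). pose proof (Rabs_pos x). simpl in *. nra.
- exists (k * C2 + INR (S n) * C1). assert (Hn := pos_INR (S n)). split; [nra|]. intros x.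
  rewrite (hermite_poly_S k (S n)). replace (S n - 1)%nat with n by lia.
  specialize (B1 x). specialize (B2 x).
  assert (Hx : 1 <= 1 + x ^ 2) by apply one_le_1px2.
  assert (Hax : Rabs x <= 1 + x ^ 2).
  { rewrite -(pow2_abs x). pose proof (pow2_ge_0 (Rabs x - 1)). pose proof (Rabs_pos x). nra. }
  eapply Rle_trans; [apply Rabs_triang|]. rewrite Rabs_Ropp !Rabs_mult (Rabs_pos_eq k); [|lra].
  rewrite (Rabs_pos_eq (INR (S n))) //.
  set (y := 1 + x ^ 2) in *.
  rewrite Rmult_plus_distr_r. apply Rplus_le_compat.
  + replace (k * C2 * y ^ S (S n)) with (k * y * (C2 * y ^ S n)) by (simpl; ring).
    apply Rmult_le_compat => //; try apply Rabs_pos.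
    * apply Rmult_le_pos; [lra|apply Rabs_pos].
    * apply Rmult_le_compat_l; lra.
  + rewrite Rmult_assoc. apply Rmult_le_compat_l => //. eapply Rle_trans; [apply B1|].
    apply Rmult_le_compat_l => //. apply Rle_pow => //. lia.
Qed.

Definition hermite_fun (w : R) (n : nat) (x : R) : R :=
  Rpower (w / PI) (/ 4) * (hermite_poly (sqrt (2 * w)) n x * exp (- (w * x ^ 2) / 2)).

Lemma hermite_fun_der w n x : is_derive (hermite_fun w n) x
  (sqrt (2 * w) * (INR n * hermite_fun w (n - 1) x) - w * x * hermite_fun w n x).
Proof.
assert (D : is_derive (fun x => exp (- (w * x ^ 2) / 2)) x (- (w * x) * exp (- (w * x ^ 2) / 2))).
{ apply (Rderive_exp (fun x => - (w * x ^ 2) / 2) x (- (w * x))). auto_derive. easy. field. }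
eapply is_derive_eq; [|apply Rderive_mult; [apply: is_derive_const|apply Rderive_mult; [apply hermite_poly_der|exact D]]].
rewrite /zero /hermite_fun. cbv beta. simpl. ringR.
Qed.

Lemma hermite_fun_S w n x : hermite_fun w (S n) x = sqrt (2 * w) * x * hermite_fun w n x - INR n * hermite_fun w (n - 1) x.
Proof. unfold hermite_fun. rewrite hermite_poly_S. ring. Qed.

Lemma astar_ext w f g x : (forall y, f y = g y) -> astar w f x = astar w g x.
Proof. intros H. unfold astar. by rewrite (Cderiv_ext f g x H) H. Qed.

Lemma astar_iter w n x : 0 < w -> Nat.iter n (astar w) (psi0 w) x = RtoC (hermite_fun w n x).
Proof.
intros Hw. revert x. induction n as [|n IH]; intros x.
- rewrite /= /psi0 /hermite_fun /hermite_poly. f_equal. ring.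
- change (Nat.iter (S n) (astar w) (psi0 w) x) with (astar w (Nat.iter n (astar w) (psi0 w)) x).
  rewrite (astar_ext w _ (fun x => RtoC (hermite_fun w n x)) x IH).
  unfold astar. rewrite (is_Cder_Cderiv _ _ _ (is_Cder_RtoC _ _ _ (hermite_fun_der w n x))) hermite_fun_S.
  assert (Hs := sqrt_lt_R0 (2 * w) ltac:(lra)). assert (Hss := sqrt_sqrt (2 * w) ltac:(lra)).
  rewrite -!RtoC_mult -RtoC_minus -RtoC_mult. f_equal.
  apply Rmult_eq_reg_l with (sqrt (2 * w)); [|lra]. rewrite -Rmult_assoc Rinv_r; [|lra].
  transitivity ((sqrt (2 * w) * sqrt (2 * w)) * x * hermite_fun w n x - sqrt (2 * w) * (INR n * hermite_fun w (n - 1) x)); [|ring].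
  rewrite Hss. ring.
Qed.

Lemma hermite_fun_gwave_bound w n l g : 0 < w -> exists C, 0 <= C /\
  forall x, Cmod (Cmult (RtoC (hermite_fun w n x)) (gwave l g x)) <= C * (1 + x ^ 2) ^ n * exp (- ((w / 2 + snd g / 2) * x ^ 2)).
Proof.
intros Hw. assert (Hs := sqrt_lt_R0 (2 * w) ltac:(lra)).
destruct (hermite_poly_bound (sqrt (2 * w)) n Hs) as [C [HC B]].
set (N := Rpower (w / PI) (/ 4)). assert (HN : 0 < N) by apply exp_pos.
assert (He := exp_pos (fst l)).
exists (N * C * exp (fst l)). split. { apply Rmult_le_pos; [|lra]. nra. }
intros x. rewrite Cmod_mult Cmod_gwave Cmod_R /hermite_fun !Rabs_mult -/N (Rabs_pos_eq N); [|lra].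
rewrite (Rabs_pos_eq (exp _)); [|left; apply exp_pos].
replace (- ((w / 2 + snd g / 2) * x ^ 2)) with (- (w * x ^ 2) / 2 + - (snd g / 2 * x ^ 2)) by field.
rewrite exp_plus.
set (e1 := exp (- (w * x ^ 2) / 2)). set (e2 := exp (- (snd g / 2 * x ^ 2))).
assert (0 < e1) by apply exp_pos. assert (0 < e2) by apply exp_pos.
replace (N * C * exp (fst l) * (1 + x ^ 2) ^ n * (e1 * e2)) with ((N * e1 * exp (fst l) * e2) * (C * (1 + x ^ 2) ^ n)) by ring.
replace (N * (Rabs (hermite_poly (sqrt (2 * w)) n x) * e1) * (exp (fst l) * e2)) with
  ((N * e1 * exp (fst l) * e2) * Rabs (hermite_poly (sqrt (2 * w)) n x)) by ring.
apply Rmult_le_compat_l; [|apply B]. left. repeat apply Rmult_lt_0_compat => //.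
Qed.

Lemma hermite_fun_gwave_der w n l g x : is_Cder (fun x => Cmult (RtoC (hermite_fun w n x)) (gwave l g x)) x
  (Cmult (Cplus (RtoC (sqrt (2 * w) * (INR n * hermite_fun w (n - 1) x) - w * x * hermite_fun w n x))
     (Cmult (Cmult (Cmult Ci g) (RtoC x)) (RtoC (hermite_fun w n x)))) (gwave l g x)).
Proof.
eapply is_Cder_eq; [|apply is_Cder_mult; [apply is_Cder_RtoC, hermite_fun_der|apply gwave_der]]. cbv beta. ring.
Qed.

Lemma hermite_fun_cont w n : cont (hermite_fun w n).
Proof. apply cont_derive => x. eexists. apply hermite_fun_der. Qed.

Lemma hermite_fun_gwave_der_cont w n l g : Ccont (fun x =>
  Cmult (Cplus (RtoC (sqrt (2 * w) * (INR n * hermite_fun w (n - 1) x) - w * x * hermite_fun w n x))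
     (Cmult (Cmult (Cmult Ci g) (RtoC x)) (RtoC (hermite_fun w n x)))) (gwave l g x)).
Proof.
apply Ccont_mult; [|apply gwave_Ccont].
assert (c1 := hermite_fun_cont w n). assert (c2 := hermite_fun_cont w (n - 1)).
apply Ccont_plus; [apply Ccont_RtoC; cont_auto|].
apply Ccont_mult; [apply Ccont_mult; [apply Ccont_const|apply Ccont_RtoC; cont_auto]|apply Ccont_RtoC; cont_auto].
Qed.

Definition overlap (w : R) (l g : C) (n : nat) : C :=
  (Rline_int (fun x => fst (Cmult (RtoC (hermite_fun w n x)) (gwave l g x))),
   Rline_int (fun x => snd (Cmult (RtoC (hermite_fun w n x)) (gwave l g x)))).

Lemma overlap_lint w l g n : 0 < w -> 0 < snd g ->
  is_Clint (fun x => Cmult (RtoC (hermite_fun w n x)) (gwave l g x)) (overlap w l g n).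
Proof.
intros Hw Hg. destruct (hermite_fun_gwave_bound w n l g Hw) as [C [HC B]].
destruct (ex_Clint_gauss _ C n (w / 2 + snd g / 2)
  (is_Cder_Ccont _ _ (hermite_fun_gwave_der w n l g)) ltac:(lra) B) as [z [H1 H2]].
split; apply ex_lint_correct; [by exists (fst z)|by exists (snd z)].
Qed.

(* With [m] the squeezing ratio, [f_{n+1} + m n f_{n-1}] times the wave packet is a total derivative, because
   the packet is annihilated by [a + m a^*]. *)
Lemma overlap_rec w l g n : 0 < w -> 0 < snd g ->
  overlap w l g (S n) = Copp (Cmult (Cmult (squeeze w g) (RtoC (INR n))) (overlap w l g (n - 1))).
Proof.
intros Hw Hg. assert (Hs := sqrt_lt_R0 (2 * w) ltac:(lra)). assert (Hss := sqrt_sqrt (2 * w) ltac:(lra)).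
set (m := squeeze w g). set (k := sqrt (2 * w)) in *.
assert (Hm : Cmult m (Cminus (RtoC w) (Cmult Ci g)) = Copp (Cplus (RtoC w) (Cmult Ci g))) by by apply squeeze_eq.
assert (Hk0 : RtoC k <> RtoC 0). { intros E. apply (f_equal fst) in E. simpl in E. lra. }
assert (Hkk : Cmult (RtoC k) (RtoC k) = Cmult (RtoC 2) (RtoC w)). { by rewrite -!RtoC_mult Hss. }
assert (Z : Cplus (overlap w l g (S n)) (Cmult (Cmult m (RtoC (INR n))) (overlap w l g (n - 1))) = RtoC 0).
{ eapply is_Clint_inj.
  - apply is_Clint_plus; [by apply overlap_lint|apply is_Clint_scal; by apply overlap_lint].
  - destruct (hermite_fun_gwave_bound w n l g Hw) as [C [HC B]].
    assert (I := is_Clint_derive_gauss _ _ C n (w / 2 + snd g / 2) (hermite_fun_gwave_der w n l g) (hermite_fun_gwave_der_cont w n l g) ltac:(lra) B).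
    (* The derivative of [f_n] times the packet carries [- (w - i g) x f_n]. As
       [(1 - m) (w - i g) = 2 w = k^2], this factor turns the coefficient of [x f_n] into [k], the
       one in the recurrence for [f_{n+1}]. *)
    apply (is_Clint_scal (Cdiv (Cminus m (RtoC 1)) (RtoC k))) in I. rewrite Cmult_0_r in I.
    revert I. apply is_Clint_ext. intros x. cbv beta.
    rewrite (hermite_fun_S w n x) -/k.
    rewrite (RtoC_minus (k * x * hermite_fun w n x)) (RtoC_mult (k * x)) (RtoC_mult k x) (RtoC_mult (INR n)).
    rewrite (RtoC_minus (k * (INR n * hermite_fun w (n - 1) x))) (RtoC_mult k (INR n * _)) (RtoC_mult (INR n)) (RtoC_mult (w * x)) (RtoC_mult w x).
    set (hn := RtoC (hermite_fun w n x)). set (hm := RtoC (hermite_fun w (n - 1) x)). set (N := RtoC (INR n)). set (X := RtoC x).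
    set (G := gwave l g x).
    transitivity (Cmult (Cplus (Cmult (Cminus m (RtoC 1)) (Cmult N hm))
       (Cmult (Cdiv (Cminus (Cminus (RtoC w) (Cmult Ci g)) (Cmult m (Cminus (RtoC w) (Cmult Ci g)))) (RtoC k)) (Cmult X hn))) G).
    + field. exact Hk0.
    + rewrite Hm.
      transitivity (Cmult (Cplus (Cmult (Cminus m (RtoC 1)) (Cmult N hm))
         (Cmult (Cdiv (Cmult (RtoC 2) (RtoC w)) (RtoC k)) (Cmult X hn))) G).
      * replace (RtoC 2) with (Cplus (RtoC 1) (RtoC 1)) by (rewrite -RtoC_plus; f_equal; ring). field. exact Hk0.
      * rewrite -Hkk. field. exact Hk0. }
transitivity (Cminus (Cplus (overlap w l g (S n)) (Cmult (Cmult m (RtoC (INR n))) (overlap w l g (n - 1))))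
  (Cmult (Cmult m (RtoC (INR n))) (overlap w l g (n - 1)))); [ring|]. rewrite Z. ring.
Qed.

Lemma inner_psi_n w l g n : 0 < w -> 0 < snd g ->
  Cmod (inner (psi_n w n) (gwave l g)) ^ 2 = Cmod (overlap w l g n) ^ 2 / INR (fact n).
Proof.
intros Hw Hg.
assert (E : inner (psi_n w n) (gwave l g) = Cmult (RtoC (/ sqrt (INR (fact n)))) (overlap w l g n)).
{ assert (O := is_Clint_scal (RtoC (/ sqrt (INR (fact n)))) _ _ (overlap_lint w l g n Hw Hg)).
  apply (is_Clint_ext _ (fun x => Cmult (Cconj (psi_n w n x)) (gwave l g x))) in O.
  - destruct O as [O1 O2]. apply injective_projections.
    + exact (is_lint_unique _ _ O1).
    + exact (is_lint_unique _ _ O2).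
  - intros x. unfold psi_n. rewrite astar_iter // -RtoC_mult.
    replace (Cconj (RtoC (/ sqrt (INR (fact n)) * hermite_fun w n x))) with (RtoC (/ sqrt (INR (fact n)) * hermite_fun w n x)).
    + rewrite RtoC_mult. ring.
    + apply injective_projections; simpl; ring. }
assert (F := INR_fact_lt_0 n). assert (Fs := sqrt_lt_R0 _ F).
rewrite E Cmod_mult Cmod_R Rabs_pos_eq; [|left; by apply Rinv_0_lt_compat].
rewrite Rpow_mult_distr pow_inv pow2_sqrt; [|lra]. unfold Rdiv. ring.
Qed.

Lemma overlap_odd w l g k : 0 < w -> 0 < snd g -> overlap w l g (2 * k + 1) = RtoC 0.
Proof.
intros Hw Hg. induction k as [|k IH].
- simpl. rewrite overlap_rec //. simpl. ring.
- replace (2 * S k + 1)%nat with (S (S (2 * k + 1))) by lia. rewrite overlap_rec //.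
  replace (S (2 * k + 1) - 1)%nat with (2 * k + 1)%nat by lia. rewrite IH. ring.
Qed.

Lemma dfact_SS n : dfact (S (S n)) = (S (S n) * dfact n)%nat.
Proof. reflexivity. Qed.

Lemma dfact_pos n : (0 < dfact n)%nat.
Proof. induction n as [| |n IH1 IH2] using nat_ind2; [simpl; lia|simpl; lia|rewrite dfact_SS; lia]. Qed.

(** One step of the recurrence gives [|m|^2 (2k+1)^2], and the factorial divides by [(2k+1) (2k+2)];
    the quotient [(2k+1) / (2k+2)] is the growth of the ratio of double factorials. *)
Lemma overlap_even w l g k : 0 < w -> 0 < snd g ->
  Cmod (overlap w l g (2 * k)) ^ 2 / INR (fact (2 * k)) =
  (Cmod (squeeze w g) ^ 2) ^ k * (INR (dfact (2 * k - 1)) / INR (dfact (2 * k))) * Cmod (overlap w l g 0) ^ 2.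
Proof.
intros Hw Hg. induction k as [|k IH].
- simpl. field.
- replace (2 * S k)%nat with (S (S (2 * k))) by lia. rewrite overlap_rec //.
  replace (S (2 * k) - 1)%nat with (2 * k)%nat by lia.
  rewrite Cmod_opp !Cmod_mult Cmod_R Rabs_pos_eq; [|apply pos_INR].
  assert (F := INR_fact_lt_0 (2 * k)). assert (D := lt_0_INR _ (dfact_pos (2 * k))).
  assert (N := pos_INR (2 * k)).
  assert (E1 : INR (fact (S (S (2 * k)))) = (INR (2 * k) + 1 + 1) * ((INR (2 * k) + 1) * INR (fact (2 * k)))).
  { clear. generalize (2 * k)%nat. intros n. rewrite !fact_simpl !mult_INR !S_INR. ring. }
  assert (E2 : INR (dfact (S (S (2 * k)))) = (INR (2 * k) + 1 + 1) * INR (dfact (2 * k))).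
  { clear. generalize (2 * k)%nat. intros n. rewrite dfact_SS mult_INR !S_INR. ring. }
  assert (E3 : INR (dfact (S (S (2 * k)) - 1)) = (INR (2 * k) + 1) * INR (dfact (2 * k - 1))).
  (* For [k = 0] the truncated [2 * 0 - 1] is 0, where [dfact] takes the conventional value 1. *)
  { destruct k as [|k]; [simpl; ring|].
    replace (S (S (2 * S k)) - 1)%nat with (S (S (2 * S k - 1))) by lia. rewrite dfact_SS mult_INR.
    replace (S (S (2 * S k - 1))) with (S (2 * S k)) by lia. rewrite S_INR. ring. }
  rewrite E1 E2 E3 S_INR.
  transitivity (Cmod (squeeze w g) ^ 2 * ((INR (2 * k) + 1) / (INR (2 * k) + 1 + 1)) *
     (Cmod (overlap w l g (2 * k)) ^ 2 / INR (fact (2 * k)))).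
  + field. lra.
  + rewrite IH. simpl pow. field. lra.
Qed.

(** The overlap is a Gaussian integral with [z = (w - i g) / 2]. Fourth powers clear all roots:
    [|overlap|^4 = 4 w Im g / |w - i g|^2], which is [1 - |m|^2]. *)
Lemma overlap_0 w l g : 0 < w -> 0 < snd g -> fst l = / 4 * ln (snd g / PI) ->
  Cmod (overlap w l g 0) ^ 2 = sqrt (1 - Cmod (squeeze w g) ^ 2).
Proof.
intros Hw Hg Hl. assert (Hpi := PI_RGT_0).
set (z := Cmult (RtoC (/ 2)) (Cminus (RtoC w) (Cmult Ci g))).
assert (Hz : 0 < fst z). { simpl. lra. }
destruct (cgauss_lint z Hz) as [J HJ].
assert (EJ := cgauss_lint_square z J Hz HJ).
set (N := Rpower (w / PI) (/ 4)).
assert (EO : overlap w l g 0 = Cmult (Cmult (RtoC N) (Cexp l)) J).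
{ apply (is_Clint_inj _ _ _ (overlap_lint w l g 0 Hw Hg)).
  apply (is_Clint_ext (fun x => Cmult (Cmult (RtoC N) (Cexp l)) (cgauss z x))); [|by apply is_Clint_scal].
  intros x. unfold hermite_fun, gwave, cgauss. rewrite Cexp_plus /hermite_poly Rmult_1_l -/N RtoC_mult.
  transitivity (Cmult (Cmult (RtoC N) (Cexp l)) (Cmult (RtoC (exp (- (w * x ^ 2) / 2))) (Cexp (Cmult (Cmult Ci g) (RtoC (x ^ 2 / 2)))))); [|ring].
  f_equal. replace (RtoC (exp (- (w * x ^ 2) / 2))) with (Cexp (RtoC (- (w * x ^ 2) / 2))).
  - rewrite -Cexp_plus. f_equal. unfold z. destruct g as [g1 g2]. apply injective_projections; simpl; field.
  - unfold Cexp. simpl. rewrite cos_0 sin_0. apply injective_projections; simpl; ring. }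
assert (HN : 0 < N) by apply exp_pos.
assert (N4 : N ^ 4 = w / PI).
{ unfold N, Rpower. rewrite exp_pow_INR. replace (INR 4 * (/ 4 * ln (w / PI))) with (ln (w / PI)) by (simpl; field).
  rewrite exp_ln //. by apply Rdiv_lt_0_compat. }
assert (L4 : exp (fst l) ^ 4 = snd g / PI).
{ rewrite exp_pow_INR Hl. replace (INR 4 * (/ 4 * ln (snd g / PI))) with (ln (snd g / PI)) by (simpl; field).
  rewrite exp_ln //. by apply Rdiv_lt_0_compat. }
assert (J4 : Cmod z * Cmod J ^ 2 = PI).
{ apply (f_equal Cmod) in EJ. rewrite (Cmod_mult z) (Cmod_mult J) (Cmod_R PI) (Rabs_pos_eq PI) in EJ; [|lra]. rewrite -EJ. ring. }
assert (Cz : Cmod z = / 2 * Cmod (Cminus (RtoC w) (Cmult Ci g))).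
{ unfold z. rewrite Cmod_mult Cmod_R Rabs_pos_eq; lra. }
assert (Hd : 0 < Cmod (Cminus (RtoC w) (Cmult Ci g))) by (apply Cmod_gt_0; by apply wminus_neq0).
rewrite Cmod_squeeze //. set (d := Cmod (Cminus (RtoC w) (Cmult Ci g))) in *.
symmetry. apply sqrt_lem_1.
- replace (1 - (1 - 4 * w * snd g / d ^ 2)) with (4 * w * snd g / d ^ 2) by ring.
  left. apply Rdiv_lt_0_compat; [nra|by apply pow_lt].
- apply pow2_ge_0.
- rewrite EO !Cmod_mult Cmod_Cexp Cmod_R Rabs_pos_eq; [|lra].
  transitivity (N ^ 4 * exp (fst l) ^ 4 * (Cmod J ^ 2) ^ 2); [ring|].
  rewrite N4 L4. replace (Cmod J ^ 2) with (2 * PI / d).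
  + field. lra.
  + apply Rmult_eq_reg_l with (Cmod z); [|rewrite Cz; lra]. rewrite J4 Cz. field. lra.
Qed.

(** * The limits *)

Lemma polar z : exists th, 0 <= th < 2 * PI /\ z = Cmult (cexp th) (RtoC (Cmod z)).
Proof.
assert (Hpi := PI_RGT_0).
destruct (Ceq_dec z (RtoC 0)) as [->|Hz].
{ exists 0. split; [lra|]. rewrite Cmod_0. ring. }
assert (Hp : 0 < Cmod z) by by apply Cmod_gt_0.
set (a := fst z / Cmod z). set (b := snd z / Cmod z).
assert (E : a ^ 2 + b ^ 2 = 1).
{ unfold a, b. replace ((fst z / Cmod z) ^ 2 + (snd z / Cmod z) ^ 2) with ((fst z ^ 2 + snd z ^ 2) / Cmod z ^ 2) by (field; lra).
  rewrite -Cmod_sqr. field. lra. }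
assert (Ha : -1 <= a <= 1) by nra.
assert (Ez : z = Cmult (a, b) (RtoC (Cmod z))).
{ unfold a, b. destruct z as [x y]. apply injective_projections; simpl fst; simpl snd; simpl; field; simpl in Hp; lra. }
assert (Hs : sin (acos a) = sqrt (1 - a ^ 2)). { rewrite sin_acos //. f_equal. unfold Rsqr. ring. }
assert (Hb := acos_bound a).
destruct (Rle_or_lt 0 b) as [Hb0|Hb0].
- exists (acos a). split; [lra|]. rewrite {1}Ez. f_equal. unfold cexp. rewrite cos_acos // Hs. f_equal.
  symmetry. apply sqrt_lem_1; nra.
- exists (2 * PI - acos a). split.
  + split; [lra|]. assert (acos a <> 0); [|lra]. intros E0. assert (cos (acos a) = 1) by (rewrite E0; apply cos_0).
    rewrite cos_acos // in H. nra.
  + rewrite {1}Ez. f_equal. unfold cexp.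
    replace (2 * PI - acos a) with (- acos a + 2 * INR 1 * PI) by (simpl; ring).
    rewrite cos_period sin_period cos_neg sin_neg cos_acos // Hs. f_equal.
    assert (sqrt (1 - a ^ 2) = - b); [|lra]. apply sqrt_lem_1; nra.
Qed.

Lemma tanh_surj x : 0 <= x < 1 -> exists r, 0 <= r /\ tanh r = x.
Proof.
(* The witness [ln y / 2] is the inverse hyperbolic tangent of [x]. *)
intros Hx. set (y := (1 + x) / (1 - x)).
assert (Hy : 1 <= y). { unfold y. apply Rmult_le_reg_r with (1 - x); [lra|]. unfold Rdiv. rewrite Rmult_assoc Rinv_l; lra. }
exists (/ 2 * ln y). split.
- assert (0 <= ln y); [|lra]. rewrite -ln_1. destruct Hy as [Hy|Hy]; [left; apply ln_increasing; lra|rewrite -Hy; lra].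
- set (E := exp (/ 2 * ln y)).
  assert (HE : 0 < E) by apply exp_pos.
  assert (E2 : E * E = y). { unfold E. rewrite -exp_plus. replace (/ 2 * ln y + / 2 * ln y) with (ln y) by field. apply exp_ln. lra. }
  unfold tanh, sinh, cosh. rewrite exp_Ropp -/E.
  transitivity ((E * E - 1) / (E * E + 1)).
  + field. repeat split; nra.
  + rewrite E2. unfold y. field. split; lra.
Qed.

Lemma tanh_ge0 r : 0 <= r -> 0 <= tanh r.
Proof.
intros Hr. unfold tanh. apply Rdiv_le_0_compat.
- unfold sinh. assert (exp (- r) <= exp r) by (apply exp_mono; lra). lra.
- unfold cosh. pose proof (exp_pos r). pose proof (exp_pos (- r)). lra.
Qed.

Lemma cexp_plus a b : cexp (a + b) = Cmult (cexp a) (cexp b).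
Proof. unfold cexp, Cmult. simpl. rewrite cos_plus sin_plus. f_equal; ring. Qed.

Lemma Cmod_cexp a : Cmod (cexp a) = 1.
Proof.
assert (H : Cmod (cexp a) ^ 2 = 1). { rewrite Cmod_sqr. simpl. pose proof (sin2_cos2 a) as E. unfold Rsqr in E. lra. }
pose proof (Cmod_ge_0 (cexp a)). nra.
Qed.

Lemma osc_square alpha t : Cmult (osc alpha t) (osc alpha t) = cexp (alpha * t ^ 2).
Proof.
unfold osc. rewrite -Cexp_plus. unfold Cexp, cexp.
replace (Cplus _ _) with (0, alpha * t ^ 2). 2:{ apply injective_projections; simpl; field. }
simpl fst; simpl snd. rewrite exp_0 !Rmult_1_l //.
Qed.

Lemma cexp_opp_pi2 : cexp (- (PI / 2)) = Copp Ci.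
Proof. unfold cexp. rewrite cos_neg sin_neg cos_PI2 sin_PI2. apply injective_projections; simpl; ring. Qed.

Lemma is_lim_Cmod2 f l : is_Clim f l -> is_lim (fun t => Cmod (f t) ^ 2) p_infty (Finite (Cmod l ^ 2)).
Proof.
intros [H1 H2].
apply (is_lim_ext (fun t => fst (f t) * fst (f t) + snd (f t) * snd (f t))).
{ intros t. rewrite Cmod_sqr. ring. }
replace (Cmod l ^ 2) with (fst l * fst l + snd l * snd l) by (rewrite Cmod_sqr; ring).
apply is_lim_Rplus; by apply is_lim_Rmult.
Qed.

Lemma is_lim_sqrt f l : 0 <= l -> is_lim f p_infty (Finite l) -> is_lim (fun t => sqrt (f t)) p_infty (Finite (sqrt l)).
Proof.
intros Hl H. apply (is_lim_comp_continuous f sqrt p_infty l) => //.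
by apply continuity_pt_filterlim, continuity_pt_sqrt.
Qed.

Lemma is_lim_pow f l n : is_lim f p_infty (Finite l) -> is_lim (fun t => f t ^ n) p_infty (Finite (l ^ n)).
Proof.
intros H. induction n as [|n IH]; simpl; [apply is_lim_const|by apply is_lim_Rmult].
Qed.

Lemma is_lim_ext_pos f g l : (forall t, 0 < t -> f t = g t) -> is_lim f p_infty l -> is_lim g p_infty l.
Proof. intros H. apply is_lim_ext_loc. exists 0. exact H. Qed.

Lemma inv_sqrt2_square : / sqrt 2 * / sqrt 2 = / 2.
Proof. rewrite -Rinv_mult sqrt_sqrt //. lra. Qed.

(** The rotating angle itself has no limit, so only the distance [D] between the two unit vectors is
    estimated. The hypothesis gives [tanh r * D] tending to 0; instead of dividing by [tanh r], the
    bound [D <= 2] replaces [tanh r] by its limit. *)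
Lemma squeezed_angle_limit alpha (m : R -> C) (r th : R -> R) :
  is_Clim (fun t => Cmult (m t) (cexp (alpha * t ^ 2))) (0, - / sqrt 2) ->
  (forall t, 0 < t -> 0 <= r t /\ m t = Cmult (cexp (th t)) (RtoC (tanh (r t)))) ->
  is_lim (fun t => Cmod (Cminus (cexp (th t)) (cexp (- (alpha * t ^ 2 + PI / 2))))) p_infty 0 /\
  is_lim (fun t => tanh (r t)) p_infty (/ sqrt 2).
Proof.
intros L H.
set (z := fun t => Cmult (m t) (cexp (alpha * t ^ 2))) in *.
assert (Hs : 0 < / sqrt 2) by (apply Rinv_0_lt_compat, sqrt_lt_R0; lra).
assert (T : is_lim (fun t => tanh (r t)) p_infty (/ sqrt 2)).
{ apply (is_lim_ext_pos (fun t => sqrt (Cmod (z t) ^ 2))).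
  - intros t Ht. destruct (H t Ht) as [Hr E]. unfold z. rewrite E !Cmod_mult !Cmod_cexp Cmod_R.
    assert (P := tanh_ge0 _ Hr). rewrite (Rabs_pos_eq _ P) Rmult_1_l Rmult_1_r. by apply sqrt_pow2.
  - replace (/ sqrt 2) with (sqrt (Cmod (0, - / sqrt 2) ^ 2)).
    + apply is_lim_sqrt; [apply pow2_ge_0|]. by apply is_lim_Cmod2.
    + rewrite Cmod_sqr. simpl fst; simpl snd. replace (0 ^ 2 + (- / sqrt 2) ^ 2) with ((/ sqrt 2) ^ 2) by ring.
      apply sqrt_pow2. lra. }
split => //.
set (D := fun t => Cmod (Cminus (cexp (th t)) (cexp (- (alpha * t ^ 2 + PI / 2))))).
assert (D2 : forall t, 0 <= D t <= 2).
{ intros t. split; [apply Cmod_ge_0|]. unfold D, Cminus. eapply Rle_trans; [apply Cmod_triangle|].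
  rewrite Cmod_opp !Cmod_cexp. lra. }
assert (TD : is_lim (fun t => tanh (r t) * D t) p_infty 0).
{ assert (Lz : is_Clim (fun t => Cplus (z t) (Cmult (RtoC (tanh (r t))) Ci)) (RtoC 0)).
  { replace (RtoC 0) with (Cplus (0, - / sqrt 2) (Cmult (RtoC (/ sqrt 2)) Ci)).
    - apply is_Clim_plus => //. apply is_Clim_mult; [|apply is_Clim_const]. split; simpl => //. apply is_lim_const.
    - apply injective_projections; simpl; ring. }
  apply is_lim_Cmod2 in Lz. apply is_lim_sqrt in Lz; [|apply pow2_ge_0].
  rewrite Cmod_0 in Lz. replace (0 ^ 2) with 0 in Lz by ring. rewrite sqrt_0 in Lz.
  revert Lz. apply is_lim_ext_pos. intros t Ht. destruct (H t Ht) as [Hr E].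
  rewrite sqrt_pow2; [|apply Cmod_ge_0]. unfold z, D. rewrite E.
  assert (P := tanh_ge0 _ Hr).
  transitivity (Cmod (Cmult (Cmult (RtoC (tanh (r t))) (Cminus (cexp (th t)) (cexp (- (alpha * t ^ 2 + PI / 2))))) (cexp (alpha * t ^ 2)))).
  - f_equal.
    transitivity (Cminus (Cmult (RtoC (tanh (r t))) (Cmult (cexp (th t)) (cexp (alpha * t ^ 2))))
       (Cmult (RtoC (tanh (r t))) (Cmult (cexp (- (alpha * t ^ 2 + PI / 2))) (cexp (alpha * t ^ 2))))); [|ring].
    rewrite -!cexp_plus. replace (- (alpha * t ^ 2 + PI / 2) + alpha * t ^ 2) with (- (PI / 2)) by ring.
    rewrite cexp_opp_pi2 cexp_plus. ring.
  - rewrite !Cmod_mult Cmod_cexp Cmod_R (Rabs_pos_eq _ P). ring. }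
assert (T2 : is_lim (fun t => (/ sqrt 2 - tanh (r t)) * D t) p_infty 0).
{ apply (is_lim_Rabs_le _ (fun t => Rabs (/ sqrt 2 - tanh (r t)) * 2)).
  - intros t. rewrite Rabs_mult. apply Rmult_le_compat_l; [apply Rabs_pos|]. rewrite Rabs_pos_eq; apply D2.
  - replace 0 with (Rabs (/ sqrt 2 - / sqrt 2) * 2) by (rewrite Rminus_eq_0 Rabs_R0; ring).
    apply is_lim_Rmult; [|apply is_lim_const].
    apply (is_lim_comp_continuous (fun t => / sqrt 2 - tanh (r t)) Rabs p_infty (/ sqrt 2 - / sqrt 2));
      [|apply continuous_Rabs].
    apply is_lim_Rminus => //. apply is_lim_const. }
apply (is_lim_ext (fun t => sqrt 2 * (tanh (r t) * D t + (/ sqrt 2 - tanh (r t)) * D t))).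
{ intros t. change (sqrt 2 * (tanh (r t) * D t + (/ sqrt 2 - tanh (r t)) * D t) = D t). field.
  assert (0 < sqrt 2) by (apply sqrt_lt_R0; lra). lra. }
replace 0 with (sqrt 2 * (0 + 0)) by ring. apply is_lim_Rmult; [apply is_lim_const|by apply is_lim_Rplus].
Qed.

Theorem theorem1 (alpha : R) (Halpha : 0 < alpha) :
  (forall t, 0 < t -> exists Psi : R -> R -> C, solves alpha t Psi) /\
  (forall Psi : R -> R -> R -> C,
     (forall t, 0 < t -> solves alpha t (Psi t)) ->
     (forall t, 0 < t -> exists r th, is_squeezed (alpha * t) (Psi t t) r th) /\
     (forall r th : R -> R,
        (forall t, 0 < t -> is_squeezed (alpha * t) (Psi t t) (r t) (th t)) ->
        is_lim (fun t => Cmod (Cminus (cexp (th t)) (cexp (- (alpha * t ^ 2 + PI / 2)))))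
               p_infty 0 /\
        is_lim (fun t => tanh (r t)) p_infty (/ sqrt 2)) /\
     (forall k : nat,
        is_lim (fun t => Cmod (inner (psi_n (alpha * t) (2 * k)) (Psi t t)) ^ 2) p_infty
               (/ (2 ^ k * sqrt 2) * (INR (dfact (2 * k - 1)) / INR (dfact (2 * k)))) /\
        (forall t, 0 < t ->
           Cmod (inner (psi_n (alpha * t) (2 * k + 1)) (Psi t t)) ^ 2 = 0))).
Proof.
assert (S : forall t, 0 < t -> solves alpha t (wave (riccati_sol alpha t) (- t))).
{ intros t Ht. apply wave_solves => //; [by apply riccati_sol_riccati|by apply riccati_sol_start]. }
split. { intros t Ht. eexists. by apply S. }
intros Psi HPsi.
set (g := fun t => riccati_sol alpha t t). set (l := fun t => log_amplitude (riccati_sol alpha t) (- t) t).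
assert (Hg : forall t, 0 < t -> 0 < snd (g t)).
{ intros t Ht. exact (proj2 (riccati_sol_riccati alpha t Halpha Ht t)). }
assert (Hw : forall t, 0 < t -> 0 < alpha * t) by (intros; by apply Rmult_lt_0_compat).
assert (E : forall t, 0 < t -> Psi t t = gwave (l t) (g t)).
(* Uniqueness makes the claims about an arbitrary solution claims about the Gaussian packet; the
   operators take whole functions, hence extensionality. *)
{ intros t Ht. apply functional_extensionality => x. exact (solves_unique alpha t _ _ Ht (HPsi t Ht) (S t Ht) x). }
assert (L : is_Clim (fun t => Cmult (squeeze (alpha * t) (g t)) (cexp (alpha * t ^ 2))) (0, - / sqrt 2)).
{ apply (is_Clim_ext (fun t => Cmult (squeeze (alpha * t) (g t)) (Cmult (osc alpha t) (osc alpha t)))).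
  - intros t. by rewrite osc_square.
  - by apply squeeze_limit. }
split; [|split].
- intros t Ht. rewrite (E t Ht). set (m := squeeze (alpha * t) (g t)).
  assert (Hm : Cmod m < 1) by (apply Cmod_squeeze_lt1; auto).
  destruct (tanh_surj (Cmod m)) as [r [Hr Er]]. { split => //. apply Cmod_ge_0. }
  destruct (polar m) as [th [Hth Eth]].
  exists r, th. split. { apply gwave_norm; auto. }
  exists (RtoC 1), m. rewrite Cmod_1. split => //. split; [|split; [|split]] => //.
  + intros x. rewrite aop_gwave astar_gwave.
    transitivity (Cmult (Cmult (RtoC (/ sqrt (2 * (alpha * t)))) (Cmult (RtoC x) (gwave (l t) (g t) x)))
      (Cplus (Cplus (RtoC (alpha * t)) (Cmult Ci (g t))) (Cmult m (Cminus (RtoC (alpha * t)) (Cmult Ci (g t)))))); [ring|].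
    rewrite squeeze_eq; auto. ring.
  + rewrite Er -Eth. field.
- intros r th H. apply (squeezed_angle_limit alpha (fun t => squeeze (alpha * t) (g t))) => //.
  intros t Ht. destruct (H t Ht) as [_ [lam [mu [Hlt [Hx [Hr [_ Em]]]]]]]. split => //.
  rewrite (E t Ht) in Hx. rewrite -Em. symmetry. apply (squeezed_ratio _ (l t)); auto.
- intros k. split.
  + set (d := INR (dfact (2 * k - 1)) / INR (dfact (2 * k))).
    (* The probability depends on the ratio only through its squared modulus, which tends to [1/2]:
       hence [(1/2)^k] from the recurrence and [1 / sqrt 2] from the vacuum overlap. *)
    apply (is_lim_ext_pos (fun t => (Cmod (squeeze (alpha * t) (g t)) ^ 2) ^ k * d * sqrt (1 - Cmod (squeeze (alpha * t) (g t)) ^ 2))).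
    { intros t Ht. rewrite (E t Ht) inner_psi_n; auto. rewrite overlap_even; auto. rewrite overlap_0; auto. }
    assert (M : is_lim (fun t => Cmod (squeeze (alpha * t) (g t)) ^ 2) p_infty (/ 2)).
    { apply is_lim_Cmod2 in L. rewrite Cmod_sqr in L. simpl fst in L. simpl snd in L.
      replace (0 ^ 2 + (- / sqrt 2) ^ 2) with (/ 2) in L by (rewrite -inv_sqrt2_square; ring).
      revert L. apply is_lim_ext. intros t. rewrite Cmod_mult Cmod_cexp Rmult_1_r //. }
    replace (/ (2 ^ k * sqrt 2) * d) with ((/ 2) ^ k * d * sqrt (1 - / 2)).
    * apply is_lim_Rmult; [apply is_lim_Rmult; [by apply is_lim_pow|apply is_lim_const]|].
      apply is_lim_sqrt; [lra|]. apply is_lim_Rminus => //. apply is_lim_const.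
    * replace (1 - / 2) with (/ 2) by field. rewrite sqrt_inv pow_inv Rinv_mult. ring.
  + intros t Ht. rewrite (E t Ht) inner_psi_n; auto. rewrite overlap_odd; auto. rewrite Cmod_0. unfold Rdiv. ring.
Qed.
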